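(* For every $k\in\mathbb{N}$ there is a constant $C>0$ such that the following holds. Let $\mathcal{R}$ be a rule of order $k$, let $n\ge k$, let $G$ be a graph on the vertex set $[n]$, and let $(G_i)_{i\ge0}$ be the flip process with rule $\mathcal{R}$ starting with $G_0=G$. Then for any $T>0$ and $\varepsilon>0$ we have $$\max_{i\in(0,Tn^2]\cap\mathbb{Z}}\left\|W_{G_i}-\Phi^{i/n^2}W_G\right\|_\square<\varepsilon$$ with probability at least $$1-\frac{CTe^{CT}}{\varepsilon}\exp\left((2\ln2)\,n-\frac{C\varepsilon^3n^2}{e^{CT}}\right).$$
   Context: $(\Omega,\pi)$ is a fixed atomless probability space whose sigma-algebra is separable (there is a countable family $\mathcal{C}$ of measurable sets such that for every measurable $S$ and $\delta>0$ some $T\in\mathcal{C}$ has $\pi(S\ominus T)<\delta$). $\mathcal{W}$ is the Banach space of kernels: bounded measurable functions $W:\Omega^2\to\mathbb{R}$ with $W(x,y)=W(y,x)$ a.e., identified when equal a.e., with the $L^\infty$-norm. $\mathcal{W}_0\subset\mathcal{W}$ is the set of graphons: kernels with values in $[0,1]$ a.e. The cut norm is $\|W\|_\square=\sup_{A,B\subseteq\Omega}\left|\int_{A\times B}W\,\mathrm{d}\pi^2\right|$ (supremum over measurable sets). $\mathcal{H}_k$ is the set of all (simple, labelled) graphs on vertex set $[k]$. A rule of order $k$ is a matrix $\mathcal{R}\in[0,1]^{\mathcal{H}_k\times\mathcal{H}_k}$ with $\sum_{J}\mathcal{R}_{H,J}=1$ for every $H\in\mathcal{H}_k$. The flip process with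 rule $\mathcal{R}$ on vertex set $[n]$ ($n\ge k$) started from $G_0$ is the Markov chain $(G_\ell)_{\ell\ge0}$ of graphs on $[n]$ in which $G_{\ell+1}$ is obtained from $G_\ell$ as follows: sample uniformly at random an ordered tuple $(v_1,\dots,v_k)$ of distinct vertices; let $H\in\mathcal{H}_k$ be the graph with $ij\in E(H)$ iff $v_iv_j\in E(G_\ell)$; sample $J\in\mathcal{H}_k$ with probability $\mathcal{R}_{H,J}$; for every pair $ij$ make $v_iv_j$ an edge if $ij\in E(J)$ and a non-edge otherwise, leaving all other pairs unchanged. Fix a partition $(\Omega_v:v\in[n])$ of $\Omega$ into sets of measure $1/n$. For a graph $G$ on $[n]$, its graphon representation $W_G$ equals $1$ on $\Omega_u\times\Omega_v$ if $uv\in E(G)$ and $0$ otherwise (the same partition is used for all graphs on $[n]$). For $F\in\mathcal{H}_k$, distinct $a,b\in[k]$ and $W\in\mathcal{W}$ define $$(T_F^{a,b}W)(x,y)=\int\prod_{ij\in E(F)}W(x_i,x_j)\prod_{ij\notin E(F)}(1-W(x_i,x_j))\prod_{i\in[k]\setminus\{a,b\}}\pi(\mathrm{d}x_i),\quad x_a=x,\ x_b=y,$$ where $ij$ ranges over unordered pairs of distinct elements of $[k]$. The velocity operator is $$\mathfrak{V}_{\mathcal{R}}W=\sum_{F,H\in\mathcal{H}_k}\mathcal{R}_{F,H}\sum_{1\le a\ne b\le k}T_F^{a,b}W\cdot\left(\mathbb{I}_{\{ab\in E(H)\setminus E(F)\}}-\mathbb{I}_{\{ab\in E(F)\setminus E(H)\}}\right),$$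 the inner sum being over ordered pairs. For a graphon $W$, $t\mapsto\Phi^tW$ denotes the unique solution of $\frac{\mathrm{d}}{\mathrm{d}t}\Phi^tW=\mathfrak{V}_{\mathcal{R}}\Phi^tW$, $\Phi^0W=W$ (derivative with respect to $\|\cdot\|_\infty$), which exists for all $t\ge0$ and stays in $\mathcal{W}_0$ for $t\ge 0$. *)

(* Defs.v *)
From HB Require Import structures.
From mathcomp Require Export all_boot all_order all_algebra.
From mathcomp Require Export all_classical all_reals all_analysis.

Set Implicit Arguments.
Unset Strict Implicit.
Unset Printing Implicit Defensive.

Import Order.TTheory GRing.Theory Num.Theory.
Import numFieldNormedType.Exports.

Local Open Scope classical_set_scope.
Local Open Scope ring_scope.

(** Graphs: an edge is a two-element set of vertices. *)

Definition is_edge_set (n : nat) (E : {set {set 'I_n}}) : bool :=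
  [forall e in E, #|e| == 2%N].

Record graph (n : nat) := Graph {
  edges :> {set {set 'I_n}};
  edgesP : is_edge_set edges }.

HB.instance Definition _ (n : nat) := [isSub for @edges n].
HB.instance Definition _ (n : nat) := [Finite of graph n by <:].

Lemma is_edge_set_filter (n : nat) (E : {set {set 'I_n}}) :
  is_edge_set [set e in E | #|e| == 2%N]%SET.
Proof. by apply/forall_inP => e; rewrite inE => /andP[]. Qed.

Definition mkgraph (n : nat) (E : {set {set 'I_n}}) : graph n :=
  Graph (is_edge_set_filter E).

Definition adj (n : nat) (G : graph n) (u v : 'I_n) : bool :=
  ([set u; v]%SET \in edges G).

(** Flip processes. *)

Definition is_rule (R : realType) (k : nat) (rule : graph k -> graph k -> R) :=
  (forall H J, 0 <= rule H J <= 1) /\ (forall H, \sum_J rule H J = 1).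

(* For injective [v], the graph on ['I_k] with edge [ij] iff [v_i v_j] is an
   edge of [G]. *)
Definition drawn_graph (k n : nat) (G : graph n) (v : {ffun 'I_k -> 'I_n}) :
    graph k :=
  mkgraph [set e : {set 'I_k} | (v @: e)%SET \in edges G]%SET.

(* All pairs inside the image of [v] are overwritten by the copy of [J]. *)
Definition replace_graph (k n : nat) (G : graph n) (v : {ffun 'I_k -> 'I_n})
    (J : graph k) : graph n :=
  mkgraph (edges G :\: powerset (v @: [set: 'I_k])
           :|: ((fun e : {set 'I_k} => v @: e) @: edges J))%SET.

Definition flip_transition (R : realType) (k n : nat)
    (rule : graph k -> graph k -> R) (G G' : graph n) : R :=
  \sum_(v : {ffun 'I_k -> 'I_n} | injectiveb v)
    (#|[set w : {ffun 'I_k -> 'I_n} | injectiveb w]%SET|%:R)^-1 *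
    \sum_(J : graph k | replace_graph G v J == G') rule (drawn_graph G v) J.

(* The Markov property is stated in the division-free form
   P(X_0 = g_0, ..., X_{m+1} = g_{m+1})
     = P(X_0 = g_0, ..., X_m = g_m) * p(g_m, g_{m+1}). *)
Definition flip_process (R : realType) (k n : nat)
    (rule : graph k -> graph k -> R) (G : graph n)
    (d : measure_display) (S : measurableType d) (Pr : probability S R)
    (X : nat -> S -> graph n) : Prop :=
  [/\ forall i g, measurable (X i @^-1` [set g]),
      Pr (X 0%N @^-1` [set G]) = 1%E
    & forall (m : nat) (g : nat -> graph n),
        Pr [set s | forall i, (i <= m.+1)%N -> X i s = g i] =
        (Pr [set s | forall i, (i <= m)%N -> X i s = g i] *
         (flip_transition rule (g m) (g m.+1))%:E)%E].

(** The ground probability space. *)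

Definition atomless (R : realType) (d : measure_display)
    (Omega : measurableType d) (mu : probability Omega R) : Prop :=
  forall A, measurable A -> (0 < mu A)%E ->
    exists B, [/\ measurable B, B `<=` A, (0 < mu B)%E & (mu B < mu A)%E].

Definition separable_measure (R : realType) (d : measure_display)
    (Omega : measurableType d) (mu : probability Omega R) : Prop :=
  exists2 C : set (set Omega), countable C /\ C `<=` measurable &
    forall (S : set Omega) (delta : R), measurable S -> 0 < delta ->
      exists2 A, C A & (mu (S `+` A) < delta%:E)%E.

Definition equipartition (R : realType) (d : measure_display)
    (Omega : measurableType d) (mu : probability Omega R) (n : nat)
    (Om : 'I_n -> set Omega) : Prop :=
  [/\ forall u, measurable (Om u),
      trivIset setT Om,
      \bigcup_u Om u = setT
    & forall u, mu (Om u) = (n%:R^-1)%:E].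

(** Kernels; elements of the Banach space are handled through representatives,
    so that equality in it is almost everywhere equality. *)

Definition is_kernel (R : realType) (d : measure_display)
    (Omega : measurableType d) (mu : probability Omega R)
    (W : Omega * Omega -> R) : Prop :=
  [/\ measurable_fun setT W,
      exists M : R, forall z, `|W z| <= M
    & {ae (mu \x mu)%E, forall z, W (z.1, z.2) = W (z.2, z.1)}].

Definition cut_norm (R : realType) (d : measure_display)
    (Omega : measurableType d) (mu : probability Omega R)
    (W : Omega * Omega -> R) : \bar R :=
  ereal_sup [set x : \bar R | exists A B : set Omega,
    [/\ measurable A, measurable B &
        x = `| \int[(mu \x mu)%E]_(z in A `*` B) (W z)%:E |%E]].

Definition Linfty_norm (R : realType) (d : measure_display)
    (Omega : measurableType d) (mu : probability Omega R)
    (W : Omega * Omega -> R) : \bar R :=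
  Lnorm (mu \x mu)%E +oo%E (fun z => (W z)%:E).

Definition graphon_of (R : realType) (d : measure_display)
    (Omega : measurableType d) (n : nat)
    (Om : 'I_n -> set Omega) (G : graph n) : Omega * Omega -> R :=
  \1_[set z | exists u v, [/\ adj G u v, Om u z.1 & Om v z.2]].
Arguments graphon_of {R d Omega n} Om G.

(** Velocity operator and flow. *)

(* Iterated integral of [f] over the coordinates listed in [s], the other
   coordinates being those of the argument [x]. *)
Definition iterated_integral (R : realType) (d : measure_display)
    (Omega : measurableType d) (mu : probability Omega R) (k : nat)
    (s : seq 'I_k) (f : ('I_k -> Omega) -> R) : ('I_k -> Omega) -> R :=
  foldr (fun (i : 'I_k) (g : ('I_k -> Omega) -> R) (x : 'I_k -> Omega) =>
    \int[mu]_t g [eta x with i |-> t]) f s.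

(* An unordered pair [ij] is represented by its ordering with [i < j]; as [W] is
   symmetric a.e., this only affects values on a null set. *)
Definition induced_weight (R : realType) (d : measure_display)
    (Omega : measurableType d) (k : nat) (F : graph k)
    (W : Omega * Omega -> R) (x : 'I_k -> Omega) : R :=
  (\prod_(p : 'I_k * 'I_k | (p.1 < p.2)%N && adj F p.1 p.2)
     W (x p.1, x p.2)) *
  (\prod_(p : 'I_k * 'I_k | (p.1 < p.2)%N && ~~ adj F p.1 p.2)
     (1 - W (x p.1, x p.2))).

Definition rooted_density (R : realType) (d : measure_display)
    (Omega : measurableType d) (mu : probability Omega R) (k : nat)
    (F : graph k) (a b : 'I_k) (W : Omega * Omega -> R)
    (z : Omega * Omega) : R :=
  iterated_integral mu [seq i <- enum 'I_k | (i != a) && (i != b)]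
    (induced_weight F W) (fun i => if i == a then z.1 else z.2).

Definition velocity (R : realType) (d : measure_display)
    (Omega : measurableType d) (mu : probability Omega R) (k : nat)
    (rule : graph k -> graph k -> R) (W : Omega * Omega -> R)
    (z : Omega * Omega) : R :=
  \sum_(F : graph k) \sum_(H : graph k) rule F H *
    \sum_(p : 'I_k * 'I_k | p.1 != p.2)
      rooted_density mu F p.1 p.2 W z *
      ((adj H p.1 p.2 && ~~ adj F p.1 p.2)%:R -
       (adj F p.1 p.2 && ~~ adj H p.1 p.2)%:R).

(* [Phi t], for [t >= 0], is a kernel-valued solution of the flip ODE with
   initial value [W]; the derivative is one-sided at [t = 0], and the values of
   [Phi] at negative times are irrelevant. *)
Definition is_trajectory (R : realType) (d : measure_display)
    (Omega : measurableType d) (mu : probability Omega R) (k : nat)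
    (rule : graph k -> graph k -> R) (W : Omega * Omega -> R)
    (Phi : R -> Omega * Omega -> R) : Prop :=
  [/\ forall t : R, 0 <= t -> is_kernel mu (Phi t),
      {ae (mu \x mu)%E, forall z, Phi 0 z = W z}
    & forall t : R, 0 <= t ->
        Linfty_norm mu (fun z =>
          (Phi (t + h) z - Phi t z) / h - velocity mu rule (Phi t) z)
        @[h --> within [set h | 0 <= t + h] 0^'] --> 0%E].

(* Main.v *)
Require Import Defs.
From mathcomp Require Import all_boot all_order all_algebra.
From mathcomp Require Import all_classical all_reals all_analysis.
From mathcomp Require Import measurable_realfun ess_sup_inf ring lra zify.

Set Implicit Arguments.
Unset Strict Implicit.
Unset Printing Implicit Defensive.

Import Order.TTheory GRing.Theory Num.Theory.
Import numFieldNormedType.Exports.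

Local Open Scope classical_set_scope.
Local Open Scope ring_scope.

(** Test the graphons against rectangles [A * B]. For the flip process the test
    value is a martingale plus the accumulated drift, and the drift in one step is
    [n^-2] times the test value of the velocity of [W_G], up to [O(1/n)]: the flip
    process samples [k] vertices without replacement, the velocity operator with
    replacement. The trajectory satisfies the same recursion up to [O(n^-4)], and
    since the velocity is Lipschitz in cut norm on graphons, a discrete Gronwall
    argument bounds the cut distance by [expR (L T)] times the largest martingale
    deviation plus [O(1/n)]. By bilinearity only the [4^n] rectangles made of whole
    cells matter, and for each of them the running maximum of a martingale with
    bounded increments is controlled by exponential moments.

    The Lipschitz estimate needs [0 <= Phi t <= 1]. This is proved by testing the
    trajectory against the sign of its excess over [0,1]: the velocity points
    inwards there, up to an error linear in the total excess.

    Both graphons move at bounded speed, so nothing can happen unless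
    [eps = O(T)]; this turns the exponent [eps^2 n^2 / T] of the martingale bound
    into the required one. *)

(** * Integrals of bounded measurable functions *)

(** The flow takes values in kernels modulo null sets, but it is only used through the scalar
    functions sending [t] to the integral of [w * Phi t]; these are differentiable on the half line,
    so real calculus suffices. The drift on one rectangle depends on the graphon on all rectangles,
    which is why the comparison is run over all pairs of sets at once, with the martingale part
    subtracted: the noise is then bounded once, by its running maximum, instead of being summed over
    the steps.

    A single [C] serves as prefactor, as factor in the exponent and inside [expR (C * T)]. Half of
    the growth of [expR (C * T)] absorbs the Gronwall loss; the other half, through
    [expR y >= y ^+ 2 / 4], beats the polynomial factors that arise once [eps] is replaced by a
    multiple of [T]. The [O(1/n)] error can exceed the tolerance only when [n * eps] is below a
    multiple of [expR (L' * T)]; then [C * eps ^+ 3 * n ^+ 2 / expR (C * T)] is at most [n], and the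
    claimed lower bound is not positive. *)

Definition bmeas (R : realType) d (T : measurableType d) (f : T -> R) :=
  measurable_fun setT f /\ exists M : R, forall x, `|f x| <= M.

Section bmeas_closure.
Context {R : realType} d {T : measurableType d}.
Implicit Types f g : T -> R.

Lemma bmeas_cst (c : R) : bmeas (fun _ : T => c).
Proof. by split; [exact: measurable_cst|exists `|c|]. Qed.

Lemma bmeasD f g : bmeas f -> bmeas g -> bmeas (fun x => f x + g x).
Proof.
move=> [mf [M fM]] [mg [N gN]]; split; first exact: measurable_funD.
by exists (M + N) => x; rewrite (le_trans (ler_normD _ _))// lerD.
Qed.

Lemma bmeasN f : bmeas f -> bmeas (fun x => - f x).
Proof.
move=> [mf [M fM]]; split; first exact: measurableT_comp.
by exists M => x; rewrite normrN.
Qed.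

Lemma bmeasB f g : bmeas f -> bmeas g -> bmeas (fun x => f x - g x).
Proof. by move=> bf /bmeasN; exact: bmeasD. Qed.

Lemma bmeasM f g : bmeas f -> bmeas g -> bmeas (fun x => f x * g x).
Proof.
move=> [mf [M fM]] [mg [N gN]]; split; first exact: measurable_funM.
by exists (M * N) => x; rewrite normrM ler_pM.
Qed.

Lemma bmeas_norm f : bmeas f -> bmeas (fun x => `|f x|).
Proof.
move=> [mf [M fM]]; split; first exact: measurableT_comp.
by exists M => x; rewrite normr_id.
Qed.

Lemma bmeas_max f g : bmeas f -> bmeas g -> bmeas (fun x => Num.max (f x) (g x)).
Proof.
move=> [mf [M fM]] [mg [N gN]]; split; first exact: measurable_maxr.
exists (Num.max M N) => x.
by rewrite le_max; case: (leP (f x) (g x)) => _; rewrite ?fM ?gN ?orbT.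
Qed.

Lemma bmeas_min f g : bmeas f -> bmeas g -> bmeas (fun x => Num.min (f x) (g x)).
Proof.
move=> bf bg; have := bmeasN (bmeas_max (bmeasN bf) (bmeasN bg)).
by under eq_fun do rewrite oppr_max !opprK.
Qed.

Lemma bmeas_indic (A : set T) : measurable A -> bmeas (\1_A : T -> R).
Proof.
move=> mA; split; first exact: measurable_indic.
by exists 1 => x; rewrite indicE; case: (_ \in _); rewrite ?normr1 ?normr0.
Qed.

Lemma bmeas_sum (I : Type) (r : seq I) (P : pred I) (F : I -> T -> R) :
  (forall i, bmeas (F i)) -> bmeas (fun x => \sum_(i <- r | P i) F i x).
Proof.
move=> bF; elim: r => [|i r IH].
  by under eq_fun do rewrite big_nil; exact: bmeas_cst.
under eq_fun do rewrite big_cons.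
by case: (P i) => //; exact: bmeasD.
Qed.

Lemma bmeas_comp d' (T' : measurableType d') (phi : T' -> T) f :
  measurable_fun setT phi -> bmeas f -> bmeas (fun x => f (phi x)).
Proof.
move=> mphi [mf [M fM]]; split; first exact: measurableT_comp.
by exists M.
Qed.

End bmeas_closure.

Section bmeas_integral.
Context {R : realType} d {T : measurableType d} (P : probability T R).
Implicit Types f g : T -> R.

Lemma bmeas_integrable (A : set T) f :
  measurable A -> bmeas f -> P.-integrable A (EFin \o f).
Proof.
move=> mA [mf [M fM]]; apply: measurable_bounded_integrable => //.
- by rewrite (le_lt_trans (probability_le1 P mA))// ltry.
- exact: measurable_funTS.
- exists M; split; first by rewrite num_real.
  by move=> x Mx t _ /=; rewrite (le_trans (fM t))// ltW.
Qed.
Let intT f := @bmeas_integrable setT f measurableT.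

Lemma bint_cst (c : R) : \int[P]_x c = c.
Proof.
rewrite Rintegral_cst//= probability_setT/= mulr1//.
Qed.

Lemma bintD f g : bmeas f -> bmeas g ->
  \int[P]_x (f x + g x) = \int[P]_x f x + \int[P]_x g x.
Proof. by move=> bf bg; rewrite RintegralD//; exact: intT. Qed.

Lemma bintB f g : bmeas f -> bmeas g ->
  \int[P]_x (f x - g x) = \int[P]_x f x - \int[P]_x g x.
Proof. by move=> bf bg; rewrite RintegralB//; exact: intT. Qed.

Lemma bintZ (c : R) f : bmeas f -> \int[P]_x (c * f x) = c * \int[P]_x f x.
Proof. by move=> bf; rewrite RintegralZl//; exact: intT. Qed.

Lemma bintN f : bmeas f -> \int[P]_x (- f x) = - \int[P]_x f x.
Proof.
move=> bf; rewrite -mulN1r -bintZ//; apply: eq_Rintegral => x _.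
by rewrite mulN1r.
Qed.

Lemma bint_sum (I : Type) (r : seq I) (Q : pred I) (F : I -> T -> R) :
  (forall i, bmeas (F i)) ->
  \int[P]_x (\sum_(i <- r | Q i) F i x) = \sum_(i <- r | Q i) \int[P]_x F i x.
Proof.
move=> bF; elim: r => [|i r IH].
  by under eq_Rintegral do rewrite big_nil; rewrite bint_cst big_nil.
under eq_Rintegral do rewrite big_cons.
rewrite big_cons; case: (Q i) => //.
by rewrite bintD ?IH//; exact: bmeas_sum.
Qed.

Lemma bint_le f g : bmeas f -> bmeas g -> (forall x, f x <= g x) ->
  \int[P]_x f x <= \int[P]_x g x.
Proof. by move=> bf bg fg; apply: le_Rintegral => //; exact: intT. Qed.

Lemma bint_norm f : bmeas f -> `|\int[P]_x f x| <= \int[P]_x `|f x|.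
Proof. by move=> bf; apply: le_normr_Rintegral => //; exact: intT. Qed.

Lemma bint_ae f g : bmeas f -> bmeas g -> {ae P, forall x, f x = g x} ->
  \int[P]_x f x = \int[P]_x g x.
Proof.
move=> bf bg fg; rewrite /Rintegral; congr fine.
apply: ae_eq_integral => //.
- by apply/measurable_EFinP; case: bf.
- by apply/measurable_EFinP; case: bg.
- by apply: filterS fg => x /= -> _.
Qed.

Lemma bint_le_ae f g : bmeas f -> bmeas g -> {ae P, forall x, f x <= g x} ->
  \int[P]_x f x <= \int[P]_x g x.
Proof.
move=> bf bg fg.
(* [f] agrees almost everywhere with the minimum, which is below [g] everywhere. *)
rewrite (@bint_ae f (fun x => Num.min (f x) (g x)))//.
- apply: bint_le => //; first exact: bmeas_min.
  by move=> x; rewrite ge_min lexx orbT.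
- exact: bmeas_min.
- by apply: filterS fg => x /= /min_idPl.
Qed.

Lemma bint_norm_le f (c : R) : bmeas f -> (forall x, `|f x| <= c) ->
  `|\int[P]_x f x| <= c.
Proof.
move=> bf fc; rewrite (le_trans (bint_norm bf))//.
by rewrite -[leRHS]bint_cst; apply: bint_le => //; [exact: bmeas_norm|exact: bmeas_cst].
Qed.

Lemma bint_norm_le_ae f (c : R) : bmeas f -> {ae P, forall x, `|f x| <= c} ->
  `|\int[P]_x f x| <= c.
Proof.
move=> bf fc; rewrite (le_trans (bint_norm bf))//.
by rewrite -[leRHS]bint_cst; apply: bint_le_ae => //; [exact: bmeas_norm|exact: bmeas_cst].
Qed.

Lemma bint_indic (A : set T) : measurable A -> \int[P]_x \1_A x = fine (P A).
Proof. by move=> mA; rewrite /Rintegral integral_indic// setIT. Qed.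

Lemma bint_setE (A : set T) f : measurable A ->
  \int[P]_(x in A) f x = \int[P]_x (\1_A x * f x).
Proof.
move=> mA; rewrite Rintegral_mkcond; apply: eq_Rintegral => x _.
by rewrite patchE indicE; case: ifP; rewrite ?mul1r ?mul0r.
Qed.

Lemma bint_eq0_ae f : bmeas f -> \int[P]_x `|f x| = 0 -> {ae P, forall x, f x = 0}.
Proof.
move=> bf f0.
have : (\int[P]_x `|(f x)%:E| = 0)%E.
  have := intT (bmeas_norm bf) => /integrable_fin_num -/(_ measurableT) /fineK <-.
  by move: f0; rewrite /Rintegral => ->.
have mEf : measurable_fun setT (fun x => (f x)%:E).
  by apply/measurable_EFinP; case: bf.
move/(proj1 (ae_eq_integral_abs P measurableT mEf)).
by apply: filterS => x /= /(_ I) [].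
Qed.

End bmeas_integral.

Section bmeas_fubini.
Context {R : realType} d1 {T1 : measurableType d1} d2 {T2 : measurableType d2}.
Variables (P1 : probability T1 R) (P2 : probability T2 R).
Variable f : T1 * T2 -> R.
Hypothesis bf : bmeas f.

Let intf := @bmeas_integrable R _ _ (P1 \x P2)%E setT f measurableT bf.

Lemma bmeas_fst x : bmeas (fun y => f (x, y)).
Proof. by apply: bmeas_comp bf; exact: measurable_pair1. Qed.

Lemma bmeas_snd y : bmeas (fun x => f (x, y)).
Proof. by apply: bmeas_comp bf; exact: measurable_pair2. Qed.

Lemma EFin_Rintegral_fst x :
  (\int[P2]_y f (x, y))%:E = (\int[P2]_y (f (x, y))%:E)%E.
Proof.
rewrite /Rintegral fineK//; apply: integrable_fin_num => //.
by apply: (bmeas_integrable P2 measurableT); exact: bmeas_fst.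
Qed.

Lemma EFin_Rintegral_snd y :
  (\int[P1]_x f (x, y))%:E = (\int[P1]_x (f (x, y))%:E)%E.
Proof.
rewrite /Rintegral fineK//; apply: integrable_fin_num => //.
by apply: (bmeas_integrable P1 measurableT); exact: bmeas_snd.
Qed.

Lemma bmeas_int_fst : bmeas (fun x => \int[P2]_y f (x, y)).
Proof.
split.
  apply/measurable_EFinP.
  rewrite (_ : EFin \o _ = fubini_F P2 (EFin \o f)); last first.
    by apply/funext => x; exact: EFin_Rintegral_fst.
  exact: measurable_fubini_F intf.
by have [_ [M fM]] := bf; exists M => x; apply: bint_norm_le => //; exact: bmeas_fst.
Qed.

Lemma bmeas_int_snd : bmeas (fun y => \int[P1]_x f (x, y)).
Proof.
split.
  apply/measurable_EFinP.
  rewrite (_ : EFin \o _ = fubini_G P1 (EFin \o f)); last first.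
    by apply/funext => x; exact: EFin_Rintegral_snd.
  exact: measurable_fubini_G intf.
by have [_ [M fM]] := bf; exists M => x; apply: bint_norm_le => //; exact: bmeas_snd.
Qed.

Lemma bint_prod12 : \int[(P1 \x P2)%E]_z f z = \int[P1]_x \int[P2]_y f (x, y).
Proof.
rewrite /Rintegral; congr fine; rewrite -(integral12_prod_meas1 intf).
by apply: eq_integral => x _; rewrite EFin_Rintegral_fst.
Qed.

Lemma bint_prod21 : \int[(P1 \x P2)%E]_z f z = \int[P2]_y \int[P1]_x f (x, y).
Proof.
rewrite /Rintegral; congr fine; rewrite -(integral21_prod_meas1 intf).
by apply: eq_integral => x _; rewrite EFin_Rintegral_snd.
Qed.

End bmeas_fubini.

(** * Rectangle tests and the cut norm *)

Section cut_functions.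
Context {R : realType} d {T : measurableType d} (P : probability T R).
Implicit Types (K : T * T -> R) (u v : T -> R).

(** Written with indicator weights rather than as an integral over a product set, so that it is one
    value of the bilinear form whose extrema over [[0,1]]-valued weights are needed below. *)
Definition box_int K (A B : set T) : R :=
  \int[(P \x P)%E]_z (\1_A z.1 * \1_B z.2 * K z).

Lemma bmeas_rect u v K : bmeas u -> bmeas v -> bmeas K ->
  bmeas (fun z : T * T => u z.1 * v z.2 * K z).
Proof.
move=> bu bv bK; apply: bmeasM => //; apply: bmeasM.
  by apply: bmeas_comp bu; exact: measurable_fst.
by apply: bmeas_comp bv; exact: measurable_snd.
Qed.

Lemma bmeas_posset u : bmeas u -> measurable [set x | 0 <= u x].
Proof.
move=> [mu _]; rewrite -[X in measurable X]setTI.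
rewrite [X in _ `&` X](_ : _ = u @^-1` `[0, +oo[); first exact: mu.
by apply/seteqP; split => x /=; rewrite in_itv/= andbT.
Qed.

(* A bilinear functional is maximised over [0,1]-valued functions at
   indicators: replace first [u], then [v], by the indicator of the set where
   its partial integral against the other is nonnegative. *)
Lemma box_int_fun_le K u v (r : R) : bmeas K -> bmeas u -> bmeas v ->
  (forall x, 0 <= u x <= 1) -> (forall x, 0 <= v x <= 1) ->
  (forall A B, measurable A -> measurable B -> box_int K A B <= r) ->
  \int[(P \x P)%E]_z (u z.1 * v z.2 * K z) <= r.
Proof.
move=> bK bu bv u01 v01 Kr.
have [A mA uA] : exists2 A, measurable A &
  \int[(P \x P)%E]_z (u z.1 * v z.2 * K z) <=
  \int[(P \x P)%E]_z (\1_A z.1 * v z.2 * K z).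
  pose k x := \int[P]_y (v y * K (x, y)).
  have b1 : bmeas (fun z : T * T => v z.2 * K z).
    by apply: bmeasM => //; apply: bmeas_comp bv; exact: measurable_snd.
  have bk : bmeas k by apply: (bmeas_int_fst P P b1).
  exists [set x | 0 <= k x]; first exact: bmeas_posset.
  have E w : bmeas w -> \int[(P \x P)%E]_z (w z.1 * v z.2 * K z) =
      \int[P]_x (w x * k x).
    move=> bw; rewrite bint_prod12; last exact: bmeas_rect.
    apply: eq_Rintegral => x _; rewrite /k -bintZ; last exact: (bmeas_fst b1).
    by apply: eq_Rintegral => y _ /=; rewrite mulrA.
  have b1A := bmeas_indic (R := R) (bmeas_posset bk).
  rewrite !E//; apply: bint_le; [exact: bmeasM|exact: bmeasM|move=> x].
  have /andP[? ?] := u01 x; rewrite indicE; have [kx|kx] := leP 0 (k x).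
    by rewrite mem_set//= mul1r ler_piMl.
  rewrite memNset/=; last by apply/negP; rewrite -ltNge.
  by rewrite mul0r mulr_ge0_le0// ltW.
have b1A := bmeas_indic (R := R) mA.
have [B mB vB] : exists2 B, measurable B &
  \int[(P \x P)%E]_z (\1_A z.1 * v z.2 * K z) <= box_int K A B.
  pose k y := \int[P]_x (\1_A x * K (x, y)).
  have b1 : bmeas (fun z : T * T => \1_A z.1 * K z).
    by apply: bmeasM => //; apply: bmeas_comp b1A; exact: measurable_fst.
  have bk : bmeas k by apply: (bmeas_int_snd P P b1).
  exists [set x | 0 <= k x]; first exact: bmeas_posset.
  have E w : bmeas w -> \int[(P \x P)%E]_z (\1_A z.1 * w z.2 * K z) =
      \int[P]_x (w x * k x).
    move=> bw; rewrite bint_prod21; last exact: bmeas_rect.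
    apply: eq_Rintegral => y _; rewrite /k -bintZ; last exact: (bmeas_snd b1).
    by apply: eq_Rintegral => x _ /=; rewrite mulrCA mulrA.
  have b1B := bmeas_indic (R := R) (bmeas_posset bk).
  rewrite /box_int !E//; apply: bint_le; [exact: bmeasM|exact: bmeasM|move=> x].
  have /andP[? ?] := v01 x; rewrite indicE; have [kx|kx] := leP 0 (k x).
    by rewrite mem_set//= mul1r ler_piMl.
  rewrite memNset/=; last by apply/negP; rewrite -ltNge.
  by rewrite mul0r mulr_ge0_le0// ltW.
by rewrite (le_trans uA)// (le_trans vB)// Kr.
Qed.

Lemma box_intN K A B : bmeas K -> measurable A -> measurable B ->
  box_int (fun z => - K z) A B = - box_int K A B.
Proof.
move=> bK mA mB; rewrite /box_int -bintN.
  by apply: eq_Rintegral => z _; rewrite mulrN.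
by apply: bmeas_rect => //; exact: bmeas_indic.
Qed.

Lemma box_intD K K' A B : bmeas K -> bmeas K' -> measurable A -> measurable B ->
  box_int (fun z => K z + K' z) A B = box_int K A B + box_int K' A B.
Proof.
move=> bK bK' mA mB; rewrite /box_int -bintD.
- by apply: eq_Rintegral => z _; rewrite mulrDr.
- by apply: bmeas_rect => //; exact: bmeas_indic.
- by apply: bmeas_rect => //; exact: bmeas_indic.
Qed.

Lemma box_intB K K' A B : bmeas K -> bmeas K' -> measurable A -> measurable B ->
  box_int (fun z => K z - K' z) A B = box_int K A B - box_int K' A B.
Proof.
move=> bK bK' mA mB; rewrite box_intD ?box_intN//; exact: bmeasN.
Qed.

Lemma box_int_fun_norm K u v (r : R) : bmeas K -> bmeas u -> bmeas v ->
  (forall x, 0 <= u x <= 1) -> (forall x, 0 <= v x <= 1) ->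
  (forall A B, measurable A -> measurable B -> `|box_int K A B| <= r) ->
  `|\int[(P \x P)%E]_z (u z.1 * v z.2 * K z)| <= r.
Proof.
move=> bK bu bv u01 v01 Kr.
have Kr' A B : measurable A -> measurable B -> - r <= box_int K A B <= r.
  by move=> mA mB; rewrite -ler_norml Kr.
rewrite ler_norml; apply/andP; split; last first.
  by apply: box_int_fun_le => // A B mA mB; have /andP[] := Kr' _ _ mA mB.
rewrite lerNl -bintN; last exact: bmeas_rect.
under eq_Rintegral do rewrite -mulrN.
apply: box_int_fun_le => //; first exact: bmeasN.
by move=> A B mA mB; rewrite box_intN// lerNl; have /andP[] := Kr' _ _ mA mB.
Qed.

Lemma cut_norm_le K (r : R) : bmeas K ->
  (forall A B, measurable A -> measurable B -> `|box_int K A B| <= r) ->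
  (cut_norm P K <= r%:E)%E.
Proof.
move=> bK Kr; apply: ge_ereal_sup => _ [A [B [mA mB ->]]].
have mAB : measurable (A `*` B) by exact: measurableX.
rewrite -EFin_normr_Rintegral//; last exact: bmeas_integrable.
rewrite lee_fin (le_trans _ (Kr A B mA mB))// bint_setE// le_eqVlt; apply/orP; left.
apply/eqP; congr (`| _ |); apply: eq_Rintegral => z _.
by rewrite !indicE in_setX; case: (_ \in A); case: (_ \in B);
  rewrite /= ?(mul1r, mul0r, mulr0).
Qed.

End cut_functions.

(** * Iterated integrals *)

Section iterated.
Context {R : realType} d {Omega : measurableType d} (mu : probability Omega R).
Variable k : nat.
Implicit Types (f g : ('I_k -> Omega) -> R) (X : 'I_k -> Omega) (s : seq 'I_k).
Local Notation I s f := (iterated_integral mu s f).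

(* Bounded, and measurable along every family of measurable coordinate maps:
   this replaces measurability for the product sigma-algebra on ['I_k -> Omega]. *)
Definition cyl_bmeas f :=
  (exists M : R, forall x, `|f x| <= M) /\
  forall d' (T : measurableType d') (P : probability T R) (phi : 'I_k -> T -> Omega),
    (forall i, measurable_fun setT (phi i)) ->
    measurable_fun setT (fun t => f (fun i => phi i t)).

Lemma cyl_bmeasE f d' (T : measurableType d') (P : probability T R)
    (phi : 'I_k -> T -> Omega) : cyl_bmeas f ->
  (forall i, measurable_fun setT (phi i)) -> bmeas (fun t => f (fun i => phi i t)).
Proof. by move=> [[M fM] mf] mphi; split; [exact: mf|exists M]. Qed.

Lemma cyl_bmeas_intro f :
  (exists M : R, forall x, `|f x| <= M) ->
  (forall d' (T : measurableType d') (P : probability T R) (phi : 'I_k -> T -> Omega),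
    (forall i, measurable_fun setT (phi i)) -> bmeas (fun t => f (fun i => phi i t))) ->
  cyl_bmeas f.
Proof. by move=> fM bf; split => // d' T P phi mphi; have [] := bf _ T P phi mphi. Qed.

Lemma cyl_bmeas_cst (c : R) : cyl_bmeas (fun=> c).
Proof.
split; first by exists `|c|.
by move=> d' T P phi _; exact: measurable_cst.
Qed.

Lemma cyl_bmeasD f g : cyl_bmeas f -> cyl_bmeas g -> cyl_bmeas (fun x => f x + g x).
Proof.
move=> bf bg; apply: cyl_bmeas_intro.
  have [[M fM] _] := bf; have [[N gN] _] := bg.
  by exists (M + N) => x; rewrite (le_trans (ler_normD _ _))// lerD.
by move=> d' T P phi mphi; apply: bmeasD; apply: cyl_bmeasE.
Qed.

Lemma cyl_bmeasM f g : cyl_bmeas f -> cyl_bmeas g -> cyl_bmeas (fun x => f x * g x).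
Proof.
move=> bf bg; apply: cyl_bmeas_intro.
  have [[M fM] _] := bf; have [[N gN] _] := bg.
  by exists (M * N) => x; rewrite normrM ler_pM.
by move=> d' T P phi mphi; apply: bmeasM; apply: cyl_bmeasE.
Qed.

Lemma cyl_bmeasN f : cyl_bmeas f -> cyl_bmeas (fun x => - f x).
Proof.
move=> bf; under eq_fun do rewrite -mulN1r.
by apply: cyl_bmeasM => //; exact: cyl_bmeas_cst.
Qed.

Lemma cyl_bmeasB f g : cyl_bmeas f -> cyl_bmeas g -> cyl_bmeas (fun x => f x - g x).
Proof. by move=> bf bg; apply: cyl_bmeasD => //; exact: cyl_bmeasN. Qed.

Lemma cyl_bmeas_norm f : cyl_bmeas f -> cyl_bmeas (fun x => `|f x|).
Proof.
move=> bf; apply: cyl_bmeas_intro.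
  by have [[M fM] _] := bf; exists M => x; rewrite normr_id.
by move=> d' T P phi mphi; apply: bmeas_norm; apply: cyl_bmeasE.
Qed.

Lemma cyl_bmeas_sum (J : Type) (r : seq J) (Q : pred J)
    (F : J -> ('I_k -> Omega) -> R) :
  (forall i, cyl_bmeas (F i)) -> cyl_bmeas (fun x => \sum_(i <- r | Q i) F i x).
Proof.
move=> bF; elim: r => [|i r IH].
  by under eq_fun do rewrite big_nil; exact: cyl_bmeas_cst.
under eq_fun do rewrite big_cons.
by case: (Q i) => //; exact: cyl_bmeasD.
Qed.

Lemma cyl_bmeas_prod (J : Type) (r : seq J) (Q : pred J)
    (F : J -> ('I_k -> Omega) -> R) :
  (forall i, cyl_bmeas (F i)) -> cyl_bmeas (fun x => \prod_(i <- r | Q i) F i x).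
Proof.
move=> bF; elim: r => [|i r IH].
  by under eq_fun do rewrite big_nil; exact: cyl_bmeas_cst.
under eq_fun do rewrite big_cons.
by case: (Q i) => //; exact: cyl_bmeasM.
Qed.

Lemma cyl_bmeas_pair (W : Omega * Omega -> R) i j :
  bmeas W -> cyl_bmeas (fun x => W (x i, x j)).
Proof.
move=> bW; apply: cyl_bmeas_intro; first by have [_ [M WM]] := bW; exists M.
move=> d' T P phi mphi; apply: bmeas_comp bW.
exact: measurable_fun_pair.
Qed.

Lemma cyl_bmeas_coord (u : Omega -> R) i :
  bmeas u -> cyl_bmeas (fun x => u (x i)).
Proof.
move=> bu; apply: cyl_bmeas_intro; first by have [_ [M uM]] := bu; exists M.
by move=> d' T P phi mphi; exact: bmeas_comp bu.
Qed.

Lemma bmeas_eta f i X : cyl_bmeas f -> bmeas (fun t => f [eta X with i |-> t]).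
Proof.
move=> bf.
apply: (@cyl_bmeasE f _ _ mu (fun j t => [eta X with i |-> t] j)) => // j /=.
by case: (j == i); [exact: measurable_id|exact: measurable_cst].
Qed.

Lemma bmeas_eta2 f i j X : cyl_bmeas f ->
  bmeas (fun z : Omega * Omega => f [eta [eta X with i |-> z.1] with j |-> z.2]).
Proof.
move=> bf.
apply: (@cyl_bmeasE f _ _ (mu \x mu)%E
  (fun l z => [eta [eta X with i |-> z.1] with j |-> z.2] l)) => // l /=.
case: (l == j); first exact: measurable_snd.
by case: (l == i); [exact: measurable_fst|exact: measurable_cst].
Qed.

(** Measurability in the parameters is Fubini for [P \x mu]; it is for this that [cyl_bmeas] carries
    a probability [P] on the parameter space. *)
Lemma cyl_bmeas_int f i : cyl_bmeas f ->
  cyl_bmeas (fun x => \int[mu]_t f [eta x with i |-> t]).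
Proof.
move=> bf; split.
  have [[M fM] _] := bf; exists M => x; apply: bint_norm_le => //; exact: bmeas_eta.
move=> d' T P phi mphi.
have bg : bmeas (fun z : T * Omega => f [eta (phi^~ z.1) with i |-> z.2]).
  apply: (@cyl_bmeasE f _ _ (P \x mu)%E
    (fun l z => [eta (phi^~ z.1) with i |-> z.2] l)) => // l /=.
  case: (l == i); first exact: measurable_snd.
  apply: measurableT_comp => //; exact: measurable_fst.
by have [] := bmeas_int_fst P mu bg.
Qed.

Lemma cyl_bmeas_iint s f : cyl_bmeas f -> cyl_bmeas (I s f).
Proof. by move=> bf; elim: s => //= i s IH; exact: cyl_bmeas_int. Qed.

Lemma iint_cat s1 s2 f : I (s1 ++ s2) f = I s1 (I s2 f).
Proof. by rewrite /iterated_integral foldr_cat. Qed.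

Lemma iint_cst s (c : R) : I s (fun=> c) = fun=> c.
Proof.
elim: s => //= i s ->; apply/funext => X; exact: bint_cst.
Qed.

Lemma iint_le s f g X : cyl_bmeas f -> cyl_bmeas g -> (forall x, f x <= g x) ->
  I s f X <= I s g X.
Proof.
move=> bf bg fg; elim: s X => //= i s IH X.
by apply: bint_le => //; apply: bmeas_eta; exact: cyl_bmeas_iint.
Qed.

Lemma iintD s f g X : cyl_bmeas f -> cyl_bmeas g ->
  I s (fun x => f x + g x) X = I s f X + I s g X.
Proof.
move=> bf bg; elim: s X => //= i s IH X.
rewrite -bintD; try by apply: bmeas_eta; exact: cyl_bmeas_iint.
by apply: eq_Rintegral => t _; exact: IH.
Qed.

Lemma iintZ s (c : R) f X : cyl_bmeas f ->
  I s (fun x => c * f x) X = c * I s f X.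
Proof.
move=> bf; elim: s X => //= i s IH X.
rewrite -bintZ; last by apply: bmeas_eta; exact: cyl_bmeas_iint.
by apply: eq_Rintegral => t _; exact: IH.
Qed.

Lemma iintN s f X : cyl_bmeas f -> I s (fun x => - f x) X = - I s f X.
Proof.
move=> bf; rewrite -mulN1r -iintZ//; congr iterated_integral.
by apply/funext => x; rewrite mulN1r.
Qed.

Lemma iintB s f g X : cyl_bmeas f -> cyl_bmeas g ->
  I s (fun x => f x - g x) X = I s f X - I s g X.
Proof. by move=> bf bg; rewrite iintD ?iintN//; exact: cyl_bmeasN. Qed.

Lemma iint_sum s (J : Type) (r : seq J) (Q : pred J)
    (F : J -> ('I_k -> Omega) -> R) X :
  (forall i, cyl_bmeas (F i)) ->
  I s (fun x => \sum_(i <- r | Q i) F i x) X = \sum_(i <- r | Q i) I s (F i) X.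
Proof.
move=> bF; elim: r => [|i r IH].
  by under eq_fun do rewrite big_nil; rewrite iint_cst big_nil.
under [in LHS]eq_fun do rewrite big_cons.
rewrite big_cons; case: (Q i) => //.
by rewrite iintD ?IH//; exact: cyl_bmeas_sum.
Qed.

Lemma iint_norm s f X : cyl_bmeas f -> `|I s f X| <= I s (fun x => `|f x|) X.
Proof.
move=> bf; rewrite ler_norml -iintN; last exact: cyl_bmeas_norm.
have bn := cyl_bmeas_norm bf; have bN := cyl_bmeasN bn; apply/andP; split; apply: iint_le => // x.
- by rewrite lerNl -normrN ler_norm.
- exact: ler_norm.
Qed.

Lemma iint_norm_le s f X (c : R) : cyl_bmeas f -> (forall x, `|f x| <= c) ->
  `|I s f X| <= c.
Proof.
move=> bf fc; rewrite (le_trans (iint_norm s X bf))//.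
have <- : I s (fun=> c) X = c by rewrite iint_cst.
by apply: iint_le => //; [exact: cyl_bmeas_norm|exact: cyl_bmeas_cst].
Qed.

Lemma iint_agree s f X Y : (forall i, i \notin s -> X i = Y i) -> I s f X = I s f Y.
Proof.
elim: s X Y => [|i s IH] X Y XY /=.
  by congr f; apply/funext => i; exact: XY.
apply: eq_Rintegral => t _; apply: IH => j js /=.
by case: eqVneq => // ji; apply: XY; rewrite inE negb_or ji.
Qed.

Definition indep s f := forall i X t, i \in s -> f [eta X with i |-> t] = f X.

Lemma iintMl s f g X : cyl_bmeas f -> indep s g ->
  I s (fun x => g x * f x) X = g X * I s f X.
Proof.
move=> bf; elim: s X => //= i s IH X ig.
rewrite -bintZ; last by apply: bmeas_eta; exact: cyl_bmeas_iint.
apply: eq_Rintegral => t _; rewrite IH => [|j Y u js].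
  by rewrite ig ?mem_head.
by rewrite ig// in_cons js orbT.
Qed.

Lemma iint_indep s f X : indep s f -> I s f X = f X.
Proof.
move=> sf; have := iintMl X (cyl_bmeas_cst 1) sf.
rewrite iint_cst mulr1 => <-; congr iterated_integral.
by apply/funext => x; rewrite mulr1.
Qed.

Lemma eta_swap X i j t u : i != j ->
  [eta [eta X with i |-> t] with j |-> u] =
  [eta [eta X with j |-> u] with i |-> t] :> ('I_k -> Omega).
Proof.
move=> ij; apply/funext => l /=; case: eqVneq => [->|//].
by rewrite eq_sym (negbTE ij).
Qed.

Lemma iint2E i j f X : cyl_bmeas f ->
  I [:: i; j] f X = \int[(mu \x mu)%E]_z f [eta [eta X with i |-> z.1] with j |-> z.2].
Proof. by move=> bf; rewrite (bint_prod12 mu mu (bmeas_eta2 i j X bf)). Qed.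

Lemma iint_swap i j s f : i != j -> cyl_bmeas f ->
  I [:: i, j & s] f = I [:: j, i & s] f.
Proof.
move=> ij bf; apply/funext => X.
have bs := cyl_bmeas_iint s bf.
transitivity (I [:: i; j] (I s f) X); first by [].
rewrite iint2E// (bint_prod21 mu mu (bmeas_eta2 i j X bs)) /=.
by apply: eq_Rintegral => t _; apply: eq_Rintegral => u _; rewrite eta_swap.
Qed.

Lemma iint_shift i s1 s2 f : i \notin s1 -> cyl_bmeas f ->
  I (i :: s1 ++ s2) f = I (s1 ++ i :: s2) f.
Proof.
elim: s1 => //= j s1 IH; rewrite inE negb_or => /andP[ij is1] bf.
by rewrite -(IH is1 bf) -[RHS]/(I [:: j, i & s1 ++ s2] f) -iint_swap.
Qed.

(** The head of [s] is moved to its place in [s'] by exchanging neighbours, each exchange being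
    Fubini for two distinct coordinates. Any pair of coordinates can thus be integrated outermost or
    innermost. *)
Lemma iint_perm s s' f : uniq s -> perm_eq s s' -> cyl_bmeas f -> I s f = I s' f.
Proof.
elim: s s' => [|i s IH] s' us ss' bf.
  by have := perm_size ss'; case: s' ss'.
have : i \in s' by rewrite -(perm_mem ss') mem_head.
have us' : uniq s' by rewrite -(perm_uniq ss').
move=> is'; move: ss' us'; case/splitPr: is' => p1 p2 ss' us'.
have ip1 : i \notin p1.
  by move: us'; rewrite cat_uniq /= => /and3P[_ /norP[]].
rewrite -iint_shift//=; apply/funext => X; apply: eq_Rintegral => t _.
rewrite (IH (p1 ++ p2))//; first by case/andP: us.
by move: ss'; rewrite perm_sym perm_catC/= perm_cons perm_catC perm_sym.
Qed.

End iterated.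

(** * Regularity of the velocity operator *)

Section velocity.
Context {R : realType} d {Omega : measurableType d} (mu : probability Omega R).
Variable k : nat.
Implicit Types (F H : graph k) (W U : Omega * Omega -> R) (X : 'I_k -> Omega)
  (p q : 'I_k * 'I_k) (a b i j : 'I_k).
Local Notation I s f := (iterated_integral mu s f).

Definition vertex_pairs : seq ('I_k * 'I_k) :=
  [seq p : 'I_k * 'I_k <- enum {: 'I_k * 'I_k} | (p.1 < p.2)%N].

(** One formula for edges and non-edges, so that the induced weight is a single product over
    [vertex_pairs] and can be telescoped. *)
Definition edge_factor F p (w : R) : R := if adj F p.1 p.2 then w else 1 - w.

Definition others a b : seq 'I_k := [seq i <- enum 'I_k | (i != a) && (i != b)].

(** Coordinates other than [a] and [b] also receive [z.2], as a dummy value: [others a b] integrates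
    them out. *)
Definition root a (z : Omega * Omega) : 'I_k -> Omega :=
  fun i => if i == a then z.1 else z.2.

Lemma adjC n (G : graph n) u v : adj G u v = adj G v u.
Proof. by rewrite /adj finset.setUC. Qed.

Lemma induced_weightE F W X :
  induced_weight F W X =
  \prod_(p <- vertex_pairs) edge_factor F p (W (X p.1, X p.2)).
Proof.
rewrite /vertex_pairs big_filter big_enum_cond /= /induced_weight.
rewrite [RHS](bigID (fun p => adj F p.1 p.2))/=; congr (_ * _).
  by apply: eq_bigr => p /andP[_]; rewrite /edge_factor => ->.
by apply: eq_bigr => p /andP[_ /negbTE]; rewrite /edge_factor => ->.
Qed.

Lemma vertex_pairs_uniq : uniq vertex_pairs.
Proof. by rewrite filter_uniq// enum_uniq. Qed.

Lemma vertex_pairsP p : p \in vertex_pairs -> (p.1 < p.2)%N.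
Proof. by rewrite mem_filter => /andP[]. Qed.

Lemma cyl_bmeas_factor F p W : bmeas W ->
  cyl_bmeas (fun X => edge_factor F p (W (X p.1, X p.2))).
Proof.
move=> bW; rewrite /edge_factor; case: adj; first exact: cyl_bmeas_pair.
by apply: cyl_bmeasB; [exact: cyl_bmeas_cst|exact: cyl_bmeas_pair].
Qed.

Lemma cyl_bmeas_weight F W : bmeas W -> cyl_bmeas (induced_weight F W).
Proof.
move=> bW; rewrite (_ : induced_weight F W = fun X =>
  \prod_(p <- vertex_pairs) edge_factor F p (W (X p.1, X p.2))).
  by apply: cyl_bmeas_prod => p; exact: cyl_bmeas_factor.
by apply/funext => X; rewrite induced_weightE.
Qed.

Lemma bmeas_root s a f : cyl_bmeas f -> bmeas (fun z => I s f (root a z)).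
Proof.
move=> bf.
apply: (@cyl_bmeasE R _ _ k (I s f) _ _ (mu \x mu)%E (fun i z => root a z i)).
  exact: cyl_bmeas_iint.
by move=> i; rewrite /root; case: (i == a); [exact: measurable_fst|exact: measurable_snd].
Qed.

Lemma others_perm a b : a != b -> perm_eq (a :: b :: others a b) (enum 'I_k).
Proof.
move=> ab; apply: uniq_perm; rewrite ?enum_uniq//=.
  rewrite !inE !mem_filter !eqxx !andbF/= orbF ab/=.
  by rewrite filter_uniq// enum_uniq.
move=> i; rewrite !inE mem_filter mem_enum inE/= andbT.
by case: (i == a); case: (i == b).
Qed.

(** Turns a tested rooted density into an integral over all coordinates, in which any other pair can
    then be singled out. [X] is arbitrary because every coordinate is integrated. *)
Lemma rooted_integral a b (u v : Omega -> R) f X : a != b ->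
  bmeas u -> bmeas v -> cyl_bmeas f ->
  \int[(mu \x mu)%E]_z (u z.1 * v z.2 * I (others a b) f (root a z)) =
  I (enum 'I_k) (fun x => u (x a) * v (x b) * f x) X.
Proof.
move=> ab bu bv bf.
have buv : cyl_bmeas (fun x : 'I_k -> Omega => u (x a) * v (x b)).
  by apply: cyl_bmeasM; exact: cyl_bmeas_coord.
have bg := cyl_bmeasM buv bf.
have us : uniq (a :: b :: others a b).
  by rewrite (perm_uniq (others_perm ab)) enum_uniq.
rewrite -(iint_perm mu us (others_perm ab) bg).
rewrite -[_ :: _ :: _]/([:: a; b] ++ _) iint_cat iint2E; last exact: cyl_bmeas_iint.
apply: eq_Rintegral => z _; rewrite iintMl//; last first.
  move=> i Y t; rewrite mem_filter => /andP[/andP[ia ib] _] /=.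
  by rewrite eq_sym (negbTE ia) eq_sym (negbTE ib).
rewrite /= eqxx (negbTE ab) eqxx; congr (_ * _); apply: iint_agree => i.
rewrite mem_filter mem_enum andbT negb_and !negbK /root/=.
by case/orP => /eqP ->; rewrite eqxx// ?(negbTE ab)// eq_sym (negbTE ab).
Qed.

(** One factor is blind to [x j] and the other to [x i]: with the other coordinates fixed, such an
    [m] is exactly a product weight against which a cut-norm bound is effective. *)
Definition indep_pair (m : ('I_k -> Omega) -> R) i j :=
  exists u v : ('I_k -> Omega) -> R,
    [/\ cyl_bmeas u /\ (forall x, 0 <= u x <= 1),
        cyl_bmeas v /\ (forall x, 0 <= v x <= 1),
        indep [:: j] u, indep [:: i] v & m = (fun x => u x * v x)].

Lemma unit_itvM (x y : R) : 0 <= x <= 1 -> 0 <= y <= 1 -> 0 <= x * y <= 1.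
Proof.
by move=> /andP[x0 x1] /andP[y0 y1]; rewrite mulr_ge0//= mulr_ile1.
Qed.

Lemma indep_pairM m m' i j :
  indep_pair m i j -> indep_pair m' i j -> indep_pair (fun x => m x * m' x) i j.
Proof.
move=> [u [v [[bu u01] [bv v01] iu iv ->]]] [u' [v' [[bu' u01'] [bv' v01'] iu' iv' ->]]].
exists (fun x => u x * u' x), (fun x => v x * v' x); split.
- by split=> [|x]; [exact: cyl_bmeasM|exact: unit_itvM].
- by split=> [|x]; [exact: cyl_bmeasM|exact: unit_itvM].
- by move=> l X t lj; rewrite iu// iu'.
- by move=> l X t lj; rewrite iv// iv'.
- by apply/funext => x; rewrite mulrACA.
Qed.

Lemma indep_pairl m i j : cyl_bmeas m -> (forall x, 0 <= m x <= 1) ->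
  indep [:: j] m -> indep_pair m i j.
Proof.
move=> bm m01 im; exists m, (fun=> 1); split => //.
- by split => [|x]; [exact: cyl_bmeas_cst|rewrite ler01 lexx].
- by apply/funext => x; rewrite mulr1.
Qed.

Lemma indep_pairr m i j : cyl_bmeas m -> (forall x, 0 <= m x <= 1) ->
  indep [:: i] m -> indep_pair m i j.
Proof.
move=> bm m01 im; exists (fun=> 1), m; split => //.
- by split => [|x]; [exact: cyl_bmeas_cst|rewrite ler01 lexx].
- by apply/funext => x; rewrite mul1r.
Qed.

Lemma edge_factor01 F p w : 0 <= w <= 1 -> 0 <= edge_factor F p w <= 1.
Proof. by rewrite /edge_factor; case: adj => //= /andP[? ?]; apply/andP; split; lra. Qed.

(** Two distinct pairs share at most one vertex, so the factor of [q] ignores one of the two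
    coordinates of [p]. *)
Lemma indep_pair_factor F p q W : bmeas W -> (forall z, 0 <= W z <= 1) ->
  (p.1 < p.2)%N -> (q.1 < q.2)%N -> p != q ->
  indep_pair (fun x => edge_factor F q (W (x q.1, x q.2))) p.1 p.2.
Proof.
move=> bW W01 hp hq pq.
have bm := cyl_bmeas_factor F q bW.
have m01 x : 0 <= edge_factor F q (W (x q.1, x q.2)) <= 1 by exact: edge_factor01.
have [/andP[]|] := boolP ((p.1 \in [:: q.1; q.2]) && (p.2 \in [:: q.1; q.2])).
  rewrite !inE => /orP[|] /eqP e1 /orP[|] /eqP e2; exfalso; move: hp; rewrite e1 e2 ?ltnn//.
    by move: pq; rewrite (surjective_pairing p) e1 e2 -surjective_pairing eqxx.
  by move/ltnW; rewrite leqNgt hq.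
rewrite negb_and => /orP[]; rewrite !inE negb_or => /andP[n1 n2].
  apply: indep_pairr => // i X t; rewrite inE => /eqP -> /=.
  by rewrite eq_sym (negbTE n1) eq_sym (negbTE n2).
apply: indep_pairl => // i X t; rewrite inE => /eqP -> /=.
by rewrite eq_sym (negbTE n1) eq_sym (negbTE n2).
Qed.

Lemma indep_pair_coord (u : Omega -> R) a i j : bmeas u -> (forall x, 0 <= u x <= 1) ->
  i != j -> indep_pair (fun x => u (x a)) i j.
Proof.
move=> bu u01 ij; have bm := cyl_bmeas_coord (k := k) a bu.
have [ai|ai] := eqVneq a i.
  apply: indep_pairl => // l X t; rewrite inE => /eqP -> /=.
  by rewrite ai (negbTE ij).
apply: indep_pairr => // l X t; rewrite inE => /eqP -> /=.
by rewrite (negbTE ai).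
Qed.

(** With all coordinates but [i] and [j] frozen, [u] depends on [x i] and [v] on [x j] only, so the
    inner double integral is a [[0,1]]-weighted rectangle test of [K]. *)
Lemma iint_cut m i j K X (r : R) : i != j -> indep_pair m i j -> bmeas K ->
  (forall A B, measurable A -> measurable B -> `|box_int mu K A B| <= r) ->
  `|I (enum 'I_k) (fun x => m x * K (x i, x j)) X| <= r.
Proof.
move=> ij [u [v [[bu u01] [bv v01] iu iv ->]]] bK Kr.
have bg : cyl_bmeas (fun x => u x * v x * K (x i, x j)).
  by apply: cyl_bmeasM; [exact: cyl_bmeasM|exact: cyl_bmeas_pair].
have us : uniq (others i j ++ [:: i; j]).
  by rewrite uniq_catC -[_ ++ _]/(i :: j :: _) (perm_uniq (others_perm ij)) enum_uniq.
have ps : perm_eq (others i j ++ [:: i; j]) (enum 'I_k).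
  by rewrite perm_catC; exact: others_perm.
rewrite -(iint_perm mu us ps bg).
rewrite iint_cat; apply: iint_norm_le; first exact: cyl_bmeas_iint.
move=> Y; rewrite iint2E//=.
rewrite (_ : (fun z => _) = fun z : Omega * Omega =>
   u [eta Y with i |-> z.1] * v [eta Y with j |-> z.2] * K z).
  apply: (@box_int_fun_norm R _ _ mu K (fun x => u [eta Y with i |-> x])
            (fun y => v [eta Y with j |-> y])) => //; exact: bmeas_eta.
apply/funext => z; rewrite /= eqxx (negbTE ij) iu ?inE// eta_swap// iv ?inE//.
by rewrite eqxx -surjective_pairing.
Qed.

(** Telescoping: [U] is exchanged for [W] one pair at a time. Each term is [U - W] at one pair,
    weighted by factors that split over that pair, so it costs [r]. The weight [m] is general so
    that it can collect the factors already exchanged. *)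
Lemma prod_diff_cut F U W (r : R) (X : 'I_k -> Omega)
    (s : seq ('I_k * 'I_k)) m :
  bmeas U -> bmeas W -> (forall z, 0 <= U z <= 1) -> (forall z, 0 <= W z <= 1) ->
  (forall A B, measurable A -> measurable B ->
    `|box_int mu (fun z => U z - W z) A B| <= r) ->
  cyl_bmeas m -> uniq s -> (forall p, p \in s -> (p.1 < p.2)%N) ->
  (forall p, p \in s -> indep_pair m p.1 p.2) ->
  `|I (enum 'I_k) (fun x => m x *
     (\prod_(p <- s) edge_factor F p (U (x p.1, x p.2)) -
      \prod_(p <- s) edge_factor F p (W (x p.1, x p.2)))) X| <= (size s)%:R * r.
Proof.
move=> bU bW U01 W01 UWr; elim: s m => [|p s IH] m bm /= us sp sm.
  under eq_fun do rewrite !big_nil subrr mulr0.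
  by rewrite iint_cst normr0 mul0r.
have /andP[ps us'] := us.
have bP (V : Omega * Omega -> R) : bmeas V ->
    cyl_bmeas (fun x => \prod_(p <- s) edge_factor F p (V (x p.1, x p.2))).
  by move=> bV; apply: cyl_bmeas_prod => q; exact: cyl_bmeas_factor.
have bp (V : Omega * Omega -> R) : bmeas V -> cyl_bmeas (fun x => edge_factor F p (V (x p.1, x p.2))).
  exact: cyl_bmeas_factor.
have hp : (p.1 < p.2)%N by apply: sp; rewrite mem_head.
have pij : p.1 != p.2 by rewrite -val_eqE/= neq_ltn hp.
(* The sign accounts for a non-edge, whose factor is [1 - W]. *)
pose K z := (if adj F p.1 p.2 then 1 else -1) * (U z - W z).
have bK : bmeas K by apply: bmeasM; [exact: bmeas_cst|exact: bmeasB].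
have Kr A' B' : measurable A' -> measurable B' -> `|box_int mu K A' B'| <= r.
  move=> mA mB; rewrite /K; case: adj.
    by under eq_fun do rewrite mul1r; exact: UWr.
  under eq_fun do rewrite mulN1r.
  by rewrite box_intN ?normrN ?UWr//; exact: bmeasB.
rewrite (_ : (fun x => _) = fun x =>
   m x * \prod_(p <- s) edge_factor F p (U (x p.1, x p.2)) * K (x p.1, x p.2) +
   (m x * edge_factor F p (W (x p.1, x p.2))) *
     (\prod_(p <- s) edge_factor F p (U (x p.1, x p.2)) -
      \prod_(p <- s) edge_factor F p (W (x p.1, x p.2)))); last first.
  apply/funext => x; rewrite !big_cons /K /edge_factor; case: adj; ring.
rewrite iintD; last 2 first.
- by apply: cyl_bmeasM; [apply: cyl_bmeasM => //; exact: bP|exact: cyl_bmeas_pair].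
- by apply: cyl_bmeasM; [apply: cyl_bmeasM => //; exact: bp|apply: cyl_bmeasB; exact: bP].
rewrite (le_trans (ler_normD _ _))// -natr1 mulrDl mul1r addrC lerD//.
  apply: IH => //; first by apply: cyl_bmeasM => //; exact: bp.
    by move=> q qs; apply: sp; rewrite inE qs orbT.
  move=> q qs; apply: indep_pairM; first by apply: sm; rewrite inE qs orbT.
  have qp : q != p by apply: contraNneq ps => <-.
  by apply: indep_pair_factor => //; apply: sp; rewrite inE qs orbT.
apply: iint_cut => //.
apply: indep_pairM; first by apply: sm; rewrite mem_head.
(* The remaining product splits factor by factor; the induction is over lists contained in [s], so
   that the facts about [s] itself stay available. *)
have : {subset s <= s} by [].
move: {1 3}s => s'; elim: s' => [|q s' IHs] ss.
  under eq_fun do rewrite big_nil.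
  apply: indep_pairl => //; first exact: cyl_bmeas_cst.
  by move=> x; rewrite ler01 lexx.
under eq_fun do rewrite big_cons.
have qs : q \in s by apply: ss; rewrite mem_head.
apply: indep_pairM; last by apply: IHs => q' q's; apply: ss; rewrite inE q's orbT.
apply: indep_pair_factor => //; first by apply: sp; rewrite inE qs orbT.
by apply: contraNneq ps => ->.
Qed.

(** Tested on a rectangle, the difference is a full [k]-fold integral with weight
    [\1_A (x a) * \1_B (x b)]. Each indicator depends on one coordinate, so this weight splits over
    every pair. *)
Lemma rooted_density_cut a b F U W (r : R) A B : a != b ->
  bmeas U -> bmeas W -> (forall z, 0 <= U z <= 1) -> (forall z, 0 <= W z <= 1) ->
  (forall A B, measurable A -> measurable B ->
    `|box_int mu (fun z => U z - W z) A B| <= r) ->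
  measurable A -> measurable B ->
  `|box_int mu (fun z => rooted_density mu F a b U z - rooted_density mu F a b W z) A B|
    <= (size vertex_pairs)%:R * r.
Proof.
move=> ab bU bW U01 W01 UWr mA mB.
have b1A := bmeas_indic (R := R) mA; have b1B := bmeas_indic (R := R) mB.
have bFU := cyl_bmeas_weight F bU; have bFW := cyl_bmeas_weight F bW.
rewrite /box_int (_ : (fun z => _) = fun z : Omega * Omega => \1_A z.1 * \1_B z.2 *
  I (others a b) (fun x => induced_weight F U x - induced_weight F W x) (root a z)); last first.
  by apply/funext => z; rewrite iintB.
rewrite (rooted_integral (fun=> point))//; last exact: cyl_bmeasB.
rewrite (_ : (fun x => _) = fun x => \1_A (x a) * \1_B (x b) *
   (\prod_(p <- vertex_pairs) edge_factor F p (U (x p.1, x p.2)) -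
      \prod_(p <- vertex_pairs) edge_factor F p (W (x p.1, x p.2)))); last first.
  by apply/funext => x; rewrite !induced_weightE.
have ind01 (D : set Omega) x : 0 <= (\1_D x : R) <= 1.
  by rewrite indicE; case: (_ \in _); rewrite ler01 lexx.
apply: prod_diff_cut => //.
- by apply: cyl_bmeasM; exact: cyl_bmeas_coord.
- exact: vertex_pairs_uniq.
- exact: vertex_pairsP.
- move=> p /vertex_pairsP hp; have pij : p.1 != p.2 by rewrite -val_eqE/= neq_ltn hp.
  by apply: indep_pairM; exact: indep_pair_coord.
Qed.

Lemma iint_pair i j K X : i != j -> bmeas K ->
  I (enum 'I_k) (fun x => K (x i, x j)) X = \int[(mu \x mu)%E]_z K z.
Proof.
move=> ij bK; have bg := cyl_bmeas_pair (k := k) i j bK.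
have us : uniq (i :: j :: others i j).
  by rewrite (perm_uniq (others_perm ij)) enum_uniq.
rewrite -(iint_perm mu us (others_perm ij) bg).
rewrite -[_ :: _ :: _]/([:: i; j] ++ _) iint_cat iint2E; last exact: cyl_bmeas_iint.
apply: eq_Rintegral => z _; rewrite iint_indep/= => [|l Y t].
  by rewrite eqxx (negbTE ij) eqxx -surjective_pairing.
rewrite mem_filter => /andP[/andP[li lj] _] /=.
by rewrite eq_sym (negbTE li) eq_sym (negbTE lj).
Qed.

Lemma edge_factor_diff F p w w' :
  `|edge_factor F p w - edge_factor F p w'| = `|w - w'|.
Proof.
rewrite /edge_factor; case: adj => //.
by rewrite (_ : _ - _ = w' - w) 1?distrC//; ring.
Qed.

Lemma edge_factor_norm F p w (M : R) : `|w| <= M -> `|edge_factor F p w| <= 1 + M.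
Proof.
move=> wM; rewrite /edge_factor; case: adj.
  by rewrite (le_trans wM)// lerDr.
by rewrite (le_trans (ler_normB _ _))// normr1 lerD2l.
Qed.

Lemma prod_norm_le (s : seq ('I_k * 'I_k)) (f : 'I_k * 'I_k -> R) (B : R) :
  (forall p, `|f p| <= B) -> `|\prod_(p <- s) f p| <= B ^+ size s.
Proof.
move=> fB; elim: s => [|p s IH]; first by rewrite big_nil normr1 expr0.
by rewrite big_cons normrM exprS ler_pM.
Qed.

Lemma prod_diff_le (s : seq ('I_k * 'I_k)) (f g : 'I_k * 'I_k -> R) (B : R) :
  1 <= B -> (forall p, `|f p| <= B) -> (forall p, `|g p| <= B) ->
  `|\prod_(p <- s) f p - \prod_(p <- s) g p|
    <= B ^+ size s * \sum_(p <- s) `|f p - g p|.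
Proof.
move=> B1 fB gB; have B0 : 0 <= B by rewrite (le_trans ler01).
elim: s => [|p s IH]; first by rewrite !big_nil subrr normr0 mulr0.
rewrite !big_cons/= (_ : _ - _ = (f p - g p) * \prod_(p <- s) f p +
  g p * (\prod_(p <- s) f p - \prod_(p <- s) g p)); last by ring.
rewrite (le_trans (ler_normD _ _))// [leRHS]mulrDr lerD// normrM.
  rewrite mulrC ler_wpM2r// (le_trans (prod_norm_le s fB))//.
  by rewrite exprS ler_peMl// exprn_ge0.
by rewrite exprS -mulrA ler_pM.
Qed.

(** Factors are exchanged one at a time, all others being bounded by [1 + M], and integration over
    all coordinates turns every [|U - W|] into the same double integral. A general bound [M] is
    allowed because the estimate is applied before the trajectory is known to be a graphon. *)
Lemma rooted_density_L1 a b F U W (M : R) : a != b -> 0 <= M ->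
  bmeas U -> bmeas W -> (forall z, `|U z| <= M) -> (forall z, `|W z| <= M) ->
  \int[(mu \x mu)%E]_z `|rooted_density mu F a b U z - rooted_density mu F a b W z|
  <= (1 + M) ^+ size (vertex_pairs) * (size vertex_pairs)%:R *
     \int[(mu \x mu)%E]_z `|U z - W z|.
Proof.
move=> ab M0 bU bW UM WM.
pose B := (1 + M) ^+ size vertex_pairs.
have B1 : 1 <= 1 + M by rewrite lerDl.
have bFU := cyl_bmeas_weight F bU; have bFW := cyl_bmeas_weight F bW.
have bUW : bmeas (fun z => `|U z - W z|) by apply: bmeas_norm; exact: bmeasB.
have bpair p : cyl_bmeas (fun x => `|U (x p.1, x p.2) - W (x p.1, x p.2)|).
  exact: (@cyl_bmeas_pair R _ _ k (fun z => `|U z - W z|)).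
pose f x := B * \sum_(p <- vertex_pairs) `|U (x p.1, x p.2) - W (x p.1, x p.2)|.
have bs : cyl_bmeas (fun x => \sum_(p <- vertex_pairs) `|U (x p.1, x p.2) - W (x p.1, x p.2)|).
  by apply: cyl_bmeas_sum => p; exact: bpair.
have bf : cyl_bmeas f by apply: cyl_bmeasM => //; exact: cyl_bmeas_cst.
have bd : cyl_bmeas (fun x => induced_weight F U x - induced_weight F W x).
  exact: cyl_bmeasB.
apply: (@le_trans _ _ (\int[(mu \x mu)%E]_z (1 * 1 * I (others a b) f (root a z)))).
  apply: bint_le.
  - by apply: bmeas_norm; apply: bmeasB; exact: bmeas_root.
  - by apply: bmeasM; [exact: bmeas_cst|exact: bmeas_root].
  - move=> z; rewrite mul1r mul1r -iintB// (le_trans (iint_norm _ _ _ bd))//.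
    apply: iint_le => //; first exact: cyl_bmeas_norm.
    move=> x; rewrite !induced_weightE (le_trans (prod_diff_le _ B1 _ _))//.
    + by move=> p; exact: edge_factor_norm.
    + by move=> p; exact: edge_factor_norm.
    + by under eq_bigr do rewrite edge_factor_diff.
rewrite (rooted_integral (fun=> point) ab (bmeas_cst 1) (bmeas_cst 1) bf).
rewrite (_ : (fun x => _) = f); last by apply/funext => x; rewrite mul1r mul1r.
rewrite iintZ// iint_sum//.
rewrite [X in _ * X](_ : _ = \sum_(p <- vertex_pairs) \int[(mu \x mu)%E]_z `|U z - W z|).
  by rewrite big_const_seq count_predT iter_addr_0 -[X in B * X]mulr_natl mulrA lexx.
apply: eq_big_seq => p /vertex_pairsP hp.
have pij : p.1 != p.2 by rewrite -val_eqE/= neq_ltn hp.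
exact: (iint_pair (fun=> point) pij bUW).
Qed.

Lemma bmeas_rooted F a b W : bmeas W -> bmeas (rooted_density mu F a b W).
Proof. by move=> bW; apply: bmeas_root; exact: cyl_bmeas_weight. Qed.

Lemma rooted_density_norm F a b W (M : R) z : bmeas W -> (forall z, `|W z| <= M) ->
  `|rooted_density mu F a b W z| <= (1 + M) ^+ size vertex_pairs.
Proof.
move=> bW WM; apply: iint_norm_le; first exact: cyl_bmeas_weight.
move=> x; rewrite induced_weightE; apply: prod_norm_le => p.
exact: edge_factor_norm.
Qed.

(** All factors lie in [[0,1]], and that of the pair [ab] does not depend on the integrated
    coordinates, so it alone bounds the density. *)
Lemma rooted_density_bounds F a b W z : a != b -> bmeas W ->
  (forall z, 0 <= W z <= 1) -> W (z.1, z.2) = W (z.2, z.1) ->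
  0 <= rooted_density mu F a b W z <= if adj F a b then W z else 1 - W z.
Proof.
move=> ab bW W01 Wsym; have bF := cyl_bmeas_weight F bW.
have f01 x p : 0 <= edge_factor F p (W (x p.1, x p.2)) <= 1 by exact: edge_factor01.
apply/andP; split.
  rewrite -[leLHS](congr1 (fun f => f (root a z)) (iint_cst mu (others a b) 0)).
  apply: iint_le => //; first exact: cyl_bmeas_cst.
  move=> x; rewrite induced_weightE; apply: prodr_ge0 => p _.
  by have /andP[] := f01 x p.
(* [vertex_pairs] lists [ab] in increasing order; for [b < a] its factor reads [W] at the swapped
   point, whence the symmetry hypothesis at [z]. *)
pose p0 : 'I_k * 'I_k := if (a < b)%N then (a, b) else (b, a).
have hp0 : (p0.1 < p0.2)%N.
  by rewrite /p0; case: (ltngtP a b) => //= /val_inj e; rewrite e eqxx in ab.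
have bp0 := cyl_bmeas_factor F p0 bW.
have : rooted_density mu F a b W z <=
    I (others a b) (fun x => edge_factor F p0 (W (x p0.1, x p0.2))) (root a z).
  apply: iint_le => // x; rewrite induced_weightE.
  have p0in : p0 \in vertex_pairs by rewrite mem_filter hp0 mem_enum.
  rewrite (bigD1_seq p0)//= ?vertex_pairs_uniq//.
  have /andP[g0 g1] := f01 x p0; rewrite ler_piMr//.
  elim/big_rec: _ => // p y _ y1; have /andP[h0 h1] := f01 x p.
  by rewrite (le_trans (ler_wpM2l h0 y1))// mulr1.
rewrite iint_indep => [|l Y t].
  have ba : b == a = false by rewrite eq_sym (negbTE ab).
  rewrite /edge_factor /p0 /root; case: (ltnP a b) => _ /=; rewrite eqxx ba.
    by rewrite -surjective_pairing.
  by rewrite (adjC F b a) -Wsym -surjective_pairing.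
rewrite mem_filter => /andP[/andP[la lb] _] /=.
by rewrite /p0; case: (ltnP a b) => _ /=; rewrite eq_sym (negbTE la, negbTE lb) eq_sym (negbTE la, negbTE lb).
Qed.

Section rule.
Variable rule : graph k -> graph k -> R.
Hypothesis hrule : is_rule rule.

Definition flip_sign F H a b : R :=
  (adj H a b && ~~ adj F a b)%:R - (adj F a b && ~~ adj H a b)%:R.

Lemma flip_signE F H a b : flip_sign F H a b = (adj H a b)%:R - (adj F a b)%:R.
Proof. by rewrite /flip_sign; case: (adj H a b); case: (adj F a b); rewrite /= ?subrr. Qed.

Definition vel_coef F H p : R := rule F H * flip_sign F H p.1 p.2.

Lemma rule01 F H : 0 <= rule F H <= 1. Proof. by have [h _] := hrule. Qed.

Lemma vel_coef_le1 F H p : `|vel_coef F H p| <= 1.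
Proof.
rewrite normrM mulr_ile1//.
  by rewrite ger0_norm; have /andP[] := rule01 F H.
by rewrite flip_signE; case: (adj H _ _); case: (adj F _ _);
  rewrite ?subrr ?subr0 ?sub0r ?normrN ?normr1 ?normr0.
Qed.

Lemma velocityE W : velocity mu rule W = fun z =>
  \sum_F \sum_H \sum_(p : 'I_k * 'I_k | p.1 != p.2)
    vel_coef F H p * rooted_density mu F p.1 p.2 W z.
Proof.
apply/funext => z; apply: eq_bigr => F _; apply: eq_bigr => H _.
rewrite big_distrr/=; apply: eq_bigr => p _.
by rewrite /vel_coef -mulrA [X in _ * X]mulrC.
Qed.

(** The number of triples [(F, H, p)] in the velocity; each triple is estimated separately, with
    coefficient at most 1. *)
Definition nterms : R := \sum_(F : graph k) \sum_(H : graph k)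
  \sum_(p : 'I_k * 'I_k | p.1 != p.2) 1.

Lemma nterms_ge0 : 0 <= nterms.
Proof. by do 3!(apply: sumr_ge0 => ? _). Qed.

Lemma sum_nterms_le (t : graph k -> graph k -> 'I_k * 'I_k -> R) (c : R) :
  (forall F H p, p.1 != p.2 -> t F H p <= c) ->
  \sum_F \sum_H \sum_(p : 'I_k * 'I_k | p.1 != p.2) t F H p <= nterms * c.
Proof.
move=> tc; rewrite /nterms mulr_suml; apply: ler_sum => F _.
rewrite mulr_suml; apply: ler_sum => H _.
by rewrite mulr_suml; apply: ler_sum => p hp; rewrite mul1r tc.
Qed.

Lemma norm_sum_nterms_le (t : graph k -> graph k -> 'I_k * 'I_k -> R) :
  `|\sum_F \sum_H \sum_(p : 'I_k * 'I_k | p.1 != p.2) t F H p| <=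
  \sum_F \sum_H \sum_(p : 'I_k * 'I_k | p.1 != p.2) `|t F H p|.
Proof.
rewrite (le_trans (ler_norm_sum _ _ _))//; apply: ler_sum => F _.
rewrite (le_trans (ler_norm_sum _ _ _))//; apply: ler_sum => H _.
exact: ler_norm_sum.
Qed.

Lemma bmeas_velocity W : bmeas W -> bmeas (velocity mu rule W).
Proof.
move=> bW; rewrite velocityE; apply: bmeas_sum => F; apply: bmeas_sum => H.
by apply: bmeas_sum => p; apply: bmeasM; [exact: bmeas_cst|exact: bmeas_rooted].
Qed.

Lemma velocity_norm W (M : R) z : bmeas W -> (forall z, `|W z| <= M) ->
  `|velocity mu rule W z| <= nterms * (1 + M) ^+ size vertex_pairs.
Proof.
move=> bW WM; rewrite velocityE (le_trans (norm_sum_nterms_le _))//.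
apply: sum_nterms_le => F H p _; rewrite normrM.
have h := rooted_density_norm F p.1 p.2 z bW WM.
by rewrite (le_trans _ h)// ler_piMl// vel_coef_le1.
Qed.

Lemma velocity_diffE U W : (fun z => velocity mu rule U z - velocity mu rule W z) =
  fun z => \sum_F \sum_H \sum_(p : 'I_k * 'I_k | p.1 != p.2) vel_coef F H p *
    (rooted_density mu F p.1 p.2 U z - rooted_density mu F p.1 p.2 W z).
Proof.
apply/funext => z; rewrite !velocityE -sumrB; apply: eq_bigr => F _.
rewrite -sumrB; apply: eq_bigr => H _.
by rewrite -sumrB; apply: eq_bigr => p _; rewrite mulrBr.
Qed.

Definition L1_lipschitz_const (M : R) :=
  nterms * ((1 + M) ^+ size vertex_pairs * (size vertex_pairs)%:R).

Lemma velocity_L1 U W (M : R) : 0 <= M ->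
  bmeas U -> bmeas W -> (forall z, `|U z| <= M) -> (forall z, `|W z| <= M) ->
  \int[(mu \x mu)%E]_z `|velocity mu rule U z - velocity mu rule W z|
  <= L1_lipschitz_const M * \int[(mu \x mu)%E]_z `|U z - W z|.
Proof.
move=> M0 bU bW UM WM.
have bd F p : bmeas (fun z => `|rooted_density mu F p.1 p.2 U z - rooted_density mu F p.1 p.2 W z|).
  by apply: bmeas_norm; apply: bmeasB; exact: bmeas_rooted.
apply: (@le_trans _ _ (\int[(mu \x mu)%E]_z
  \sum_F \sum_(H : graph k) \sum_(p : 'I_k * 'I_k | p.1 != p.2)
    `|rooted_density mu F p.1 p.2 U z - rooted_density mu F p.1 p.2 W z|)).
  apply: bint_le.
  - by apply: bmeas_norm; apply: bmeasB; exact: bmeas_velocity.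
  - by apply: bmeas_sum => F; apply: bmeas_sum => H; apply: bmeas_sum => p.
  - move=> z; have := congr1 (fun f => f z) (velocity_diffE U W) => /= ->.
    rewrite (le_trans (norm_sum_nterms_le _))//.
    apply: ler_sum => F _; apply: ler_sum => H _; apply: ler_sum => p _.
    by rewrite normrM ler_piMl// vel_coef_le1.
rewrite bint_sum => [|F]; last by apply: bmeas_sum => H; apply: bmeas_sum.
under eq_bigr => F _ do (rewrite bint_sum; [|by move=> H; apply: bmeas_sum];
  under eq_bigr => H _ do rewrite bint_sum//).
rewrite /L1_lipschitz_const -mulrA; apply: sum_nterms_le => F H p hp.
exact: rooted_density_L1.
Qed.

Lemma velocity_cut U W (r : R) A B :
  bmeas U -> bmeas W -> (forall z, 0 <= U z <= 1) -> (forall z, 0 <= W z <= 1) ->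
  (forall A B, measurable A -> measurable B ->
    `|box_int mu (fun z => U z - W z) A B| <= r) ->
  measurable A -> measurable B ->
  `|box_int mu (fun z => velocity mu rule U z - velocity mu rule W z) A B|
    <= nterms * ((size vertex_pairs)%:R * r).
Proof.
move=> bU bW U01 W01 UWr mA mB.
have b1A := bmeas_indic (R := R) mA; have b1B := bmeas_indic (R := R) mB.
have bd F p : bmeas (fun z => rooted_density mu F p.1 p.2 U z - rooted_density mu F p.1 p.2 W z).
  by apply: bmeasB; exact: bmeas_rooted.
have br F p := bmeas_rect b1A b1B (bd F p).
rewrite velocity_diffE /box_int (_ : (fun z => _) = fun z =>
  \sum_F \sum_H \sum_(p : 'I_k * 'I_k | p.1 != p.2) vel_coef F H p * (\1_A z.1 * \1_B z.2 *
    (rooted_density mu F p.1 p.2 U z - rooted_density mu F p.1 p.2 W z))); last first.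
  apply/funext => z; rewrite mulr_sumr; apply: eq_bigr => F _.
  rewrite mulr_sumr; apply: eq_bigr => H _.
  by rewrite mulr_sumr; apply: eq_bigr => p _; rewrite mulrCA.
have bt F H p : bmeas (fun z => vel_coef F H p * (\1_A z.1 * \1_B z.2 *
    (rooted_density mu F p.1 p.2 U z - rooted_density mu F p.1 p.2 W z))).
  by apply: bmeasM; [exact: bmeas_cst|exact: br].
rewrite bint_sum => [|F]; last by apply: bmeas_sum => H; apply: bmeas_sum.
under eq_bigr => F _ do (rewrite bint_sum; [|by move=> H; apply: bmeas_sum];
  under eq_bigr => H _ do (rewrite bint_sum//; under eq_bigr => p _ do
    rewrite bintZ//)).
rewrite (le_trans (norm_sum_nterms_le _))//; apply: sum_nterms_le => F H p hp.
rewrite normrM; have h := rooted_density_cut F hp bU bW U01 W01 UWr mA mB.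
by rewrite (le_trans _ h)// ler_piMl// vel_coef_le1.
Qed.

(** A pair can disappear only if it is an edge of [F], and then the rooted density is at most [W z];
    it can appear only if it is a non-edge, and then the density is at most [1 - W z]. So the
    velocity points inwards at both ends of [[0,1]]. *)
Lemma velocity_bounds W z : bmeas W ->
  (forall z, 0 <= W z <= 1) -> W (z.1, z.2) = W (z.2, z.1) ->
  - (nterms * W z) <= velocity mu rule W z <= nterms * (1 - W z).
Proof.
move=> bW W01 Wsym; have /andP[W0 W1] := W01 z.
have W1' : 0 <= 1 - W z by rewrite subr_ge0.
have key F H p : p.1 != p.2 ->
    - W z <= vel_coef F H p * rooted_density mu F p.1 p.2 W z <= 1 - W z.
  move=> hp; have := rooted_density_bounds F hp bW W01 Wsym.
  have /andP[r0 r1] := rule01 F H.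
  rewrite /vel_coef flip_signE; case: (adj F _ _) => /andP[t0 t1].
    case: (adj H _ _); first by rewrite subrr mulr0 mul0r oppr_le0 W0.
    rewrite sub0r mulrN1 mulNr lerN2 (le_trans (ler_piMl t0 r1))//=.
    by rewrite (le_trans _ W1')// oppr_le0 mulr_ge0.
  case: (adj H _ _); last by rewrite subrr mulr0 mul0r oppr_le0 W0.
  rewrite subr0 mulr1 (le_trans (ler_piMl t0 r1))// andbT.
  by rewrite (@le_trans _ _ 0)// ?oppr_le0// mulr_ge0.
rewrite velocityE; apply/andP; split; last first.
  by apply: sum_nterms_le => F H p hp; have /andP[] := key F H p hp.
rewrite lerNl -sumrN; under eq_bigr => F _ do (rewrite -sumrN; under eq_bigr do rewrite -sumrN).
by apply: sum_nterms_le => F H p hp; rewrite lerNl; have /andP[] := key F H p hp.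
Qed.

End rule.

End velocity.

(** * One-sided calculus and the trajectory *)

Section half_line_derivative.
Context {R : realType}.
Implicit Types (q v : R -> R) (t a b c : R).

(** Stated with increments instead of quotients, so that [h = 0] is no exception; the condition
    [0 <= t + h] makes the derivative one-sided at 0. *)
Definition half_derivative q v := forall t : R, 0 <= t -> forall e : R, 0 < e ->
  exists2 dlt : R, 0 < dlt & forall h : R, `|h| < dlt -> 0 <= t + h ->
    `|q (t + h) - q t - h * v t| <= e * `|h|.

(* Continuing [q] by its tangent at [0] turns the one-sided derivative there into
   a two-sided one. *)
Definition linear_extension q v t := if 0 <= t then q t else q 0 + t * v 0.

Lemma linear_extension_derive q v t : half_derivative q v -> 0 <= t ->
  is_derive t 1 (linear_extension q v) (v t).
Proof.
move=> qv t0.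
suff cv : h^-1 *: (linear_extension q v (h *: 1 + t) - linear_extension q v t)
    @[h --> 0^'] --> v t.
  by apply: DeriveDef; [apply/cvg_ex; exists (v t)|exact/cvg_lim].
apply/cvgrPdist_le => e e0.
have [dl dl0 H] := qv t t0 e e0.
(* For [t > 0] the radius keeps [t + h] nonnegative; at [t = 0] a negative [h] lands on the tangent,
   where the remainder vanishes. *)
pose r := if t == 0 then dl else Num.min dl t.
have r0 : 0 < r.
  rewrite /r; case: eqVneq => // tn; rewrite lt_min dl0/=.
  by rewrite lt_neqAle eq_sym tn.
exists r => //= h /=; rewrite sub0r normrN => hr hn.
rewrite scaler1.
suff : `|linear_extension q v (h + t) - linear_extension q v t - h * v t| <= e * `|h|.
  move=> le; rewrite -(ler_pM2r (_ : 0 < `|h|)) ?normr_gt0// -normrM.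
  rewrite distrC in le; rewrite (le_trans _ le)// le_eqVlt; apply/orP; left; apply/eqP.
  by congr (`| _ |); rewrite /GRing.scale/=; field.
rewrite /linear_extension t0 (addrC h t); case: ifPn => th.
  apply: H => //; rewrite (lt_le_trans hr)// /r; case: eqVneq => // _.
  by rewrite ge_min lexx.
move: hr th; rewrite /r; case: eqVneq => [->|tn].
  have -> : q 0 + (0 + h) * v 0 - q 0 - h * v 0 = 0 by ring.
  by move=> _ _; rewrite normr0 mulr_ge0// ltW.
rewrite lt_min => /andP[_ ht] /negP[]; move: ht; rewrite ltr_norml => /andP[]; lra.
Qed.

Lemma half_derivative_mvt q v a b : half_derivative q v -> 0 <= a -> a <= b ->
  exists2 c, a <= c <= b & q b - q a = v c * (b - a).
Proof.
move=> qv a0 ab.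
have D (t : R) : a <= t -> is_derive t 1 (linear_extension q v) (v t).
  by move=> at0; apply: linear_extension_derive => //; exact: le_trans at0.
have [t|t /=|c] := @MVT_segment R (linear_extension q v) v a b ab.
- by rewrite in_itv/= => /andP[/ltW at0 _]; exact: D.
- apply: derivable_within_continuous => u; rewrite in_itv/= => /andP[au _].
  by have [] := D u au.
- rewrite in_itv/= => cab; rewrite /linear_extension a0 (le_trans a0 ab) => e.
  by exists c.
Qed.

Lemma half_derivative_mvt_le q v a b c K : half_derivative q v -> 0 <= a -> a <= b ->
  (forall t : R, a <= t <= b -> `|v t - c| <= K) ->
  `|q b - q a - (b - a) * c| <= K * (b - a).
Proof.
move=> qv a0 ab vK; have [t tab ->] := half_derivative_mvt qv a0 ab.
by rewrite mulrC -mulrBr normrM mulrC (ger0_norm (_ : 0 <= b - a)) ?subr_ge0// ler_wpM2r ?subr_ge0// vK.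
Qed.

(* [expR (c * t) * q t - kap * expR (c * b) * t] is nonincreasing on [a, b]. *)
Lemma half_derivative_gronwall q v a b c kap : half_derivative q v -> 0 <= a -> a <= b ->
  0 <= c -> 0 <= kap -> q a <= 0 ->
  (forall t : R, a <= t <= b -> v t <= - (c * q t) + kap) ->
  q b <= kap * (b - a).
Proof.
move=> qv a0 ab c0 k0 qa H.
pose r t := expR (c * t) * linear_extension q v t - kap * expR (c * b) * t.
have D (t : R) : a <= t -> is_derive t 1 r
    (expR (c * t) * (c * linear_extension q v t + v t) - kap * expR (c * b)).
  move=> at0; have Dq := linear_extension_derive qv (le_trans a0 at0).
  have Dlin (l : R) : is_derive t 1 ( *%R l) l.
    by have := is_deriveZ l (is_derive_id t (1 : R)); rewrite /GRing.scale/= mulr1.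
  have De : is_derive t 1 (fun u : R => expR (c * u)) (expR (c * t) * c).
    exact: is_derive1_comp (Dlin c).
  have := is_deriveB (is_deriveM De Dq) (Dlin (kap * expR (c * b))).
  by move/is_derive_eq; apply; rewrite /GRing.scale/=; ring.
pose dr t := expR (c * t) * (c * linear_extension q v t + v t) - kap * expR (c * b).
have [t|t /=|u] := @MVT_segment R r dr a b ab.
- by rewrite in_itv/= => /andP[/ltW at0 _]; exact: D.
- apply: derivable_within_continuous => u; rewrite in_itv/= => /andP[au _].
  by have [] := D u au.
- rewrite in_itv/= => /andP[au ub] e.
  have u0 := le_trans a0 au.
  have b0 := le_trans a0 ab.
  have Hu := H u; rewrite au ub in Hu; have {}Hu := Hu isT.
  have lu : linear_extension q v u = q u by rewrite /linear_extension u0.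
  have Eu : 0 < expR (c * u) by exact: expR_gt0.
  have Eub : expR (c * u) <= expR (c * b) by rewrite ler_expR ler_wpM2l.
  have rba : r b <= r a.
    rewrite -subr_le0 e /dr; rewrite mulr_le0_ge0 ?subr_ge0// lu.
    rewrite subr_le0 (@le_trans _ _ (expR (c * u) * kap))//.
      by rewrite ler_pM2l// -lerBrDl addrC.
    by rewrite mulrC ler_wpM2l.
  move: rba; rewrite /r /linear_extension a0 b0.
  have Eb : 0 < expR (c * b) by exact: expR_gt0.
  have Ea : expR (c * a) * q a <= 0 by rewrite mulr_ge0_le0// expR_ge0.
  move=> rba.
  have : expR (c * b) * q b <= expR (c * b) * (kap * (b - a)) by nra.
  by rewrite ler_pM2l.
Qed.

End half_line_derivative.

Section trajectory.
Context {R : realType} d {Omega : measurableType d} (mu : probability Omega R).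
Variables (k : nat) (rule : graph k -> graph k -> R).
Hypothesis hrule : is_rule rule.
Local Notation mu2 := (mu \x mu)%E.
Local Notation V := (velocity mu rule).
Local Notation N := (nterms k : R).

Definition clamp (lo hi x : R) := Num.max lo (Num.min hi x).

Lemma clampP (lo hi x : R) : lo <= hi -> lo <= clamp lo hi x <= hi.
Proof. by move=> lh; rewrite /clamp le_max lexx/= ge_max lh ge_min lexx. Qed.

Lemma clamp_id (lo hi x : R) : lo <= x <= hi -> clamp lo hi x = x.
Proof. by move=> /andP[lx xh]; rewrite /clamp min_r// max_r. Qed.

Lemma bmeas_clamp (lo hi : R) (W : Omega * Omega -> R) :
  bmeas W -> bmeas (fun z => clamp lo hi (W z)).
Proof.
by move=> bW; apply: bmeas_max; [exact: bmeas_cst|apply: bmeas_min => //; exact: bmeas_cst].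
Qed.

(** The [L^1] Lipschitz estimate at distance 0. It allows representatives to be changed on null
    sets, in particular to be clamped. *)
Lemma velocity_ae (U W : Omega * Omega -> R) : bmeas U -> bmeas W ->
  {ae mu2, forall z, U z = W z} -> {ae mu2, forall z, V U z = V W z}.
Proof.
move=> bU bW UW.
have [_ [M UM]] := bU; have [_ [M' WM]] := bW.
pose K := Num.max M M'.
have UK z : `|U z| <= K by rewrite le_max UM.
have WK z : `|W z| <= K by rewrite le_max WM orbT.
have K0 : 0 <= K by rewrite (le_trans _ (UK point)).
have d0 : \int[mu2]_z `|U z - W z| = 0.
  rewrite (bint_ae (g := fun=> 0)) ?bint_cst//.
  - by apply: bmeas_norm; exact: bmeasB.
  - exact: bmeas_cst.
  - by apply: filterS UW => z ->; rewrite subrr normr0.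
have := velocity_L1 mu hrule K0 bU bW UK WK; rewrite d0 mulr0 => le0.
have bVU := bmeas_velocity mu rule bU; have bVW := bmeas_velocity mu rule bW.
have : \int[mu2]_z `|V U z - V W z| = 0.
  apply/le_anti; rewrite le0/=; apply: Rintegral_ge0 => z _; exact: normr_ge0.
move/(bint_eq0_ae (bmeasB bVU bVW)); apply: filterS => z /eqP.
by rewrite subr_eq0 => /eqP.
Qed.

Variables (W0 : Omega * Omega -> R) (Phi : R -> Omega * Omega -> R).
Hypothesis W001 : forall z, 0 <= W0 z <= 1.
Hypothesis hPhi : is_trajectory mu rule W0 Phi.

Lemma bmeas_Phi t : 0 <= t -> bmeas (Phi t).
Proof. by move=> t0; have [h _ _] := hPhi; have [m b _] := h t t0. Qed.

Lemma sym_Phi t : 0 <= t ->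
  {ae mu2, forall z, Phi t (z.1, z.2) = Phi t (z.2, z.1)}.
Proof. by move=> t0; have [h _ _] := hPhi; have [] := h t t0. Qed.

Lemma bmeas_V t : 0 <= t -> bmeas (V (Phi t)).
Proof. by move=> t0; apply: bmeas_velocity; exact: bmeas_Phi. Qed.

Lemma Linfty_norm_ae (f : Omega * Omega -> R) (e : R) :
  (Linfty_norm mu f <= e%:E)%E -> {ae mu2, forall z, `|f z| <= e}.
Proof.
(* [Lnorm] at exponent [+oo] is an essential supremum only on a space of positive measure. *)
have mu1 : (0 < mu2 [set: Omega * Omega])%E.
  by have -> : mu2 [set: Omega * Omega] = 1%E := probability_setT mu2.
rewrite /Linfty_norm unlock mu1 => /ess_supP.
by apply: filterS => z /=; rewrite lee_fin.
Qed.

Lemma Phi_derivative (t : R) : 0 <= t -> forall e : R, 0 < e ->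
  exists2 dl : R, 0 < dl & forall h : R, `|h| < dl -> 0 <= t + h ->
    {ae mu2, forall z, `|Phi (t + h) z - Phi t z - h * V (Phi t) z| <= e * `|h|}.
Proof.
move=> t0 e e0; have [_ _ cv] := hPhi.
(* Convergence in the extended reals splits into finiteness near [t] and convergence of [fine]; the
   latter alone says nothing about infinite values. *)
have /fine_cvgP[] := cv t t0.
rewrite near_withinE => -[d1 /= d10 H1].
move=> /cvgr0Pnorm_lt /(_ e e0); rewrite near_withinE => -[d2 /= d20 H2].
exists (Num.min d1 d2); first by rewrite lt_min d10.
move=> h; rewrite lt_min => /andP[hd1 hd2] th.
have [->|h0] := eqVneq h 0.
  by apply: aeW => z; rewrite addr0 subrr mul0r subr0 normr0 mulr0.
have H1' := H1 h; have H2' := H2 h; move: H1' H2'.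
rewrite /= !sub0r !normrN => /(_ hd1 h0 th) F /(_ hd2 h0 th) L.
have : (Linfty_norm mu (fun z => ((Phi (t + h) z - Phi t z) / h - V (Phi t) z)%R) <= e%:E)%E.
  by rewrite -(fineK F) lee_fin; apply: ltW; apply: le_lt_trans L; exact: ler_norm.
move/Linfty_norm_ae; apply: filterS => z le.
rewrite -ler_pdivrMr ?normr_gt0// -normfV -normrM (le_trans _ le)//.
rewrite le_eqVlt; apply/orP; left; apply/eqP; congr (`| _ |); field.
exact: h0.
Qed.

(** The [L^oo] derivative passes to every integral against a bounded weight, the error being scaled
    by the bound [M] of the weight; [M + 1] avoids dividing by zero. *)
Lemma Phi_test_derivative (w : Omega * Omega -> R) : bmeas w ->
  half_derivative (fun t => \int[mu2]_z (w z * Phi t z))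
                  (fun t => \int[mu2]_z (w z * V (Phi t) z)).
Proof.
move=> bw t t0 e e0; have [_ [M wM]] := bw.
have M0 : 0 <= M by rewrite (le_trans _ (wM point)).
have M1 : 0 < M + 1 by rewrite ltr_wpDl.
have [dl dl0 H] := Phi_derivative t0 (divr_gt0 e0 M1).
exists dl => // h hd th.
have b1 := bmeas_Phi th; have b2 := bmeas_Phi t0; have b3 := bmeas_V t0.
have bh : bmeas (fun z => h * V (Phi t) z) by apply: bmeasM => //; exact: bmeas_cst.
rewrite (_ : _ - _ - _ =
    \int[mu2]_z (w z * (Phi (t + h) z - Phi t z - h * V (Phi t) z))); last first.
  rewrite -bintZ; last exact: bmeasM.
  rewrite -bintB; [|exact: bmeasM..]; rewrite -bintB; last 2 first.
  - by apply: bmeasB; exact: bmeasM.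
  - by apply: bmeasM; [exact: bmeas_cst|exact: bmeasM].
  by apply: eq_Rintegral => z _; rewrite !mulrBr (mulrCA (w z)).
apply: bint_norm_le_ae.
  by apply: bmeasM => //; apply: bmeasB => //; exact: bmeasB.
apply: filterS (H h hd th) => z le; rewrite normrM.
rewrite (le_trans (ler_pM _ _ (wM z) le))//.
rewrite (_ : M * _ = (M / (M + 1)) * (e * `|h|)); last by field; rewrite gt_eqF.
rewrite ler_piMl//; first by rewrite mulr_ge0// ltW.
by rewrite ler_pdivrMr// mul1r lerDl.
Qed.

(** * The flow stays within the graphons *)

Definition good t := {ae mu2, forall z, 0 <= Phi t z <= 1}.
(** [P t] is the truncation to which the pointwise velocity bounds apply, and [g t] the resulting
    [L^1] error, which vanishes exactly when [Phi t] is a graphon. *)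
Let P t z := clamp 0 1 (Phi t z).
Let g t := \int[mu2]_z `|Phi t z - P t z|.

Let bP t : 0 <= t -> bmeas (P t).
Proof. by move=> t0; apply: bmeas_clamp; exact: bmeas_Phi. Qed.

Let P01 t z : 0 <= P t z <= 1. Proof. exact: clampP. Qed.

Let bgap t : 0 <= t -> bmeas (fun z => `|Phi t z - P t z|).
Proof.
by move=> t0; apply: bmeas_norm; apply: bmeasB; [exact: bmeas_Phi|exact: bP].
Qed.

Let good_gap t : 0 <= t -> g t <= 0 -> good t.
Proof.
move=> t0 g0; have : g t = 0.
  apply/le_anti; rewrite g0/=; apply: Rintegral_ge0 => z _; exact: normr_ge0.
move/(bint_eq0_ae (bmeasB (bmeas_Phi t0) (bP t0))); apply: filterS => z /eqP.
by rewrite subr_eq0 => /eqP ->; exact: P01.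
Qed.

Let L2 : R := L1_lipschitz_const k 2.

Let L2_ge0 : 0 <= L2.
Proof. by rewrite /L2 /L1_lipschitz_const !mulr_ge0 ?nterms_ge0// exprn_ge0. Qed.

(** [velocity_L1] asks for bounds at every point, while [Phi t] is bounded by 2 only almost
    everywhere; its truncation [Q] to [[-2, 2]] is an equivalent kernel that satisfies them. *)
Let V_gap t : 0 <= t -> {ae mu2, forall z, `|Phi t z| <= 2} ->
  \int[mu2]_z `|V (Phi t) z - V (P t) z| <= L2 * g t.
Proof.
move=> t0 le2; pose Q z := clamp (-2) 2 (Phi t z).
have bQ : bmeas Q by apply: bmeas_clamp; exact: bmeas_Phi.
have bVQ := bmeas_velocity mu rule bQ.
have bVP := bmeas_velocity mu rule (bP t0).
have bV := bmeas_V t0.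
have PhiQ : {ae mu2, forall z, Phi t z = Q z}.
  by apply: filterS le2 => z; rewrite ler_norml => h; rewrite /Q clamp_id.
have Q2 z : `|Q z| <= 2 by rewrite ler_norml clampP//; lra.
have P2 z : `|P t z| <= 2.
  by have /andP[p0 p1] := P01 t z; rewrite ger0_norm//; lra.
have := velocity_L1 mu hrule (ler0n R 2) bQ (bP t0) Q2 P2.
rewrite -/L2.
rewrite (bint_ae (f := fun z => `|V Q z - V (P t) z|)
  (g := fun z => `|V (Phi t) z - V (P t) z|)); last 3 first.
- by apply: bmeas_norm; exact: bmeasB.
- by apply: bmeas_norm; exact: bmeasB.
- by apply: filterS (velocity_ae (bmeas_Phi t0) bQ PhiQ) => z ->.
rewrite (bint_ae (f := fun z => `|Q z - P t z|)
  (g := fun z => `|Phi t z - P t z|))//; last 3 first.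
- by apply: bmeas_norm; apply: bmeasB => //; exact: bP.
- exact: bgap.
- by apply: filterS PhiQ => z ->.
Qed.

(* [w] is a sign, and [e] the end of [0,1], for which [w * (Phi t - e)] measures
   how far [Phi t] escapes on the support of [w]; the velocity points inwards
   there. *)
Let escape (w : Omega * Omega -> R) (e s b m : R) : bmeas w ->
  (forall z, `|w z| <= 1) ->
  (forall z p x, - (N * p) <= x <= N * (1 - p) -> w z * x <= - (N * (w z * (p - e)))) ->
  (forall z p, 0 <= p <= 1 -> w z * (p - e) <= 0) ->
  0 <= s -> s <= b -> good s ->
  (forall t, s <= t <= b -> {ae mu2, forall z, `|Phi t z| <= 2}) ->
  (forall t, s <= t <= b -> g t <= m) ->
  \int[mu2]_z (w z * (Phi b z - e)) <= (N + L2) * m * (b - s).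
Proof.
move=> bw w1 wV we s0 sb gs le2 gm.
have m0 : 0 <= m.
  rewrite (le_trans _ (gm s _)) ?lexx//; apply: Rintegral_ge0 => z _; exact: normr_ge0.
pose q t := \int[mu2]_z (w z * Phi t z) - \int[mu2]_z (w z * e).
have be : bmeas (fun z => w z * e) by apply: bmeasM => //; exact: bmeas_cst.
have bwP t : 0 <= t -> bmeas (fun z => w z * Phi t z).
  by move=> t0; apply: bmeasM => //; exact: bmeas_Phi.
have qE t : 0 <= t -> q t = \int[mu2]_z (w z * (Phi t z - e)).
  move=> t0; rewrite /q -bintB//; last exact: bwP.
  by apply: eq_Rintegral => z _; rewrite mulrBr.
have Dq : half_derivative q (fun t => \int[mu2]_z (w z * V (Phi t) z)).
  move=> t t0 e' e'0; have [dl dl0 H] := Phi_test_derivative bw t0 e'0.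
  exists dl => // h hd th; rewrite /q opprB addrACA addrA addrK.
  by rewrite (_ : _ - _ - _ = \int[mu2]_z (w z * Phi (t + h) z) -
    \int[mu2]_z (w z * Phi t z) - h * \int[mu2]_z (w z * V (Phi t) z)) ?H//; ring.
rewrite -qE; last exact: le_trans sb.
apply: (half_derivative_gronwall Dq s0 sb (nterms_ge0 k)) => //.
- by rewrite mulr_ge0// addr_ge0// nterms_ge0.
- rewrite qE// -[leRHS](bint_cst mu2 0); apply: bint_le_ae => //.
  + by apply: bmeasM => //; apply: bmeasB; [exact: bmeas_Phi|exact: bmeas_cst].
  + exact: bmeas_cst.
  + by apply: filterS gs => z; exact: we.
move=> t stb; have /andP[st tb] := stb; have t0 : 0 <= t := le_trans s0 st.
have b1 := bmeas_Phi t0; have b2 := bP t0; have b3 := bmeas_V t0.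
have b4 := bmeas_velocity mu rule b2.
have bd : bmeas (fun z => `|V (Phi t) z - V (P t) z|).
  by apply: bmeas_norm; exact: bmeasB.
have bE : bmeas (fun z => w z * (Phi t z - e)).
  by apply: bmeasM => //; apply: bmeasB => //; exact: bmeas_cst.
have bg' := bgap t0.
have Psym : {ae mu2, forall z, P t (z.1, z.2) = P t (z.2, z.1)}.
  by apply: filterS (sym_Phi t0) => z; rewrite /P => ->.
apply: (@le_trans _ _ (\int[mu2]_z (- (N * (w z * (Phi t z - e))) +
    (N * `|Phi t z - P t z| + `|V (Phi t) z - V (P t) z|)))).
  have bN c f : bmeas f -> bmeas (fun z : Omega * Omega => c * f z).
    by move=> bf; apply: bmeasM => //; exact: bmeas_cst.
  apply: bint_le_ae.
  - exact: bmeasM.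
  - apply: bmeasD; first by apply: bmeasN; exact: bN.
    by apply: bmeasD => //; exact: bN.
  apply: filterS Psym => z Ps.
  have vb := velocity_bounds mu hrule b2 (P01 t) Ps.
  have h1 := wV z _ _ vb.
  have N0 := nterms_ge0 k (R := R).
  have h2 : w z * (V (Phi t) z - V (P t) z) <= `|V (Phi t) z - V (P t) z|.
    by rewrite (le_trans (ler_norm _))// normrM ler_piMl.
  have h3 : w z * (Phi t z - P t z) <= `|Phi t z - P t z|.
    by rewrite (le_trans (ler_norm _))// normrM ler_piMl.
  have h4 : N * (w z * (Phi t z - P t z)) <= N * `|Phi t z - P t z| by rewrite ler_wpM2l.
  rewrite (_ : w z * V (Phi t) z = w z * V (P t) z + w z * (V (Phi t) z - V (P t) z)); last by ring.
  rewrite (_ : - (N * (w z * (Phi t z - e))) = - (N * (w z * (P t z - e))) - N * (w z * (Phi t z - P t z))); last by ring.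
  lra.
have bN c f : bmeas f -> bmeas (fun z : Omega * Omega => c * f z).
  by move=> bf; apply: bmeasM => //; exact: bmeas_cst.
rewrite bintD; [|by apply: bmeasN; exact: bN|by apply: bmeasD => //; exact: bN].
rewrite bintN ?bintD ?bintZ//; [|exact: bN|exact: bN].
rewrite -qE//; have h := V_gap t0 (le2 t stb); have gt := gm t stb.
rewrite lerD2l mulrDl lerD//; first by rewrite ler_wpM2l// nterms_ge0.
by rewrite (le_trans h)// ler_wpM2l.
Qed.

Let measurable_level (f : Omega * Omega -> R) c : bmeas f -> measurable [set z | c < f z].
Proof.
move=> [mf _]; rewrite -[X in measurable X]setTI.
rewrite [X in _ `&` X](_ : _ = f @^-1` `]c, +oo[); first exact: mf.
by apply/seteqP; split => x /=; rewrite in_itv/= andbT.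
Qed.

(** The excess at time [b] is the part above 1 plus the part below 0. Each is an integral against a
    sign supported on the escape set at time [b], and [escape] applies because this set is kept
    fixed at all earlier times. *)
Let gap_le s b m : 0 <= s -> s <= b -> good s ->
  (forall t, s <= t <= b -> {ae mu2, forall z, `|Phi t z| <= 2}) ->
  (forall t, s <= t <= b -> g t <= m) ->
  g b <= 2 * (N + L2) * m * (b - s).
Proof.
move=> s0 sb gs le2 gm; have b0 := le_trans s0 sb.
have bb := bmeas_Phi b0.
pose D1 := [set z | 1 < Phi b z]; pose D0 := [set z | 0 < - Phi b z].
have mD1 : measurable D1 by exact: measurable_level.
have mD0 : measurable D0 by apply: measurable_level; exact: bmeasN.
have b1 := bmeas_indic (R := R) mD1.
have b2 : bmeas (fun z => - \1_D0 z : R) by apply: bmeasN; exact: bmeas_indic.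
have i01 (D : set (Omega * Omega)) z : 0 <= (\1_D z : R) <= 1.
  by rewrite indicE; case: (_ \in _); rewrite ler01 lexx.
have e1 : \int[mu2]_z (\1_D1 z * (Phi b z - 1)) <= (N + L2) * m * (b - s).
  apply: escape => //.
  - by move=> z; have /andP[? ?] := i01 D1 z; rewrite ger0_norm.
  - move=> z p x /andP[_ h]; have /andP[i0 _] := i01 D1 z.
    by rewrite mulrCA -mulrN ler_wpM2l// (le_trans h)//; lra.
  - move=> z p /andP[_ p1]; have /andP[i0 _] := i01 D1 z.
    by rewrite mulr_ge0_le0// subr_le0.
have e0 : \int[mu2]_z (- \1_D0 z * (Phi b z - 0)) <= (N + L2) * m * (b - s).
  apply: escape => //.
  - by move=> z; have /andP[? ?] := i01 D0 z; rewrite normrN ger0_norm.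
  - move=> z p x /andP[h _]; have /andP[i0 _] := i01 D0 z.
    have := ler_wpM2l i0 h.
    by rewrite subr0 mulrN !mulNr mulrN opprK (mulrCA N) lerNl.
  - move=> z p /andP[p0 _]; have /andP[i0 _] := i01 D0 z.
    by rewrite mulNr oppr_le0 mulr_ge0// subr0.
suff -> : g b = \int[mu2]_z (\1_D1 z * (Phi b z - 1)) +
    \int[mu2]_z (- \1_D0 z * (Phi b z - 0)).
  by rewrite (le_trans (lerD e1 e0))// le_eqVlt; apply/orP; left; apply/eqP; ring.
rewrite -bintD; last 2 first.
- by apply: bmeasM => //; apply: bmeasB => //; exact: bmeas_cst.
- by apply: bmeasM => //; apply: bmeasB => //; exact: bmeas_cst.
apply: eq_Rintegral => z _; rewrite /P /clamp subr0 !indicE.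
have [h|h] := ltP 1 (Phi b z).
  rewrite (mem_set (_ : D1 z))// memNset => [|/=]; last first.
    by apply/negP; rewrite -leNgt oppr_le0 (le_trans _ (ltW h)).
  by rewrite max_r// mul1r oppr0 mul0r addr0 ger0_norm// subr_ge0 ltW.
rewrite memNset => [|/=]; last by apply/negP; rewrite -leNgt.
rewrite mul0r add0r; have [h'|h'] := leP 0 (Phi b z).
  rewrite memNset => [|/=]; last by apply/negP; rewrite -leNgt oppr_le0.
  by rewrite subrr normr0 oppr0 mul0r.
rewrite (mem_set (_ : D0 z)) => [|/=]; last by rewrite /D0/= oppr_gt0.
by rewrite subr0 mulN1r ltr0_norm.
Qed.

(** The derivative estimate with [e = 1]. The constant depends on [t], as no uniform bound on the
    flow is known yet. *)
Let local_bound t : 0 <= t -> exists2 B : R, 0 <= B &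
  exists2 dl : R, 0 < dl & forall h : R, `|h| < dl -> 0 <= t + h ->
    {ae mu2, forall z, `|Phi (t + h) z - Phi t z| <= B * `|h|}.
Proof.
move=> t0; have [dl dl0 H] := Phi_derivative t0 ltr01.
have [_ [M VM]] := bmeas_V t0.
have M0 : 0 <= M by rewrite (le_trans _ (VM point)).
exists (1 + M); first by rewrite addr_ge0.
exists dl => // h hd th; apply: filterS (H h hd th) => z le.
rewrite (_ : _ - _ = (Phi (t + h) z - Phi t z - h * V (Phi t) z) + h * V (Phi t) z); last by ring.
rewrite (le_trans (ler_normD _ _))// mulrDl lerD//.
by rewrite normrM mulrC ler_wpM2r.
Qed.

(** On a short interval [gap_le] bounds the supremum of the gap by half of itself. The supremum is
    finite because [|Phi t| <= 2] there, so it is zero. *)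
Let good_forward s : 0 <= s -> good s ->
  exists2 dl : R, 0 < dl & forall t, s <= t <= s + dl -> good t.
Proof.
move=> s0 gs; have [B B0 [d1 d10 H]] := local_bound s0.
pose K := 2 * (N + L2).
have K0 : 0 <= K by rewrite mulr_ge0// addr_ge0// nterms_ge0.
(* The three bounds keep [t] where the local Lipschitz bound holds, [|Phi t|] at most 2, and the
   factor [K * dl] coming from [gap_le] at most one half. *)
pose dl := Num.min (d1 / 2) (Num.min ((B + 1)^-1) ((2 * (K + 1))^-1)).
have B1 : 0 < B + 1 by rewrite ltr_wpDl.
have K1 : 0 < 2 * (K + 1) by rewrite mulr_gt0// ltr_wpDl.
have dl0 : 0 < dl by rewrite !lt_min divr_gt0//= !invr_gt0 B1.
have dld : dl < d1 by rewrite /dl gt_min ltr_pdivrMr// mulr_natr mulr2n ltrDl d10.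
have dlB : dl <= (B + 1)^-1 by rewrite /dl !ge_min lexx/= orbT.
have dlK : dl <= (2 * (K + 1))^-1 by rewrite /dl !ge_min lexx/= !orbT.
exists dl => //.
have le2 t : s <= t <= s + dl -> {ae mu2, forall z, `|Phi t z| <= 2}.
  move=> /andP[st tsd].
  have ht : `|t - s| < d1.
    by rewrite ger0_norm ?subr_ge0// (le_lt_trans _ dld)// lerBlDl.
  have := H _ ht; rewrite (_ : s + (t - s) = t); last by ring.
  move=> /(_ (le_trans s0 st)).
  apply: filterS2 gs => z /andP[p0 p1] le.
  rewrite -(subrK (Phi s z) (Phi t z)) (le_trans (ler_normD _ _))//.
  rewrite (_ : 2 = 1 + 1 :> R) // lerD//; last by rewrite ger0_norm.
  rewrite (le_trans le)// (@le_trans _ _ ((B + 1) * dl))//.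
    by rewrite ler_pM// ?lerDl// ger0_norm ?subr_ge0// lerBlDl.
  by rewrite -ler_pdivlMl// mulr1.
have t0 t : s <= t <= s + dl -> 0 <= t by move=> /andP[st _]; exact: le_trans st.
have g3 t : s <= t <= s + dl -> g t <= 3.
  move=> tt; rewrite -[leRHS](bint_cst mu2); apply: bint_le_ae.
  - exact/bgap/t0.
  - exact: bmeas_cst.
  apply: filterS (le2 t tt) => z le; rewrite (le_trans (ler_normB _ _))//.
  have /andP[p0 p1] := P01 t z; rewrite (ger0_norm p0).
  by rewrite (_ : 3 = 2 + 1 :> R) ?lerD//; ring.
pose S := [set x | exists2 t, s <= t <= s + dl & x = g t].
have S0 : S !=set0 by exists (g s), s => //; rewrite lexx lerDl ltW.
have Sub : has_ubound S by exists 3 => _ [t tt ->]; exact: g3.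
have supg t : s <= t <= s + dl -> g t <= sup S.
  by move=> tt; apply: ub_le_sup => //; exists t.
have half : sup S <= sup S / 2.
  apply: ge_sup => // _ [t tt ->]; have /andP[st td] := tt.
  have sub u : s <= u <= t -> s <= u <= s + dl.
    by move=> /andP[-> ut]; exact: le_trans td.
  have := gap_le s0 st gs (fun u hu => le2 u (sub u hu)) (fun u hu => supg u (sub u hu)).
  move/le_trans; apply.
  have m0 : 0 <= sup S.
    by rewrite (le_trans _ (supg t tt))//; apply: Rintegral_ge0 => z _; exact: normr_ge0.
  rewrite -/K mulrAC mulrC ler_wpM2l//.
  rewrite (@le_trans _ _ ((K + 1) * dl))//.
    by rewrite ler_pM// ?subr_ge0// ?lerDl// lerBlDl.
  rewrite (le_trans (ler_wpM2l (ltW (ltr_wpDl K0 ltr01)) dlK))//.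
  by rewrite invfM mulrCA divff ?mulr1// gt_eqF// ltr_wpDl.
move=> t tt; apply: good_gap; first exact: t0.
by rewrite (le_trans (supg t tt))//; lra.
Qed.

(** Shortly before [s] the flow is a graphon, from which [Phi s] differs by at most [B * h].
    Truncation moves a value no farther than its distance to any point of [[0,1]], so the gap at [s]
    is at most every positive [e]. *)
Let good_closed s : 0 < s -> (forall t, 0 <= t < s -> good t) -> good s.
Proof.
move=> s0 gt; have [B B0 [d1 d10 H]] := local_bound (ltW s0).
apply: good_gap; first exact: ltW.
apply/ler_addgt0Pl => e e0; rewrite addr0.
pose h := Num.min (d1 / 2) (Num.min (s / 2) (e / (B + 1))).
have B1 : 0 < B + 1 by rewrite ltr_wpDl.
have h0 : 0 < h by rewrite !lt_min !divr_gt0.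
have hd : `|- h| < d1.
  by rewrite normrN gtr0_norm// /h gt_min ltr_pdivrMr// mulr_natr mulr2n ltrDl d10.
have s2 : s / 2 < s by lra.
have hs : h < s by rewrite /h !gt_min s2 orbT.
have he : h <= e / (B + 1) by rewrite /h !ge_min lexx !orbT.
have sh : 0 <= s + - h by rewrite subr_ge0 ltW.
have gsh : good (s - h) by apply: gt; rewrite sh ltrBlDr ltrDl.
rewrite -[leRHS](bint_cst mu2); apply: bint_le_ae.
- exact/bgap/ltW.
- exact: bmeas_cst.
have Hh := H _ hd sh; apply: filterS2 Hh gsh => z le /andP[p0 p1].
rewrite (@le_trans _ _ (`|Phi (s - h) z - Phi s z|))//.
  rewrite /P /clamp; have [h1|h1] := leP 1 (Phi s z).
    by rewrite max_r// ger0_norm ?subr_ge0// distrC (le_trans _ (ler_norm _))// lerD2l lerN2.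
  have [h2|h2] := leP 0 (Phi s z); first by rewrite subrr normr0.
  by rewrite subr0 ltr0_norm// (le_trans _ (ler_norm _))// lerDr.
rewrite (le_trans le)// normrN gtr0_norm// (@le_trans _ _ ((B + 1) * h))//.
  by rewrite ler_wpM2r ?lerDl// ltW.
by rewrite mulrC -ler_pdivlMr.
Qed.

(** Continuation: the times up to which the flow is a graphon form an interval that contains its
    supremum by [good_closed] and would pass it by [good_forward]. *)
Lemma trajectory_graphon t : 0 <= t -> good t.
Proof.
move=> t1; apply: contrapT => ngt.
have g0 : good 0 by have [_ h _] := hPhi; apply: filterS h => z ->.
pose S := [set t | 0 <= t /\ forall u, 0 <= u <= t -> good u].
have S0 : S !=set0.
  by exists 0; split => // u; rewrite -eq_le => /eqP <-.
have Sub : has_ubound S.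
  exists t => u [u0 gu]; rewrite leNgt; apply/negP => tu.
  by apply: ngt; apply: gu; rewrite t1 ltW.
have s0 : 0 <= sup S by apply: ub_le_sup => //; split => // u; rewrite -eq_le => /eqP <-.
have gs u : 0 <= u < sup S -> good u.
  move=> /andP[u0 us]; have [v [v0 gv] uv] := sup_gt S0 us.
  by apply: gv; rewrite u0 ltW.
have gsup : good (sup S).
  have [e|ne] := eqVneq (sup S) 0; first by rewrite e.
  by apply: good_closed => //; rewrite lt_neqAle eq_sym ne.
have [dl dl0 H] := good_forward s0 gsup.
have : S (sup S + dl).
  split => [|u /andP[u0 us]]; first by rewrite addr_ge0// ltW.
  have [h|h] := ltP u (sup S); first by apply: gs; rewrite u0.
  by apply: H; rewrite h.
move/(ub_le_sup Sub); rewrite gerDl leNgt dl0//.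
Qed.

(** * The trajectory tested on rectangles *)

Definition vel_bound : R := N * (1 + 1) ^+ size (vertex_pairs k).
Definition cut_lipschitz_const : R := N * (size (vertex_pairs k))%:R.

Lemma box_int_ae (f h : Omega * Omega -> R) A B : bmeas f -> bmeas h ->
  measurable A -> measurable B ->
  {ae mu2, forall z, f z = h z} -> box_int mu f A B = box_int mu h A B.
Proof.
move=> bf bh mA mB fh; apply: bint_ae.
- by apply: bmeas_rect => //; exact: bmeas_indic.
- by apply: bmeas_rect => //; exact: bmeas_indic.
- by apply: filterS fh => z ->.
Qed.

Lemma box_int_norm_le (f : Omega * Omega -> R) A B (c : R) : bmeas f ->
  measurable A -> measurable B -> (forall z, `|f z| <= c) -> `|box_int mu f A B| <= c.
Proof.
move=> bf mA mB fc; apply: bint_norm_le.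
  by apply: bmeas_rect => //; exact: bmeas_indic.
move=> z; rewrite !normrM (le_trans _ (fc z))// ler_piMl//.
by rewrite !indicE; case: (_ \in _); case: (_ \in _); rewrite ?normr0 ?normr1 ?mul0r ?mulr0 ?mulr1.
Qed.

(** Both kernels are replaced by their clamped representatives, which changes neither the rectangle
    tests nor, almost everywhere, the velocities; [velocity_cut] then applies. *)
Lemma velocity_cut_ae (U W : Omega * Omega -> R) (r : R) A B : bmeas U -> bmeas W ->
  {ae mu2, forall z, 0 <= U z <= 1} -> {ae mu2, forall z, 0 <= W z <= 1} ->
  (forall A B, measurable A -> measurable B ->
    `|box_int mu U A B - box_int mu W A B| <= r) ->
  measurable A -> measurable B ->
  `|box_int mu (V U) A B - box_int mu (V W) A B| <= cut_lipschitz_const * r.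
Proof.
move=> bU bW U01 W01 UWr mA mB.
have clampE (X : Omega * Omega -> R) : bmeas X -> {ae mu2, forall z, 0 <= X z <= 1} ->
    {ae mu2, forall z, X z = clamp 0 1 (X z)}.
  by move=> bX; apply: filterS => z h; rewrite clamp_id.
have bU' := bmeas_clamp 0 1 bU; have bW' := bmeas_clamp 0 1 bW.
have UE := clampE U bU U01; have WE := clampE W bW W01.
rewrite (box_int_ae _ _ mA mB (velocity_ae bU bU' UE)); try exact: bmeas_velocity.
rewrite (box_int_ae _ _ mA mB (velocity_ae bW bW' WE)); try exact: bmeas_velocity.
rewrite -box_intB//; try exact: bmeas_velocity.
rewrite /cut_lipschitz_const -mulrA; apply: velocity_cut => //.
- by move=> z; exact: clampP.
- by move=> z; exact: clampP.
move=> A' B' mA' mB'; rewrite box_intB//.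
by rewrite -(box_int_ae bU bU' mA' mB' UE) -(box_int_ae bW bW' mA' mB' WE) UWr.
Qed.

Lemma box_velocity_norm_ae (U : Omega * Omega -> R) A B : bmeas U ->
  {ae mu2, forall z, 0 <= U z <= 1} -> measurable A -> measurable B ->
  `|box_int mu (V U) A B| <= vel_bound.
Proof.
move=> bU U01 mA mB; have bU' := bmeas_clamp 0 1 bU.
have UE : {ae mu2, forall z, U z = clamp 0 1 (U z)}.
  by apply: filterS U01 => z h; rewrite clamp_id.
rewrite (box_int_ae _ _ mA mB (velocity_ae bU bU' UE)); try exact: bmeas_velocity.
apply: box_int_norm_le => //; first exact: bmeas_velocity.
move=> z; apply: velocity_norm => // y.
by have /andP[h0 h1] := @clampP 0 1 (U y) ler01; rewrite ger0_norm.
Qed.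

Section box.
Variables A B : set Omega.
Hypotheses (mA : measurable A) (mB : measurable B).

Lemma Phi_box_derivative : half_derivative (fun t => box_int mu (Phi t) A B)
  (fun t => box_int mu (V (Phi t)) A B).
Proof.
have bAB : bmeas (fun z : Omega * Omega => \1_A z.1 * \1_B z.2 : R).
  apply: bmeasM.
    by apply: bmeas_comp (bmeas_indic mA); exact: measurable_fst.
  by apply: bmeas_comp (bmeas_indic mB); exact: measurable_snd.
exact: (Phi_test_derivative bAB).
Qed.

Lemma Phi_box_lipschitz s t : 0 <= s -> s <= t ->
  `|box_int mu (Phi t) A B - box_int mu (Phi s) A B| <= vel_bound * (t - s).
Proof.
move=> s0 st.
have := @half_derivative_mvt_le _ _ _ s t 0 vel_bound Phi_box_derivative s0 st.
rewrite mulr0 subr0; apply => u /andP[su _]; rewrite subr0.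
have u0 := le_trans s0 su.
by apply: box_velocity_norm_ae => //; [exact: bmeas_Phi|exact: trajectory_graphon].
Qed.

End box.

Lemma vel_bound_ge0 : 0 <= vel_bound.
Proof. by rewrite mulr_ge0 ?nterms_ge0// exprn_ge0. Qed.

Lemma cut_lipschitz_const_ge0 : 0 <= cut_lipschitz_const.
Proof. by rewrite mulr_ge0 ?nterms_ge0. Qed.

(** Up to time [t + h] the flow moves by at most [vel_bound * h] on every rectangle, so the tested
    velocity changes by at most [cut_lipschitz_const] times that; the mean value theorem gives the
    quadratic remainder. *)
Lemma Phi_box_taylor A B t h : measurable A -> measurable B -> 0 <= t -> 0 <= h ->
  `|box_int mu (Phi (t + h)) A B - box_int mu (Phi t) A B - h * box_int mu (V (Phi t)) A B|
    <= cut_lipschitz_const * vel_bound * h ^+ 2.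
Proof.
move=> mA mB t0 h0; have tth : t <= t + h by rewrite lerDl.
have := @half_derivative_mvt_le _ _ _ t (t + h) (box_int mu (V (Phi t)) A B)
  (cut_lipschitz_const * (vel_bound * h)) (Phi_box_derivative mA mB) t0 tth.
rewrite (_ : t + h - t = h); last by ring.
move=> H; rewrite (le_trans (H _))//; last first.
  by rewrite le_eqVlt; apply/orP; left; apply/eqP; ring.
move=> u /andP[tu uth]; have u0 := le_trans t0 tu.
apply: velocity_cut_ae => //.
- exact: bmeas_Phi.
- exact: bmeas_Phi.
- exact: trajectory_graphon.
- exact: trajectory_graphon.
move=> A' B' mA' mB'; rewrite (le_trans (Phi_box_lipschitz mA' mB' t0 tu))//.
by rewrite ler_wpM2l ?vel_bound_ge0// lerBlDl.
Qed.

End trajectory.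

(** * One step of the flip process *)

Section finite_bilinear.
Context {R : realType} (n : nat).
Implicit Types (M : 'I_n -> 'I_n -> R) (al be : 'I_n -> R).

Definition bilin M al be : R := \sum_u \sum_v al u * be v * M u v.

Definition ind (A : {set 'I_n}) (u : 'I_n) : R := (u \in A)%:R.

Lemma weighted_sum_max (c al : 'I_n -> R) : (forall u, 0 <= al u <= 1) ->
  \sum_u al u * c u <= \sum_u ind [set u | 0 <= c u]%SET u * c u.
Proof.
move=> al01; apply: ler_sum => u _; have /andP[a0 a1] := al01 u.
rewrite /ind inE; have [c0|c0] := leP 0 (c u); first by rewrite mul1r ler_piMl.
by rewrite mul0r mulr_ge0_le0// ltW.
Qed.

(** The form is linear in each weight, so each in turn is replaced by the indicator of the vertices
    with nonnegative coefficient. This reduces measurable sets, which act as fractional vertex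
    weights, to finitely many pairs of vertex sets. *)
Lemma bilin_max M al be (r : R) :
  (forall u, 0 <= al u <= 1) -> (forall v, 0 <= be v <= 1) ->
  (forall A B : {set 'I_n}, bilin M (ind A) (ind B) <= r) -> bilin M al be <= r.
Proof.
move=> al01 be01 Mr.
have rowE a b : bilin M a b = \sum_u a u * \sum_v b v * M u v.
  by apply: eq_bigr => u _; rewrite mulr_sumr; apply: eq_bigr => v _; rewrite mulrA.
have colE a b : bilin M a b = \sum_v b v * \sum_u a u * M u v.
  rewrite /bilin exchange_big; apply: eq_bigr => v _; rewrite mulr_sumr.
  by apply: eq_bigr => u _; rewrite mulrCA mulrA.
rewrite rowE (le_trans (weighted_sum_max _ al01))// -rowE.
rewrite colE (le_trans (weighted_sum_max _ be01))// -colE.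
exact: Mr.
Qed.

Lemma bilinN M al be : bilin (fun u v => - M u v) al be = - bilin M al be.
Proof.
rewrite /bilin -sumrN; apply: eq_bigr => u _; rewrite -sumrN.
by apply: eq_bigr => v _; rewrite mulrN.
Qed.

Lemma bilinD M M' al be :
  bilin (fun u v => M u v + M' u v) al be = bilin M al be + bilin M' al be.
Proof.
rewrite /bilin -big_split; apply: eq_bigr => u _; rewrite -big_split.
by apply: eq_bigr => v _; rewrite mulrDr.
Qed.

Lemma bilinB M M' al be :
  bilin (fun u v => M u v - M' u v) al be = bilin M al be - bilin M' al be.
Proof. by rewrite bilinD bilinN. Qed.

Lemma bilin_sum (I : Type) (r : seq I) (P : pred I) (F : I -> 'I_n -> 'I_n -> R) al be :
  bilin (fun u v => \sum_(i <- r | P i) F i u v) al be =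
  \sum_(i <- r | P i) bilin (F i) al be.
Proof.
rewrite /bilin [RHS]exchange_big/=; apply: eq_bigr => u _; rewrite [RHS]exchange_big/=.
by apply: eq_bigr => v _; rewrite mulr_sumr.
Qed.

Lemma bilinZ (c : R) M al be : bilin (fun u v => c * M u v) al be = c * bilin M al be.
Proof.
rewrite /bilin mulr_sumr; apply: eq_bigr => u _; rewrite mulr_sumr.
by apply: eq_bigr => v _; rewrite mulrCA.
Qed.

Lemma bilin_norm_max M al be (r : R) :
  (forall u, 0 <= al u <= 1) -> (forall v, 0 <= be v <= 1) ->
  (forall A B : {set 'I_n}, `|bilin M (ind A) (ind B)| <= r) -> `|bilin M al be| <= r.
Proof.
move=> al01 be01 Mr; rewrite ler_norml lerNl -bilinN; apply/andP; split.
  apply: bilin_max => // A B; rewrite bilinN lerNl.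
  by have := Mr A B; rewrite ler_norml => /andP[].
apply: bilin_max => // A B; exact: le_trans (ler_norm _) (Mr A B).
Qed.

Lemma ind01 (A : {set 'I_n}) u : 0 <= ind A u <= 1.
Proof. by rewrite /ind; case: (u \in A); rewrite lexx ler01. Qed.

End finite_bilinear.

(** * Drift of the flip process *)

Section one_step.
Context {R : realType} (k n : nat).
Variable rule : graph k -> graph k -> R.
Hypothesis hrule : is_rule rule.
Implicit Types (G g : graph n) (w : {ffun 'I_k -> 'I_n}) (F J : graph k).

Lemma in_mkgraph m (E : {set {set 'I_m}}) e :
  (e \in edges (mkgraph E)) = (e \in E) && (#|e| == 2).
Proof. by rewrite !inE. Qed.

Lemma adj_irrefl m (g : graph m) u : adj g u u = false.
Proof.
apply/negP => h; have /forall_inP/(_ _ h) := edgesP g.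
by rewrite finset.setUid cards1.
Qed.

(** Holds for tuples with repetition too: when [w i = w j] both sides are false, as graphs have no
    loops. *)
Lemma adj_drawn G w i j : adj (drawn_graph G w) i j = (i != j) && adj G (w i) (w j).
Proof.
rewrite /adj in_mkgraph inE cards2 andbC imsetU !imset_set1.
by case: (i != j).
Qed.

Lemma adj_replace_image G w J i j : injective w -> adj (replace_graph G w J) (w i) (w j) = adj J i j.
Proof.
move=> iw; have [->|ij] := eqVneq i j; first by rewrite !adj_irrefl.
rewrite {1}/adj in_mkgraph cards2 (inj_eq iw) ij andbT !inE.
have -> : [set w i; w j]%SET = (w @: [set i; j])%SET by rewrite imsetU !imset_set1.
rewrite imsetS ?finset.subsetT//=.
apply/imsetP/idP => [[e eJ]|h]; last by exists [set i; j]%SET.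
by move/(imset_inj iw) => e'; rewrite /adj e'.
Qed.

Lemma adj_replace_off G w J u v : ~~ ((u \in codom w) && (v \in codom w)) ->
  adj (replace_graph G w J) u v = adj G u v.
Proof.
move=> off; rewrite {1}/adj in_mkgraph.
have [->|uv] := eqVneq u v; first by rewrite finset.setUid cards1 andbF adj_irrefl.
rewrite cards2 uv andbT !inE.
have nsub (T : {set 'I_k}) : [set u; v]%SET \subset w @: T = false.
  apply/negP => /fintype.subsetP sub; move/negP: off; apply; apply/andP; split.
    by have /imsetP[x _ ->] := sub u (set21 u v); exact: codom_f.
  by have /imsetP[x _ ->] := sub v (set22 u v); exact: codom_f.
rewrite nsub/=; case: imsetP => [[e eJ eE]|_]; last by rewrite orbF.
by have := nsub e; rewrite -eE subxx.
Qed.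

Lemma sum_injective (w : {ffun 'I_k -> 'I_n}) (f : 'I_n -> R) : injective w ->
  (forall u, u \notin codom w -> f u = 0) -> \sum_u f u = \sum_i f (w i).
Proof.
move=> iw f0; rewrite (bigID (mem (codom w)))/= [X in _ + X]big1 ?addr0; last first.
  by move=> u hu; exact: f0.
rewrite -big_uniq/=; last by rewrite /codom /image_mem map_inj_uniq ?enum_uniq.
by rewrite /codom /image_mem big_map big_enum.
Qed.

Definition adjR m (g : graph m) u v : R := (adj g u v)%:R.

(** Only pairs inside the image of [w] change, and these correspond to the index pairs [p]; the
    change is a sum of boundedly many terms, whatever [n] is. *)
Lemma bilin_replace G w J al be : injective w ->
  bilin (fun u v => adjR (replace_graph G w J) u v - adjR G u v) al be =
  \sum_(p : 'I_k * 'I_k | p.1 != p.2)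
    flip_sign (drawn_graph G w) J p.1 p.2 * (al (w p.1) * be (w p.2)).
Proof.
move=> iw; rewrite /bilin (sum_injective iw); last first.
  move=> u hu; apply: big1 => v _; rewrite /adjR adj_replace_off ?subrr ?mulr0//.
  by rewrite (negbTE hu).
rewrite [RHS]big_mkcond/= -(pair_bigA _ (fun i j => if i != j then flip_sign (drawn_graph G w) J i j * (al (w i) * be (w j)) else 0))/=.
apply: eq_bigr => i _; rewrite (sum_injective iw); last first.
  move=> u hu; rewrite /adjR adj_replace_off ?subrr ?mulr0//.
  by rewrite (negbTE hu) andbF.
apply: eq_bigr => j _; rewrite /adjR adj_replace_image// flip_signE adj_drawn.
have [->|ij] := eqVneq i j; first by rewrite !adj_irrefl subrr mulr0.
by rewrite mulrC.
Qed.

(** For injective [w], the expected change of the form given the sampled tuple. It makes sense for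
    every tuple, so the drift of the process (average over injective tuples) and the velocity
    (average over all tuples) are two averages of the same function. *)
Definition sample_drift G (al be : 'I_n -> R) w : R :=
  \sum_J \sum_(p : 'I_k * 'I_k | p.1 != p.2)
    vel_coef rule (drawn_graph G w) J p * (al (w p.1) * be (w p.2)).

Definition ninj : R := #|[set w : {ffun 'I_k -> 'I_n} | injectiveb w]%SET|%:R.

Definition drift g u v : R :=
  \sum_(g' : graph n) flip_transition rule g g' * (adjR g' u v - adjR g u v).

Lemma flip_transition_sum g (phi : graph n -> R) :
  \sum_(g' : graph n) flip_transition rule g g' * phi g' =
  \sum_(w : {ffun 'I_k -> 'I_n} | injectiveb w) ninj^-1 *
    \sum_J rule (drawn_graph g w) J * phi (replace_graph g w J).
Proof.
under eq_bigr do rewrite /flip_transition mulr_suml.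
rewrite exchange_big/=; apply: eq_bigr => w _.
under eq_bigr do rewrite -mulrA.
rewrite -mulr_sumr; congr (_ * _).
under [LHS]eq_bigr do rewrite mulr_suml.
rewrite (exchange_big_dep predT)//=; apply: eq_bigr => J _.
by rewrite (big_pred1 (replace_graph g w J)) => // g'; rewrite eq_sym.
Qed.

Lemma bilin_drift g al be : bilin (drift g) al be =
  ninj^-1 * \sum_(w : {ffun 'I_k -> 'I_n} | injectiveb w) sample_drift g al be w.
Proof.
rewrite /drift bilin_sum.
under eq_bigr do rewrite bilinZ.
rewrite flip_transition_sum mulr_sumr; apply: eq_bigr => w /injectiveP iw.
congr (_ * _); apply: eq_bigr => J _; rewrite bilin_replace// mulr_sumr.
by apply: eq_bigr => p _; rewrite /vel_coef mulrA.
Qed.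

Lemma flip_transition_ge0 g g' : 0 <= flip_transition rule g g'.
Proof.
apply: sumr_ge0 => w _; rewrite mulr_ge0 ?invr_ge0//.
by apply: sumr_ge0 => J _; have /andP[] := rule01 hrule (drawn_graph g w) J.
Qed.

Definition npairs : R := (k * k)%:R.

Lemma sum_pairs_norm_le (t : 'I_k * 'I_k -> R) : (forall p, `|t p| <= 1) ->
  `|\sum_(p : 'I_k * 'I_k | p.1 != p.2) t p| <= npairs.
Proof.
move=> t1; rewrite (le_trans (ler_norm_sum _ _ _))//.
apply: (@le_trans _ _ (\sum_(p : 'I_k * 'I_k) 1)).
  by rewrite [leLHS]big_mkcond/=; apply: ler_sum => p _; case: ifP.
by rewrite sumr_const card_prod card_ord /npairs.
Qed.

Lemma flip_sign_norm F J i j : `|flip_sign F J i j : R| <= 1.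
Proof.
by rewrite flip_signE; case: (adj J _ _); case: (adj F _ _);
  rewrite ?subrr ?subr0 ?sub0r ?normrN ?normr1 ?normr0.
Qed.

Section weights.
Variables al be : 'I_n -> R.
Hypotheses (al01 : forall u, 0 <= al u <= 1) (be01 : forall u, 0 <= be u <= 1).

Lemma weight_norm u v : `|al u * be v| <= 1.
Proof.
have /andP[a0 a1] := al01 u; have /andP[b0 b1] := be01 v.
by rewrite ger0_norm ?mulr_ge0// mulr_ile1.
Qed.

Lemma sample_drift_norm G w : `|sample_drift G al be w| <= npairs.
Proof.
rewrite /sample_drift; under eq_bigr do
  (under eq_bigr do rewrite /vel_coef -mulrA; rewrite -mulr_sumr).
rewrite (le_trans (ler_norm_sum _ _ _))//.
have [_ h] := hrule; rewrite -[leRHS]mul1r -(h (drawn_graph G w)) mulr_suml.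
apply: ler_sum => J _; have /andP[r0 _] := rule01 hrule (drawn_graph G w) J.
rewrite normrM ger0_norm// ler_wpM2l// sum_pairs_norm_le// => p.
by rewrite normrM mulr_ile1// ?flip_sign_norm// weight_norm.
Qed.

Lemma jump_norm g g' : flip_transition rule g g' != 0 ->
  `|bilin (fun u v => adjR g' u v - adjR g u v) al be| <= npairs.
Proof.
move=> t0.
have [w [J [iw <-]]] : exists w J, injective w /\ replace_graph g w J = g'.
  apply: contrapT => no; move/eqP: t0; apply; apply: big1 => w /injectiveP iw.
  rewrite big1 ?mulr0// => J /eqP e; exfalso; apply: no.
  by exists w, J.
rewrite bilin_replace// sum_pairs_norm_le// => p.
by rewrite normrM mulr_ile1// ?flip_sign_norm// weight_norm.
Qed.

End weights.

Hypothesis kn : (k <= n)%N.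

Lemma ninj_gt0 : 0 < ninj.
Proof. by rewrite /ninj card_inj_ffuns !card_ord ltr0n ffact_gt0. Qed.

Lemma flip_transition_sum1 g : \sum_(g' : graph n) flip_transition rule g g' = 1.
Proof.
have := flip_transition_sum g (fun=> 1); under eq_bigr do rewrite mulr1.
move=> ->; have [_ h] := hrule.
under eq_bigr do (under eq_bigr do rewrite mulr1; rewrite h mulr1).
rewrite sumr_const -[X in _ *+ X](_ : #|[set w : {ffun 'I_k -> 'I_n} | injectiveb w]%SET| = _).
  by rewrite -mulr_natr mulVf// gt_eqF// ninj_gt0.
by apply: eq_card => w; rewrite inE.
Qed.

Lemma drift_norm g al be : (forall u, 0 <= al u <= 1) -> (forall u, 0 <= be u <= 1) ->
  `|bilin (drift g) al be| <= npairs.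
Proof.
move=> al01 be01; rewrite bilin_drift normrM normfV (gtr0_norm ninj_gt0).
rewrite ler_pdivrMl ?ninj_gt0// (le_trans (ler_norm_sum _ _ _))//.
apply: (@le_trans _ _ (\sum_(w : {ffun 'I_k -> 'I_n} | injectiveb w) npairs)).
  by apply: ler_sum => w _; exact: sample_drift_norm.
rewrite sumr_const -[X in _ *+ X](_ : #|[set w : {ffun 'I_k -> 'I_n} | injectiveb w]%SET| = _).
  by rewrite -mulr_natl.
by apply: eq_card => w; rewrite inE.
Qed.

(** Denominators cleared: at most a share [m * m / n] of all [m]-tuples has a repetition. *)
Lemma ffact_lower_bound m : ((n ^ m * n)%:R : R) <= (n ^_ m * n + n ^ m * (m * m))%:R.
Proof.
rewrite ler_nat; elim: m => [|m IH]; first by rewrite expn0 ffactn0 mul1n muln0 addn0.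
(* For [n <= m] the error term alone dominates the left-hand side. *)
have [mn|nm] := leqP n m.
  rewrite (@leq_trans (n ^ m.+1 * (m.+1 * m.+1)))// ?leq_addl// leq_mul2l.
  by rewrite (leq_trans mn) ?orbT// (leq_trans (leqnSn m))// leq_pmulr.
rewrite ffactnSr expnS.
have [d nE] : exists d, n = (m + d)%N by exists (n - m)%N; rewrite subnKC// ltnW.
rewrite nE addKn -nE.
apply: (@leq_trans ((n ^_ m * n + n ^ m * (m * m)) * n)).
  by rewrite -mulnA mulnC leq_mul2r IH orbT.
have le j : (n ^_ j <= n ^ j)%N.
  elim: j => [|j IHj]; first by rewrite ffactn0 expn0.
  by rewrite ffactnSr expnSr leq_mul// leq_subr.
have {}le := le m; move: {IH} (n ^_ m)%N (n ^ m)%N le => x y le.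
have h : (x * m <= y * m)%N by rewrite leq_mul2r le orbT.
rewrite nE; nia.
Qed.

(** With [S1] and [S2] the sums over injective and other tuples, the difference is
    [S2 / T - (T - ninj) / (T * ninj) * S1]; each part is at most [c] times the share of tuples with
    a repetition. *)
Lemma sampling_error (f : {ffun 'I_k -> 'I_n} -> R) (c : R) : (0 < n)%N ->
  (forall w, `|f w| <= c) ->
  `|((n ^ k)%:R)^-1 * \sum_w f w -
    ninj^-1 * \sum_(w : {ffun 'I_k -> 'I_n} | injectiveb w) f w|
  <= 2 * c * (k * k)%:R / n%:R.
Proof.
move=> n0 fc; set T : R := (n ^ k)%:R.
have T0 : 0 < T by rewrite ltr0n expn_gt0 n0.
have I0 := ninj_gt0; have n0' : (0 : R) < n%:R by rewrite ltr0n.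
have c0 : 0 <= c.
  by rewrite (le_trans _ (fc [ffun=> Ordinal n0])).
rewrite (bigID (fun w : {ffun 'I_k -> 'I_n} => injectiveb w))/=.
set S1 := \sum_(w : {ffun 'I_k -> 'I_n} | injectiveb w) f w.
set S2 := \sum_(w : {ffun 'I_k -> 'I_n} | ~~ injectiveb w) f w.
have cardI (P : pred {ffun 'I_k -> 'I_n}) (N' : R) :
    #|[set w | P w]%SET|%:R = N' -> `|\sum_(w | P w) f w| <= c * N'.
  move=> <-; rewrite (le_trans (ler_norm_sum _ _ _))//.
  apply: (@le_trans _ _ (\sum_(w | P w) c)); first by apply: ler_sum.
  rewrite sumr_const -[X in _ *+ X](_ : #|[set w | P w]%SET| = _) ?mulr_natr//.
  by apply: eq_card => w; rewrite inE.
have h1 : `|S1| <= c * ninj by apply: cardI.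
have IT : ninj + #|[set w : {ffun 'I_k -> 'I_n} | ~~ injectiveb w]%SET|%:R = T.
  rewrite /ninj -natrD /T; congr (_%:R).
  have -> : [set w : {ffun 'I_k -> 'I_n} | ~~ injectiveb w]%SET =
    (~: [set w : {ffun 'I_k -> 'I_n} | injectiveb w])%SET by apply/setP => w; rewrite !inE.
  by rewrite cardsC card_ffun !card_ord.
have h2 : `|S2| <= c * (T - ninj).
  by apply: cardI; rewrite -IT addrC addKr.
have TI : 0 <= T - ninj by rewrite -IT addrC addKr.
have gap : (T - ninj) / T <= (k * k)%:R / n%:R.
  rewrite ler_pdivrMr// mulrAC ler_pdivlMr//.
  have := ffact_lower_bound k; rewrite natrD !natrM -/T.
  have -> : (n ^_ k)%:R = ninj by rewrite /ninj card_inj_ffuns !card_ord.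
  by rewrite -natrM => h; lra.
rewrite (_ : _ - _ = T^-1 * S2 - (T - ninj) / (T * ninj) * S1); last first.
  by field; rewrite !gt_eqF.
rewrite (le_trans (ler_normB _ _))// !normrM.
apply: (@le_trans _ _ (2 * c * ((T - ninj) / T))); last first.
  by rewrite -[leRHS]mulrA ler_wpM2l// mulr_ge0.
rewrite (_ : 2 * c * _ = T^-1 * (c * (T - ninj)) + (T - ninj) / (T * ninj) * (c * ninj)); last first.
  by field; rewrite !gt_eqF.
rewrite lerD//; first by rewrite gtr0_norm ?invr_gt0// ler_wpM2l// invr_ge0 ltW.
rewrite -normrM ger0_norm; last by rewrite divr_ge0// mulr_ge0// ltW.
by rewrite ler_wpM2l// divr_ge0// mulr_ge0// ltW.
Qed.

End one_step.

Lemma bint_tensor (R : realType) d1 (T1 : measurableType d1) d2 (T2 : measurableType d2)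
    (P1 : probability T1 R) (P2 : probability T2 R) (u : T1 -> R) (v : T2 -> R) :
  bmeas u -> bmeas v ->
  \int[(P1 \x P2)%E]_z (u z.1 * v z.2) = \int[P1]_x u x * \int[P2]_y v y.
Proof.
move=> bu bv; rewrite bint_prod12/=; last first.
  apply: bmeasM.
    by apply: bmeas_comp bu; exact: measurable_fst.
  by apply: bmeas_comp bv; exact: measurable_snd.
rewrite mulrC -bintZ//; apply: eq_Rintegral => x _.
by rewrite bintZ// mulrC.
Qed.

(** * Step graphons: the velocity as sampling with replacement *)

Section cells.
Context {R : realType} d {Omega : measurableType d} (mu : probability Omega R).
Variables (k n : nat) (rule : graph k -> graph k -> R) (Om : 'I_n -> set Omega).
Hypothesis hOm : equipartition mu Om.
Local Notation II s f := (iterated_integral mu s f).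

Lemma equipartition_gt0 : (0 < n)%N.
Proof.
have [_ _ cov _] := hOm; have : (point : Omega) \in \bigcup_u Om u by rewrite cov inE.
by rewrite inE => -[u _ _]; exact: leq_ltn_trans (ltn_ord u).
Qed.

Lemma cell_exists : exists kap : Omega -> 'I_n, forall x u, Om u x <-> kap x = u.
Proof.
have [_ tri cov _] := hOm.
have /choice[kap H] : forall x, exists u, Om u x.
  move=> x; have : x \in \bigcup_u Om u by rewrite cov inE.
  by rewrite inE => -[u _ h]; exists u.
exists kap => x u; split=> [h|<-]; last exact: H.
have [//|ne] := eqVneq (kap x) u; exfalso.
have /trivIsetP/(_ (kap x) u I I ne) := tri.
by apply/eqP/set0P; exists x; split => //; exact: H.
Qed.

Definition cell : Omega -> 'I_n := sval (cid cell_exists).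

Lemma cellP x u : Om u x <-> cell x = u.
Proof. exact: svalP (cid cell_exists) x u. Qed.

Lemma indic_cell u x : \1_(Om u) x = (cell x == u)%:R :> R.
Proof.
rewrite indicE; congr ((nat_of_bool _)%:R); apply/idP/eqP.
  by rewrite inE => /cellP.
by move/cellP => h; rewrite inE.
Qed.

Lemma bmeas_cell u : bmeas (\1_(Om u) : Omega -> R).
Proof. by have [m _ _ _] := hOm; exact: bmeas_indic. Qed.

Lemma bint_cell u : \int[mu]_x \1_(Om u) x = n%:R^-1.
Proof. by have [m _ _ e] := hOm; rewrite bint_indic// e. Qed.

Lemma graphon_ofE (G : graph n) z :
  graphon_of Om G z = adjR G (cell z.1) (cell z.2) :> R.
Proof.
rewrite /graphon_of indicE /adjR; congr ((nat_of_bool _)%:R); apply/idP/idP.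
  by rewrite inE => -[u [v [h /cellP -> /cellP ->]]].
by move=> h; rewrite inE; exists (cell z.1), (cell z.2); split => //; exact/cellP.
Qed.

Lemma graphon_of01 (G : graph n) z : 0 <= (graphon_of Om G z : R) <= 1.
Proof. by rewrite graphon_ofE /adjR; case: adj; rewrite lexx ler01. Qed.

Lemma graphon_of_sum (G : graph n) z : graphon_of Om G z =
  \sum_u \sum_v adjR G u v * (\1_(Om u) z.1 * \1_(Om v) z.2) :> R.
Proof.
rewrite graphon_ofE (bigD1 (cell z.1))//= (bigD1 (cell z.2))//=.
rewrite !indic_cell !eqxx !mulr1 !big1 ?addr0// => [u /negbTE hu|v /negbTE hv].
  by rewrite big1// => v _; rewrite indic_cell eq_sym hu mul0r mulr0.
by rewrite !indic_cell (eq_sym _ v) hv !mulr0.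
Qed.

Lemma bmeas_graphon_of (G : graph n) : bmeas (graphon_of Om G : Omega * Omega -> R).
Proof.
rewrite (_ : graphon_of Om G = fun z =>
  \sum_u \sum_v adjR G u v * (\1_(Om u) z.1 * \1_(Om v) z.2)).
  apply: bmeas_sum => u; apply: bmeas_sum => v.
  apply: bmeasM; first exact: bmeas_cst.
  apply: bmeasM.
    by apply: bmeas_comp (bmeas_cell u); exact: measurable_fst.
  by apply: bmeas_comp (bmeas_cell v); exact: measurable_snd.
by apply/funext => z; rewrite graphon_of_sum.
Qed.

(** The share of the cell [Om u] covered by [A]: a [[0,1]]-valued vertex weight, and all that a step
    graphon sees of [A]. *)
Definition dens (A : set Omega) u : R := n%:R * \int[mu]_x (\1_A x * \1_(Om u) x).

Section box.
Variables A B : set Omega.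
Hypotheses (mA : measurable A) (mB : measurable B).

Let n0 : (0 : R) < n%:R. Proof. by rewrite ltr0n equipartition_gt0. Qed.

Lemma dens01 (D : set Omega) u : measurable D -> 0 <= dens D u <= 1.
Proof.
move=> mD; have bD := bmeas_indic (R := R) mD; have bu := bmeas_cell u.
have D0 x : 0 <= (\1_D x : R) by rewrite indicE ler0n.
have D1 x : (\1_D x : R) <= 1 by rewrite indicE; case: (_ \in _); rewrite ?ler01.
have O01 x : 0 <= (\1_(Om u) x : R) by rewrite indicE ler0n.
apply/andP; split.
  rewrite mulr_ge0//; apply: Rintegral_ge0 => x _; rewrite mulr_ge0//.
rewrite /dens mulrC -ler_pdivlMr// div1r -(bint_cell u); apply: bint_le => //.
  exact: bmeasM.
by move=> x; rewrite ler_piMl.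
Qed.

Lemma box_graphon (G : graph n) :
  box_int mu (graphon_of Om G) A B =
  (n%:R ^+ 2)^-1 * bilin (adjR G) (dens A) (dens B).
Proof.
have bA := bmeas_indic (R := R) mA; have bB := bmeas_indic (R := R) mB.
have bAu u : bmeas (fun x => \1_A x * \1_(Om u) x : R) by apply: bmeasM => //; exact: bmeas_cell.
have bBv v : bmeas (fun x => \1_B x * \1_(Om v) x : R) by apply: bmeasM => //; exact: bmeas_cell.
have buv u v : bmeas (fun z : Omega * Omega =>
    adjR G u v * ((\1_A z.1 * \1_(Om u) z.1) * (\1_B z.2 * \1_(Om v) z.2)) : R).
  apply: bmeasM; first exact: bmeas_cst.
  apply: bmeasM.
    by apply: (bmeas_comp _ (bAu u)); exact: measurable_fst.
  by apply: (bmeas_comp _ (bBv v)); exact: measurable_snd.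
rewrite /box_int (_ : (fun z => _) = fun z => \sum_u \sum_v
    adjR G u v * ((\1_A z.1 * \1_(Om u) z.1) * (\1_B z.2 * \1_(Om v) z.2))); last first.
  apply/funext => z; rewrite graphon_of_sum mulr_sumr; apply: eq_bigr => u _.
  by rewrite mulr_sumr; apply: eq_bigr => v _; ring.
rewrite bint_sum => [|u]; last by apply: bmeas_sum.
rewrite /bilin mulr_sumr; apply: eq_bigr => u _.
rewrite bint_sum// mulr_sumr; apply: eq_bigr => v _.
rewrite bintZ; last first.
  apply: bmeasM.
    by apply: (bmeas_comp _ (bAu u)); exact: measurable_fst.
  by apply: (bmeas_comp _ (bBv v)); exact: measurable_snd.
rewrite (bint_tensor _ _ (bAu u) (bBv v)) /dens; field.
by rewrite gt_eqF.
Qed.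

Lemma iint_prod (h : 'I_k -> Omega -> R) s X : (forall i, bmeas (h i)) -> uniq s ->
  II s (fun x => \prod_(i <- s) h i (x i)) X = \prod_(i <- s) \int[mu]_t h i t.
Proof.
move=> bh; elim: s X => [|i s IH] X; first by rewrite /= !big_nil.
rewrite [uniq _]/= => /andP[is_ us]; rewrite big_cons.
under eq_fun do rewrite big_cons.
have bs : cyl_bmeas (fun x : 'I_k -> Omega => \prod_(j <- s) h j (x j)).
  by apply: cyl_bmeas_prod => j; exact: cyl_bmeas_coord.
rewrite mulrC -bintZ; last exact: bh.
rewrite /=; apply: eq_Rintegral => t _; rewrite iintMl//; last first.
  by move=> j Y u js /=; case: eqVneq => // ij; rewrite ij js in is_.
by rewrite IH// /= eqxx mulrC.
Qed.

(** Exactly one assignment [w] has all its cell indicators equal to 1 at [x]. *)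
Lemma cell_expand (phi : {ffun 'I_k -> 'I_n} -> R) (x : 'I_k -> Omega) :
  phi [ffun i => cell (x i)] =
  \sum_w phi w * \prod_(i <- enum 'I_k) \1_(Om (w i)) (x i).
Proof.
rewrite (bigD1 [ffun i => cell (x i)])//= [X in _ + X]big1 => [|w hw]; last first.
  have [i hi] : exists i, cell (x i) != w i.
    apply: contrapT => no; move/eqP: hw; apply; apply/ffunP => i; rewrite ffunE.
    by apply/esym/eqP/negPn/negP => h; apply: no; exists i.
  rewrite (bigD1_seq i)/= ?mem_enum ?enum_uniq// indic_cell (negbTE hi) mul0r mulr0//.
rewrite addr0 big1 ?mulr1// => i _.
by rewrite indic_cell ffunE eqxx.
Qed.

(** The cells of the [k] coordinates are independent and uniform, and given its cell a coordinate
    lies in [A] with probability [dens]; hence an average over all tuples, with replacement. *)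
Lemma iint_cells (phi : {ffun 'I_k -> 'I_n} -> R) a b X : a != b ->
  II (enum 'I_k) (fun x => \1_A (x a) * \1_B (x b) * phi [ffun i => cell (x i)]) X =
  ((n ^ k)%:R)^-1 * \sum_w phi w * (dens A (w a) * dens B (w b)).
Proof.
move=> ab.
have bA := bmeas_indic (R := R) mA; have bB := bmeas_indic (R := R) mB.
pose h (w : {ffun 'I_k -> 'I_n}) i (t : Omega) : R :=
  (if i == a then \1_A t else if i == b then \1_B t else 1) * \1_(Om (w i)) t.
have bh w i : bmeas (h w i).
  apply: bmeasM; last exact: bmeas_cell.
  by case: eqP => // _; case: eqP => // _; exact: bmeas_cst.
have split_ab (e : 'I_k -> R) : (forall i, i != a -> i != b -> e i = 1) ->
    \prod_(i <- enum 'I_k) e i = e a * e b.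
  move=> e1; rewrite big_enum/= (bigD1 a)//= (bigD1 b)/= 1?eq_sym// big1 ?mulr1//.
  by move=> i /andP[ia ib]; exact: e1.
have hE w x : \prod_(i <- enum 'I_k) h w i (x i) =
    \1_A (x a) * \1_B (x b) * \prod_(i <- enum 'I_k) \1_(Om (w i)) (x i).
  rewrite big_split/=; congr (_ * _).
  rewrite (split_ab (fun i => if i == a then \1_A (x i) else if i == b then \1_B (x i) else 1)).
    by rewrite eqxx eq_sym (negbTE ab) eqxx.
  by move=> i /negbTE -> /negbTE ->.
rewrite (_ : (fun x => _) = fun x => \sum_w phi w * \prod_(i <- enum 'I_k) h w i (x i)); last first.
  apply/funext => x; rewrite cell_expand mulr_sumr; apply: eq_bigr => w _.
  by rewrite hE; ring.
have bp w : cyl_bmeas (fun x : 'I_k -> Omega => \prod_(i <- enum 'I_k) h w i (x i)).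
  by apply: cyl_bmeas_prod => i; exact: cyl_bmeas_coord.
rewrite iint_sum => [|w]; last by apply: cyl_bmeasM => //; exact: cyl_bmeas_cst.
rewrite mulr_sumr; apply: eq_bigr => w _; rewrite iintZ// iint_prod ?enum_uniq//.
rewrite mulrCA; congr (_ * _).
have hint i : \int[mu]_t h w i t = n%:R^-1 *
    (if i == a then dens A (w i) else if i == b then dens B (w i) else 1).
  rewrite /h /dens; case: eqP => _; first by rewrite mulKf// gt_eqF.
  case: eqP => _; first by rewrite mulKf// gt_eqF.
  by rewrite mulr1 -(bint_cell (w i)); apply: eq_Rintegral => t _; rewrite mul1r.
under eq_bigr do rewrite hint.
rewrite big_split/= big_const_seq count_predT size_enum_ord; congr (_ * _).
  by rewrite natrX -exprVn; elim: (k) => //= m ->; rewrite exprS.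
rewrite split_ab; first by rewrite eqxx eq_sym (negbTE ab) eqxx.
by move=> i /negbTE -> /negbTE ->.
Qed.

Lemma graph_ext m (F F' : graph m) :
  (forall i j : 'I_m, (i < j)%N -> adj F i j = adj F' i j) -> F = F'.
Proof.
move=> H; apply: val_inj; apply/setP => e /=.
have [/cards2P[i [j [ij ->]]]|ne] := boolP (#|e| == 2).
  have := H i j; have := H j i; rewrite (adjC F j i) (adjC F' j i) /adj.
  case: (ltngtP i j) => [_ _ ->//|_ ->//|/val_inj e'].
  by rewrite e' eqxx in ij.
have out (F0 : graph m) : (e \in edges F0) = false.
  by apply/negP => h; have /forall_inP/(_ _ h) := edgesP F0; apply/negP.
by rewrite !out.
Qed.

(** A step graphon takes the values 0 and 1, so each factor checks one pair and the product checks
    that the drawn graph is [F]. *)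
Lemma weight_graphon_of (F : graph k) (G : graph n) (x : 'I_k -> Omega) :
  induced_weight F (graphon_of Om G) x =
  (drawn_graph G [ffun i => cell (x i)] == F)%:R :> R.
Proof.
rewrite induced_weightE.
have facE p : p \in vertex_pairs k ->
    edge_factor F p (graphon_of Om G (x p.1, x p.2)) =
    (adj F p.1 p.2 == adj (drawn_graph G [ffun i => cell (x i)]) p.1 p.2)%:R :> R.
  move/vertex_pairsP => hp; rewrite adj_drawn !ffunE graphon_ofE /adjR/=.
  have -> : p.1 != p.2 by rewrite -val_eqE/= neq_ltn hp.
  rewrite /edge_factor; case: (adj F _ _); case: (adj G _ _);
  by rewrite ?subrr ?subr0.
have [E|ne] := eqVneq.
  by rewrite big_seq big1// => p hp; rewrite facE// E eqxx.
have [p hp pne] : exists2 p, p \in vertex_pairs k &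
    adj F p.1 p.2 != adj (drawn_graph G [ffun i => cell (x i)]) p.1 p.2.
  apply: contrapT => no; move/eqP: ne; apply; apply: graph_ext => i j ij.
  apply/esym/eqP/negPn/negP => h; apply: no; exists (i, j) => //.
  by rewrite mem_filter ij mem_enum.
rewrite (bigD1_seq p)//= ?vertex_pairs_uniq// facE// (negbTE pne) mul0r//.
Qed.

(** In the sum over [F] the indicator from [weight_graphon_of] keeps only the drawn graph, which
    leaves [sample_drift] averaged over all tuples. *)
Lemma box_velocity (G : graph n) :
  box_int mu (velocity mu rule (graphon_of Om G)) A B =
  ((n ^ k)%:R)^-1 * \sum_w sample_drift rule G (dens A) (dens B) w.
Proof.
have bA := bmeas_indic (R := R) mA; have bB := bmeas_indic (R := R) mB.
have bW := bmeas_graphon_of G.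
have bT F p : bmeas (fun z : Omega * Omega =>
    \1_A z.1 * \1_B z.2 * rooted_density mu F p.1 p.2 (graphon_of Om G) z).
  by apply: bmeas_rect => //; exact: bmeas_rooted.
rewrite /box_int velocityE (_ : (fun z => _) = fun z =>
  \sum_F \sum_H \sum_(p : 'I_k * 'I_k | p.1 != p.2) vel_coef rule F H p *
    (\1_A z.1 * \1_B z.2 * rooted_density mu F p.1 p.2 (graphon_of Om G) z)); last first.
  apply/funext => z; rewrite mulr_sumr; apply: eq_bigr => F _.
  rewrite mulr_sumr; apply: eq_bigr => H _.
  by rewrite mulr_sumr; apply: eq_bigr => p _; rewrite mulrCA.
have bt F H p : bmeas (fun z : Omega * Omega => vel_coef rule F H p *
    (\1_A z.1 * \1_B z.2 * rooted_density mu F p.1 p.2 (graphon_of Om G) z)).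
  by apply: bmeasM; [exact: bmeas_cst|exact: bT].
rewrite bint_sum => [|F]; last by apply: bmeas_sum => H; apply: bmeas_sum.
transitivity (\sum_F \sum_H \sum_(p : 'I_k * 'I_k | p.1 != p.2) vel_coef rule F H p *
  (((n ^ k)%:R)^-1 * \sum_w (drawn_graph G w == F)%:R * (dens A (w p.1) * dens B (w p.2)))).
  apply: eq_bigr => F _; rewrite bint_sum => [|H]; last exact: bmeas_sum.
  apply: eq_bigr => H _; rewrite bint_sum//; apply: eq_bigr => p hp.
  rewrite bintZ//; congr (_ * _).
  rewrite (rooted_integral mu (fun=> point) hp bA bB (cyl_bmeas_weight F bW)).
  rewrite -(iint_cells (fun w => (drawn_graph G w == F)%:R) (fun=> point) hp).
  by congr iterated_integral; apply/funext => x; rewrite weight_graphon_of.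
rewrite /sample_drift.
under [LHS]eq_bigr => F _ do (under eq_bigr => H _ do
  (under eq_bigr => p _ do rewrite mulrCA mulr_sumr;
   rewrite -mulr_sumr exchange_big/=); rewrite -mulr_sumr exchange_big/=).
rewrite -mulr_sumr; congr (_ * _); rewrite [LHS]exchange_big/=; apply: eq_bigr => w _.
rewrite (bigD1 (drawn_graph G w))//= [X in _ + X]big1 ?addr0 => [|F hF]; last first.
  apply: big1 => H _; apply: big1 => p _.
  by rewrite eq_sym (negbTE hF) mul0r mulr0.
by apply: eq_bigr => H _; apply: eq_bigr => p _; rewrite eqxx mul1r.
Qed.

End box.
End cells.

(** * A maximal inequality for finite Markov chains *)

(** From [1 - x / 2 <= expR (- (x / 2))] by squaring and inverting:
    [(1 + x + x ^+ 2) * (1 - x / 2) ^+ 2] equals [1 + x ^+ 2 / 4 * (1 - 3 * x + x ^+ 2)], which is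
    at least 1 in this range. *)
Lemma expR_quadratic (R : realType) (x : R) : `|x| <= 4^-1 -> expR x <= 1 + x + x ^+ 2.
Proof.
rewrite ler_norml => /andP[x0 x1].
have h1 : 1 - x / 2 <= expR (- (x / 2)) by exact: expR_ge1Dx.
have h0 : 0 < 1 - x / 2 by lra.
have -> : expR x = (expR (- (x / 2)) ^+ 2)^-1.
  by rewrite -expRM_natl -expRN; congr expR; rewrite mulrC; field.
rewrite invf_ple ?posrE ?exprn_gt0 ?expR_gt0//; last nra.
rewrite (@le_trans _ _ ((1 - x / 2) ^+ 2))//; last by rewrite ler_pXn2r// ?nnegrE ltW// expR_gt0.
rewrite -div1r ler_pdivrMr; last nra.
have : 0 <= x ^+ 2 by exact: sqr_ge0.
nra.
Qed.

Section chain.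
Context {R : realType} (S : finType).
Variables (p xi : S -> S -> R) (c lam : R).
Hypothesis p0 : forall x y, 0 <= p x y.
Hypothesis p1 : forall x, \sum_y p x y = 1.

Fixpoint path_weight (x : S) (s : seq S) : R :=
  if s is y :: s' then p x y * path_weight y s' else 1.

(** Some partial sum of [xi] along the path, the empty one included, reaches [eta]. Lowering the
    threshold at each step, rather than carrying a sum, fits an induction on the first step. *)
Fixpoint crosses (eta : R) (x : S) (s : seq S) : bool :=
  (eta <= 0) || (if s is y :: s' then crosses (eta - xi x y) y s' else false).

Lemma path_weight_ge0 x s : 0 <= path_weight x s.
Proof. by elim: s x => //= y s IH x; rewrite mulr_ge0. Qed.

Lemma big_tuple_cons N (f : seq S -> R) :
  \sum_(t : N.+1.-tuple S) f t = \sum_y \sum_(t : N.-tuple S) f (y :: t).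
Proof.
rewrite pair_bigA/= (reindex (fun q : S * N.-tuple S => [tuple of q.1 :: q.2]))//=.
exists (fun t : N.+1.-tuple S => (thead t, [tuple of behead t])) => [[y t] _|t _] /=.
  by congr pair; apply: val_inj.
by rewrite [RHS]tuple_eta.
Qed.

Lemma path_weight_sum1 N x : \sum_(t : N.-tuple S) path_weight x t = 1.
Proof.
elim: N x => [|N IH] x.
  by rewrite (big_pred1 [tuple])//= => t; apply/esym/eqP; exact: tuple0.
rewrite big_tuple_cons /=; under eq_bigr do rewrite -mulr_sumr IH mulr1.
exact: p1.
Qed.

Lemma crosses_partial_sum (x0 x : S) s eta i : (i <= size s)%N ->
  eta <= \sum_(j < i) xi (nth x0 (x :: s) j) (nth x0 (x :: s) j.+1) ->
  crosses eta x s.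
Proof.
elim: s x eta i => [|y s IH] x eta [|i] //=.
- by rewrite big_ord0 => _ ->.
- by rewrite big_ord0 => _ ->.
rewrite ltnS big_ord_recl /= => i_s h; apply/orP; right.
by apply: (IH _ _ i) => //; rewrite lerBlDl.
Qed.

Hypothesis c0 : 0 <= c.
Hypothesis xi_le : forall x y, p x y != 0 -> `|xi x y| <= c.
Hypothesis xi_mean : forall x, \sum_y p x y * xi x y = 0.
Hypothesis lam0 : 0 <= lam.
Hypothesis lamc : lam * c <= 4^-1.

(** [lamc] brings the exponent into the range of [expR_quadratic]; the linear term averages to zero,
    which leaves [1 + lam ^+ 2 * c ^+ 2]. *)
Lemma exp_moment x : \sum_y p x y * expR (lam * xi x y) <= expR (lam ^+ 2 * c ^+ 2).
Proof.
apply: (@le_trans _ _ (\sum_y p x y * (1 + lam * xi x y + lam ^+ 2 * c ^+ 2))).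
  apply: ler_sum => y _; have [->|pn] := eqVneq (p x y) 0; first by rewrite !mul0r.
  rewrite ler_wpM2l//; have h := xi_le pn.
  have h' : `|lam * xi x y| <= 4^-1.
    by rewrite normrM ger0_norm// (le_trans _ lamc)// ler_wpM2l.
  rewrite (le_trans (expR_quadratic h'))// lerD2l exprMn ler_wpM2l ?sqr_ge0//.
  by rewrite -(real_normK (num_real (xi x y))) ler_pXn2r// nnegrE.
under eq_bigr do rewrite !mulrDr mulr1 mulrCA.
rewrite !big_split/= p1 -mulr_sumr xi_mean mulr0 addr0 -mulr_suml p1 mul1r.
by rewrite expR_ge1Dx.
Qed.

(* Backward induction on the horizon: conditioning on the first step multiplies
   the bound by at most [expR (lam ^+ 2 * c ^+ 2)]. *)
Lemma chain_maximal_inequality N x eta :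
  \sum_(t : N.-tuple S) path_weight x t * (crosses eta x t)%:R <=
  expR (- (lam * eta) + N%:R * (lam ^+ 2 * c ^+ 2)).
Proof.
have e0 eta' N' : eta' <= 0 -> 1 <= expR (- (lam * eta') + N'%:R * (lam ^+ 2 * c ^+ 2)).
  move=> h; rewrite -[leLHS]expR0 ler_expR addr_ge0//.
    by rewrite oppr_ge0 mulr_ge0_le0.
  by rewrite mulr_ge0// mulr_ge0 ?sqr_ge0.
elim: N x eta => [|N IH] x eta.
  rewrite (big_pred1 [tuple])/= => [|t]; last by apply/esym/eqP; exact: tuple0.
  rewrite mul1r orbF; have [h|_] := boolP (eta <= 0); last exact: expR_ge0.
  exact: (e0 eta 0%N).
have [h|h] := leP eta 0.
  apply: le_trans (e0 _ _ h); rewrite -[leRHS](path_weight_sum1 N.+1 x).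
  apply: ler_sum => t _; rewrite ler_piMr ?path_weight_ge0//.
  by case: (crosses _ _ _); rewrite ?ler01.
rewrite (big_tuple_cons N (fun t => path_weight x t * (crosses eta x t)%:R))/=.
rewrite [X in (_ <= X)](_ : _ = expR (- (lam * eta) + N%:R * (lam ^+ 2 * c ^+ 2)) *
    expR (lam ^+ 2 * c ^+ 2)); last first.
  by rewrite -expRD; congr expR; rewrite -natr1; ring.
apply: le_trans (ler_wpM2l (expR_ge0 _) (exp_moment x)).
rewrite mulr_sumr; apply: ler_sum => y _.
under eq_bigr do rewrite leNgt h /= -mulrA.
rewrite -mulr_sumr mulrCA ler_wpM2l//.
apply: le_trans (IH y (eta - xi x y)) _.
by rewrite -expRD ler_expR le_eqVlt; apply/orP; left; apply/eqP; ring.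
Qed.

End chain.

(** * Law of the first steps of the flip process *)

Section process_law.
Context {R : realType} (k n : nat) (rule : graph k -> graph k -> R) (G : graph n).
Hypothesis hrule : is_rule rule.
Hypothesis kn : (k <= n)%N.
Context d {S : measurableType d} (Pr : probability S R) (X : nat -> S -> graph n).
Hypothesis hX : flip_process rule G Pr X.
Variable N : nat.
Local Notation p := (flip_transition rule).

Definition trace (s : S) : N.-tuple (graph n) := [tuple X i.+1 s | i < N].

(** [X 0] equals [G] only almost surely and is not recorded by [trace], so the event fixes it
    separately. *)
Definition path_event (t : N.-tuple (graph n)) : set S :=
  [set s | X 0%N s = G /\ trace s = t].

Lemma measurable_state i g : measurable [set s | X i s = g].
Proof. by have [mX _ _] := hX; exact: mX. Qed.

Lemma measurable_prefix m (g : nat -> graph n) :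
  measurable [set s | forall i, (i <= m)%N -> X i s = g i].
Proof.
rewrite (_ : [set s | _] = \bigcap_(i in `I_m.+1) [set s | X i s = g i]); last first.
  by apply/seteqP; split => s h i /=; [move=> im; exact: h|move=> im; apply: h].
by apply: bigcap_measurableType => i _; exact: measurable_state.
Qed.

Lemma path_weight_prod x (s : seq (graph n)) :
  path_weight p x s = \prod_(j < size s) p (nth G (x :: s) j) (nth G (x :: s) j.+1).
Proof.
elim: s x => [|y s IH] x /=; first by rewrite big_ord0.
by rewrite big_ord_recl /= IH.
Qed.

Lemma path_eventE t : path_event t =
  [set s | forall i, (i <= N)%N -> X i s = nth G (G :: t) i].
Proof.
apply/seteqP; split => s /=.
  move=> [X0 <-] [|i] //= iN.
  by rewrite (nth_map (Ordinal iN)) ?size_enum_ord// nth_enum_ord.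
move=> h; split; first exact: (h 0%N).
apply: eq_from_tnth => i; rewrite tnth_mktuple h ?ltn_ord//=.
by rewrite (tnth_nth G).
Qed.

Lemma Pr_path_event t : Pr (path_event t) = (path_weight p G t)%:E.
Proof.
have [_ X0 Xstep] := hX.
rewrite path_eventE path_weight_prod size_tuple.
suff H m : Pr [set s | forall i, (i <= m)%N -> X i s = nth G (G :: t) i] =
    (\prod_(j < m) p (nth G (G :: t) j) (nth G (G :: t) j.+1))%:E by exact: H.
elim: m => [|m IH].
  rewrite big_ord0 -X0; congr (Pr _); apply/seteqP; split => s /=.
    by move=> h; exact: (h 0%N).
  by move=> h [|i].
by rewrite Xstep IH big_ord_recr/= EFinM.
Qed.

Lemma measurable_path_event t : measurable (path_event t).
Proof. by rewrite path_eventE; exact: measurable_prefix. Qed.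

Lemma measurable_trace (Q : N.-tuple (graph n) -> Prop) : measurable [set s | Q (trace s)].
Proof.
rewrite (_ : [set s | _] = \bigcup_(t in [set t | Q t]) [set s | trace s = t]); last first.
  apply/seteqP; split => s /=; first by move=> h; exists (trace s).
  by move=> [t Qt ->].
apply: fin_bigcup_measurable; first exact: finite_finset.
move=> t _; rewrite (_ : [set s | _] = \bigcap_(i in [set: 'I_N]) [set s | X i.+1 s = tnth t i]).
  by apply: fin_bigcap_measurable => [|i _]; [exact: finite_finset|exact: measurable_state].
apply/seteqP; split => s /=.
  by move=> <- i _ /=; rewrite tnth_mktuple.
by move=> h; apply: eq_from_tnth => i; rewrite tnth_mktuple; exact: h.
Qed.

(** Events of distinct paths are disjoint, so the indicator of [Q] dominates the sum of those of the
    paths that have nonzero weight and are not [bad]; their total weight is 1 minus that of the bad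
    paths. *)
Lemma trace_probability (Q : N.-tuple (graph n) -> Prop) (bad : pred (N.-tuple (graph n))) :
  (forall t : N.-tuple (graph n), path_weight p G t != 0 -> ~~ bad t -> Q t) ->
  ((1 - \sum_(t : N.-tuple (graph n)) path_weight p G t * (bad t)%:R)%:E
    <= Pr [set s | Q (trace s)])%E.
Proof.
move=> HQ; have mQ := measurable_trace Q.
rewrite -(fineK (fin_num_measure Pr _ mQ)) lee_fin.
rewrite -(bint_indic Pr mQ).
pose ok (t : N.-tuple (graph n)) := (path_weight p G t != 0) && ~~ bad t.
have b1 t : bmeas (\1_(path_event t) : S -> R).
  by apply: bmeas_indic; exact: measurable_path_event.
apply: (@le_trans _ _ (\int[Pr]_s \sum_(t : N.-tuple (graph n) | ok t) \1_(path_event t) s)).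
  rewrite bint_sum// -[X in X - _](path_weight_sum1 (flip_transition_sum1 hrule kn) N G) -sumrB.
  rewrite [leRHS]big_mkcond/=; apply: ler_sum => t _.
  rewrite /ok; case: eqVneq => [->|_]/=; first by rewrite mul0r subrr.
  case: (bad t); first by rewrite mulr1 subrr.
  by rewrite mulr0 subr0 bint_indic ?Pr_path_event//; exact: measurable_path_event.
apply: bint_le; [exact: bmeas_sum|exact: bmeas_indic|move=> s].
have off t : t != trace s -> (\1_(path_event t) s : R) = 0.
  by move=> tn; rewrite indicE memNset// => -[_ e]; rewrite e eqxx in tn.
have [okt|nokt] := boolP (ok (trace s)); last first.
  rewrite big1 ?indicE ?ler0n// => t okt; apply: off.
  by apply: contraNneq nokt => <-.
rewrite (bigD1 (trace s))//= big1 ?addr0 => [|t /andP[_]]; last exact: off.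
have /andP[w nb] := okt.
rewrite [leRHS]indicE mem_set; last exact: HQ.
by rewrite indicE; case: (_ \in _); rewrite ?ler01.
Qed.

End process_law.

(** * Comparison of a path with the trajectory *)

Section comparison.
Context {R : realType} d {Omega : measurableType d} (mu : probability Omega R).
Variables (k n : nat) (rule : graph k -> graph k -> R) (Om : 'I_n -> set Omega).
Hypothesis hrule : is_rule rule.
Hypothesis kn : (k <= n)%N.
Hypothesis hOm : equipartition mu Om.
Variables (gs : nat -> graph n) (Phi : R -> Omega * Omega -> R).
Hypothesis hPhi : is_trajectory mu rule (graphon_of Om (gs 0%N)) Phi.
Local Notation h := (n%:R ^+ 2)^-1 (only parsing).
Local Notation L := (cut_lipschitz_const k : R).
Local Notation vb := (vel_bound k : R).

(** Change of the form minus its conditional mean given the current graph: a martingale difference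
    of the flip process. *)
Definition increment (al be : 'I_n -> R) (g g' : graph n) : R :=
  bilin (fun u v => adjR g' u v - adjR g u v) al be - bilin (drift rule g) al be.

Let n0 : (0 < n)%N := equipartition_gt0 hOm.
Let nR : (0 : R) < n%:R. Proof. by rewrite ltr0n. Qed.
Let h0 : (0 : R) < h. Proof. by rewrite invr_gt0 exprn_gt0. Qed.
Let hn : h <= n%:R^-1 :> R.
Proof.
rewrite lef_pV2 ?posrE ?exprn_gt0//.
by rewrite expr2 ler_peMr ?ler1n// ltW.
Qed.

Let time0 i : 0 <= i%:R * h :> R.
Proof. by rewrite mulr_ge0// ltW. Qed.

Let start01 z : 0 <= (graphon_of Om (gs 0%N) z : R) <= 1.
Proof. exact: (graphon_of01 hOm). Qed.

Let box_start A B : measurable A -> measurable B ->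
  box_int mu (graphon_of Om (gs 0%N)) A B = box_int mu (Phi 0) A B.
Proof.
move=> mA mB; apply: box_int_ae => //.
- exact: (bmeas_graphon_of hOm).
- exact: (bmeas_Phi hPhi).
by have [_ e _] := hPhi; apply: filterS e => z ->.
Qed.

(** A possible transition changes the test value by at most [npairs k] times the time step [h], and
    the trajectory has speed at most [vb]. This settles the case of large [eps], without any
    probability. *)
Lemma path_lipschitz N A B : measurable A -> measurable B ->
  (forall j, (j < N)%N -> flip_transition rule (gs j) (gs j.+1) != 0) ->
  forall i, (i <= N)%N ->
  `|box_int mu (graphon_of Om (gs i)) A B - box_int mu (Phi (i%:R * h)) A B|
    <= (npairs k + vb) * (i%:R * h).
Proof.
move=> mA mB tr i iN.
have step : `|box_int mu (graphon_of Om (gs i)) A B -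
              box_int mu (graphon_of Om (gs 0%N)) A B| <= npairs k * (i%:R * h).
  elim: i iN => [|i IH] iN; first by rewrite subrr normr0 mul0r mulr0.
  rewrite (_ : _ - _ = (box_int mu (graphon_of Om (gs i.+1)) A B -
      box_int mu (graphon_of Om (gs i)) A B) + (box_int mu (graphon_of Om (gs i)) A B -
      box_int mu (graphon_of Om (gs 0%N)) A B)); last by ring.
  rewrite (le_trans (ler_normD _ _))// -natr1 mulrDl mul1r mulrDr [leRHS]addrC.
  rewrite lerD//; last by apply: IH; exact: ltnW.
  rewrite !(box_graphon hOm mA mB) -mulrBr -bilinB normrM gtr0_norm// mulrC ler_wpM2r ?(ltW h0)//.
  by apply: (jump_norm (rule := rule)); [move=> u; exact: (dens01 hOm _ mA)|move=> u; exact: (dens01 hOm _ mB)|exact: tr].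
have := Phi_box_lipschitz hrule start01 hPhi mA mB (lexx 0) (time0 i).
rewrite subr0 -box_start// => lip.
rewrite (_ : _ - _ = (box_int mu (graphon_of Om (gs i)) A B -
    box_int mu (graphon_of Om (gs 0%N)) A B) - (box_int mu (Phi (i%:R * h)) A B -
    box_int mu (graphon_of Om (gs 0%N)) A B)); last by ring.
rewrite (le_trans (ler_normB _ _))//.
by rewrite mulrDl lerD.
Qed.

Variables (r : R) (N : nat).
Hypothesis r0 : 0 <= r.
Hypothesis small : forall (A B : {set 'I_n}) i, (i <= N)%N ->
  `|\sum_(j < i) increment (ind A) (ind B) (gs j) (gs j.+1)| <= r * n%:R ^+ 2.

(** Collects two errors per unit time, both of order [1/n]: sampling without against with
    replacement, and the Taylor remainder [L * vb * h ^+ 2], which is at most [h * (L * vb / n)] as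
    [h <= n^-1]. *)
Definition sampling_const : R := 2 * npairs k * (k * k)%:R + L * vb.
Local Notation E := (sampling_const / n%:R).

Lemma sampling_const_ge0 : 0 <= sampling_const.
Proof.
apply: addr_ge0; first by rewrite /npairs -!natrM ler0n.
exact: mulr_ge0 (cut_lipschitz_const_ge0 k) (vel_bound_ge0 k).
Qed.

(** Solves [growth i.+1 = growth i + h * ((L + 1) * (growth i + r + E))] from 0. The rate is [L + 1]
    instead of [L] so that the additive error [E] of each step is absorbed. *)
Definition growth i : R := ((1 + (L + 1) * h) ^+ i - 1) * (r + E).

Lemma E_ge0 : 0 <= E.
Proof. by rewrite divr_ge0 ?sampling_const_ge0// ltW. Qed.

Let L1_ge0 : 0 <= (L + 1) * h.
Proof.
apply: mulr_ge0; last exact: ltW.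
by apply: addr_ge0; first exact: cut_lipschitz_const_ge0.
Qed.

Let growth_ge0 i : 0 <= growth i.
Proof.
apply: mulr_ge0; last by apply: addr_ge0; last exact: E_ge0.
by rewrite subr_ge0 exprn_ege1// lerDl.
Qed.

Definition martingale (A B : set Omega) i : R :=
  h * \sum_(j < i) increment (dens mu Om A) (dens mu Om B) (gs j) (gs j.+1).

Section fixed_sets.
Variables A B : set Omega.
Hypotheses (mA : measurable A) (mB : measurable B).
Local Notation al := (dens mu Om A).
Local Notation be := (dens mu Om B).

Local Notation mart := (martingale A B).

Let mart_le i : (i <= N)%N -> `|mart i| <= r.
Proof.
move=> iN; rewrite /martingale normrM (gtr0_norm h0) ler_pdivrMl ?exprn_gt0// mulrC.
(* For a fixed path the sum is one bilinear form in the weights, so the bound for vertex sets passes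
   to fractional weights. *)
pose M u v := \sum_(j < i) ((adjR (gs j.+1) u v - adjR (gs j) u v) - drift rule (gs j) u v).
have ME a b : \sum_(j < i) increment a b (gs j) (gs j.+1) = bilin M a b.
  by rewrite bilin_sum; apply: eq_bigr => j _; rewrite bilinB.
rewrite ME; apply: bilin_norm_max => [u|u|A' B'].
- exact: (dens01 hOm _ mA).
- exact: (dens01 hOm _ mB).
by rewrite -ME small.
Qed.

Let comp_step i : box_int mu (graphon_of Om (gs i.+1)) A B - mart i.+1 =
  box_int mu (graphon_of Om (gs i)) A B - mart i + h * bilin (drift rule (gs i)) al be.
Proof.
rewrite /martingale big_ord_recr/= !(box_graphon hOm mA mB) /increment bilinB; ring.
Qed.

Let drift_velocity i :
  `|bilin (drift rule (gs i)) al be - box_int mu (velocity mu rule (graphon_of Om (gs i))) A B|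
  <= 2 * npairs k * (k * k)%:R / n%:R.
Proof.
rewrite bilin_drift (box_velocity rule hOm mA mB) distrC.
apply: sampling_error => // w; apply: sample_drift_norm => // u.
- exact: (dens01 hOm _ mA).
- exact: (dens01 hOm _ mB).
Qed.

(** Four errors add up: the previous one, drift against velocity, the velocities of the two
    graphons, and the Taylor remainder. The third needs the uncompensated distance on all
    rectangles, where the martingale costs [r]. *)
Lemma compensated_step i : (i <= N)%N ->
  (forall A' B', measurable A' -> measurable B' ->
    `|box_int mu (graphon_of Om (gs i)) A' B' - box_int mu (Phi (i%:R * h)) A' B'|
      <= growth i + r) ->
  `|box_int mu (graphon_of Om (gs i)) A B - mart i - box_int mu (Phi (i%:R * h)) A B|
     <= growth i ->
  `|box_int mu (graphon_of Om (gs i.+1)) A B - mart i.+1 - box_int mu (Phi (i.+1%:R * h)) A B|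
     <= growth i.+1.
Proof.
move=> iN cut IH.
have lip := velocity_cut_ae hrule (bmeas_graphon_of hOm (gs i)) (bmeas_Phi hPhi (time0 i))
  (aeW _ (graphon_of01 hOm (gs i))) (trajectory_graphon hrule start01 hPhi (time0 i)) cut mA mB.
have tay := Phi_box_taylor hrule start01 hPhi mA mB (time0 i) (ltW h0).
have dv := drift_velocity i.
rewrite comp_step -natr1 mulrDl mul1r.
set y := box_int mu (graphon_of Om (gs i)) A B - mart i in IH *.
set f := box_int mu (Phi (i%:R * h)) A B in IH tay *.
set f' := box_int mu (Phi (i%:R * h + h)) A B in tay *.
set D := bilin _ _ _ in dv *.
set VW := box_int mu (velocity mu rule (graphon_of Om (gs i))) A B in dv lip.
set VP := box_int mu (velocity mu rule (Phi (i%:R * h))) A B in lip tay.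
rewrite (_ : y + h * D - f' = (y - f) + h * (D - VW) + h * (VW - VP) - (f' - f - h * VP)); last by ring.
rewrite (le_trans (ler_normB _ _))// (le_trans (lerD (ler_normD _ _) tay))//.
rewrite (le_trans (lerD (lerD (ler_normD _ _) (lexx _)) (lexx _)))//.
rewrite !normrM (gtr0_norm h0).
rewrite (le_trans (lerD (lerD (lerD IH (ler_wpM2l (ltW h0) dv)) (ler_wpM2l (ltW h0) lip)) (lexx _)))//.
have LV : 0 <= L * vb by rewrite mulr_ge0 ?cut_lipschitz_const_ge0 ?vel_bound_ge0.
have LVh : L * vb * h ^+ 2 <= h * (L * vb / n%:R).
  rewrite expr2 mulrCA -[leRHS]/(h * (L * vb * n%:R^-1)) ler_wpM2l// ?(ltW h0)//.
  by rewrite ler_wpM2l.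
have L0 := cut_lipschitz_const_ge0 k (R := R).
have rE : 0 <= growth i + r by rewrite addr_ge0.
have E0 := E_ge0.
have -> : growth i.+1 = growth i + h * ((L + 1) * (growth i + r + E)).
  by rewrite /growth exprS; ring.
rewrite (@le_trans _ _ (growth i + h * (E + L * (growth i + r))))//.
  rewrite -!addrA lerD2l !addrA.
  rewrite (_ : h * (E + _) = h * (2 * npairs k * (k * k)%:R / n%:R) + h * (L * (growth i + r)) + h * (L * vb / n%:R)).
    by rewrite lerD2l.
  by rewrite /sampling_const; ring.
rewrite lerD2l ler_wpM2l ?(ltW h0)//.
have LE : 0 <= L * E by rewrite mulr_ge0.
move: rE LE; set GR := growth i + r; set E' := E; move=> rE LE.
rewrite [leRHS]mulrDl [X in _ <= _ + X]mul1r [X in _ <= X + _]mulrDr; lra.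
Qed.

Lemma compensated_le i : (i <= N)%N ->
  `|box_int mu (graphon_of Om (gs i)) A B - mart i - box_int mu (Phi (i%:R * h)) A B|
     <= growth i ->
  `|box_int mu (graphon_of Om (gs i)) A B - box_int mu (Phi (i%:R * h)) A B|
      <= growth i + r.
Proof.
move=> iN le; set x := box_int _ _ _ _ in le *.
rewrite (_ : x - _ = x - mart i - box_int mu (Phi (i%:R * h)) A B + mart i); last by ring.
by rewrite (le_trans (ler_normD _ _))// lerD// mart_le.
Qed.

End fixed_sets.

Lemma path_close i A B : (i <= N)%N -> measurable A -> measurable B ->
  `|box_int mu (graphon_of Om (gs i)) A B - box_int mu (Phi (i%:R * h)) A B|
    <= expR ((L + 1) * (i%:R * h)) * (r + E).
Proof.
move=> iN mA mB.
(* The induction runs over all rectangles at once, since a step for one of them uses the distance on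
   all. *)
have comp : forall A B, measurable A -> measurable B ->
    `|box_int mu (graphon_of Om (gs i)) A B - martingale A B i -
      box_int mu (Phi (i%:R * h)) A B| <= growth i.
  elim: i iN => [|i IH] iN A' B' mA' mB'.
    rewrite /martingale big_ord0 mulr0 subr0 mul0r box_start// subrr normr0.
    exact: growth_ge0.
  have iN' := ltnW iN.
  apply: compensated_step => //; last exact: IH.
  by move=> A2 B2 mA2 mB2; apply: compensated_le => //; exact: IH.
rewrite (le_trans (compensated_le mA mB iN (comp _ _ mA mB)))//.
have pow : (1 + (L + 1) * h) ^+ i <= expR ((L + 1) * (i%:R * h)).
  rewrite (_ : (L + 1) * (i%:R * h) = i%:R * ((L + 1) * h)); last by ring.
  by rewrite expRM_natl; apply: lerXn2r; rewrite ?nnegrE ?expR_ge0 ?expR_ge1Dx// addr_ge0.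
have E0 := E_ge0.
apply: (@le_trans _ _ ((1 + (L + 1) * h) ^+ i * (r + E))).
  by rewrite /growth mulrBl mul1r; lra.
by rewrite ler_wpM2r// addr_ge0.
Qed.

End comparison.

(** * Conclusion *)

Lemma common_upper_bound (R : realType) (x y z t : R) :
  exists C : R, [/\ x <= C, y <= C, z <= C & t <= C].
Proof.
exists (Num.max (Num.max x y) (Num.max z t)).
by rewrite !le_max !lexx !orbT.
Qed.

(** * Choice of the constant [C] *)

Section constants.
Context {R : realType}.
Variables (L' K0 c E0 C T eps nn : R).
Hypotheses (L'0 : 0 <= L') (K01 : 1 <= K0) (c1 : 1 <= c) (E00 : 0 <= E0).
Hypotheses (CL : 4 * L' <= C) (CK : 2 * K0 <= C) (Cc : 1024 * c ^+ 2 * K0 <= C)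
  (CE : 64 * E0 * K0 ^+ 2 <= C).
Hypotheses (T0 : 0 < T) (eps0 : 0 < eps) (epsT : eps <= K0 * T) (nn0 : 0 <= nn).

Let C0 : 0 < C. Proof. by move: CK K01; lra. Qed.

Lemma square_le_expR (y : R) : 0 <= y -> y ^+ 2 / 4 <= expR y.
Proof.
move=> y0; have -> : expR y = expR (y / 2) ^+ 2.
  by rewrite -expRM_natl; congr expR; field.
have h : y / 2 <= expR (y / 2) by rewrite (le_trans _ (expR_ge1Dx _))// lerDr.
by rewrite (_ : _ / 4 = (y / 2) ^+ 2) ?lerXn2r ?nnegrE ?expR_ge0 ?divr_ge0//; field.
Qed.

Let CT_sq : (C * T) ^+ 2 / 16 <= expR (C * T / 2).
Proof.
have CT0 : 0 <= C * T by rewrite mulr_ge0 ?ltW.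
have := @square_le_expR (C * T / 2) (divr_ge0 CT0 (ler0n _ 2)).
by rewrite (_ : _ / 4 = (C * T) ^+ 2 / 16)//; field.
Qed.

(** From [eps <= K0 * T] and [2 * K0 <= C]. The value 2 pays for the two signs in the union bound,
    and makes the final claim trivial when its exponent is nonnegative. *)
Lemma prefactor_ge2 : 2 <= C * T * expR (C * T) / eps.
Proof.
have E1 : 1 <= expR (C * T) by rewrite -expR0 ler_expR mulr_ge0 ?ltW.
rewrite ler_pdivlMr// (@le_trans _ _ (2 * (K0 * T)))//; first by rewrite ler_wpM2l.
have CT : 2 * K0 * T <= C * T by rewrite ler_wpM2r// ltW.
have CT0 : 0 <= C * T by rewrite mulr_ge0 ?ltW.
by rewrite mulrA (le_trans CT)// ler_peMr.
Qed.

(** After division the claim is [64 * c ^+ 2 * C * eps * T <= expR (C * T - 2 * (L' * T))]. With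
    [eps <= K0 * T] and [Cc] the left side is at most [(C * T) ^+ 2 / 16], hence at most
    [expR (C * T / 2)], and [4 * L' <= C] leaves that much of the exponential. *)
Lemma exponent_le : C * eps ^+ 3 * nn ^+ 2 / expR (C * T) <=
  (eps * expR (- (L' * T)) / 4) ^+ 2 * nn ^+ 2 / (4 * T * c ^+ 2).
Proof.
set a := expR (C * T); set b := expR (- (L' * T)).
have a0 : 0 < a by exact: expR_gt0.
have c0 : 0 < c := lt_le_trans ltr01 c1.
have c20 : 0 < c ^+ 2 by rewrite exprn_gt0.
have key : 64 * c ^+ 2 * C * eps * T <= a * b ^+ 2.
  have -> : a * b ^+ 2 = expR (C * T - 2 * (L' * T)).
    by rewrite /a /b -expRM_natl -expRD; congr expR; ring.
  apply: (@le_trans _ _ (64 * c ^+ 2 * C * (K0 * T) * T)).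
    by rewrite ler_wpM2r ?(ltW T0)// ler_wpM2l// !mulr_ge0// ltW.
  apply: (@le_trans _ _ ((C * T) ^+ 2 / 16)).
    have := ler_wpM2r (mulr_ge0 (ltW C0) (sqr_ge0 T)) Cc.
    rewrite (_ : (C * T) ^+ 2 / 16 = C * (C * T ^+ 2) / 16); last by ring.
    by rewrite (_ : 64 * _ * _ * _ * _ = 1024 * c ^+ 2 * K0 * (C * T ^+ 2) / 16); [lra|field].
  apply: (le_trans CT_sq); rewrite ler_expR.
  have := ler_wpM2r (ltW T0) CL; lra.
rewrite ler_pdivrMr// [leRHS]mulrAC ler_pdivlMr ?mulr_gt0//.
rewrite (_ : (eps * b / 4) ^+ 2 * nn ^+ 2 * a = (a * b ^+ 2) * ((eps * nn) ^+ 2 / 16)); last by field.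
have := ler_wpM2r (divr_ge0 (sqr_ge0 (eps * nn)) (ler0n R 16)) key.
by apply: le_trans; rewrite le_eqVlt; apply/orP; left; apply/eqP; field.
Qed.

(** Trading one factor [nn * eps] for [4 * E0 * expR (L' * T)] leaves a multiple of [nn]; by
    [eps <= K0 * T] and the size of [C] the multiple is at most [expR (C * T)], and [1 <= 2 * ln 2]
    finishes. *)
Lemma exponent_ge0 : nn * eps < 4 * E0 * expR (L' * T) ->
  0 <= 2 * ln 2 * nn - C * eps ^+ 3 * nn ^+ 2 / expR (C * T).
Proof.
move=> small_n; set a := expR (C * T); set b := expR (L' * T) in small_n.
have a0 : 0 < a by exact: expR_gt0.
have b0 : 0 < b by exact: expR_gt0.
(* Equivalent to [expR 2^-1 <= 2], which is [1 - 2^-1 <= expR (- 2^-1)] inverted. *)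
have ln2 : 1 <= 2 * ln 2 :> R.
  rewrite -ler_pdivrMl// mulr1 -ler_expR lnK ?posrE//.
  rewrite -[leRHS]invrK -[leLHS]invrK lef_pV2 ?posrE ?invr_gt0 ?expR_gt0//.
  by rewrite -expRN (le_trans _ (expR_ge1Dx _))//; lra.
have bound : C * eps ^+ 2 * (4 * E0 * b) <= a.
  apply: (@le_trans _ _ ((C * T) ^+ 2 / 16 * b)).
    apply: (@le_trans _ _ (C * (K0 * T) ^+ 2 * (4 * E0 * b))).
      rewrite ler_wpM2r ?mulr_ge0// ?(ltW b0)// ler_wpM2l ?(ltW C0)//.
      have KT0 : 0 <= K0 * T := mulr_ge0 (le_trans ler01 K01) (ltW T0).
      by rewrite lerXn2r ?nnegrE ?(ltW eps0).
    rewrite (_ : C * _ * _ = (64 * E0 * K0 ^+ 2) * (C * T ^+ 2 / 16) * b); last by field.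
    rewrite (_ : (C * T) ^+ 2 / 16 = C * (C * T ^+ 2 / 16)); last by field.
    by rewrite ler_wpM2r ?(ltW b0)// ler_wpM2r// divr_ge0// mulr_ge0 ?sqr_ge0// ltW.
  apply: (le_trans (ler_wpM2r (ltW b0) CT_sq)).
  rewrite /a /b -expRD ler_expR.
  have := ler_wpM2r (ltW T0) CL; have : 0 <= L' * T by rewrite mulr_ge0// ltW.
  by rewrite -mulrA; lra.
rewrite subr_ge0 ler_pdivrMr//.
apply: (@le_trans _ _ (C * eps ^+ 2 * (4 * E0 * b) * nn)).
  rewrite (_ : C * eps ^+ 3 * nn ^+ 2 = C * eps ^+ 2 * (nn * eps) * nn); last by ring.
  by rewrite ler_wpM2r// ler_wpM2l ?(ltW small_n)// mulr_ge0 ?sqr_ge0// ltW.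
apply: (le_trans (ler_wpM2r nn0 bound)); rewrite -[leRHS]mulrA [nn * a]mulrC.
by rewrite ler_peMl// mulr_ge0// ltW.
Qed.

End constants.

Section final.
Context {R : realType} d {Omega : measurableType d} (mu : probability Omega R).
Variables (k n : nat) (rule : graph k -> graph k -> R) (Om : 'I_n -> set Omega).
Hypothesis hrule : is_rule rule.
Hypothesis kn : (k <= n)%N.
Hypothesis hOm : equipartition mu Om.

Lemma cut_norm_graphon_lt (g : graph n) (W : Omega * Omega -> R) (r eps : R) :
  bmeas W -> r < eps ->
  (forall A B, measurable A -> measurable B ->
    `|box_int mu (graphon_of Om g) A B - box_int mu W A B| <= r) ->
  (cut_norm mu (fun z => graphon_of Om g z - W z)%R < eps%:E)%E.
Proof.
move=> bW re H; have bG := bmeas_graphon_of hOm g.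
apply: (@le_lt_trans _ _ r%:E); last by rewrite lte_fin.
apply: cut_norm_le; first exact: bmeasB.
by move=> A B mA mB; rewrite box_intB// H.
Qed.

Lemma increment_norm (al be : 'I_n -> R) g g' :
  (forall u, 0 <= al u <= 1) -> (forall u, 0 <= be u <= 1) ->
  flip_transition rule g g' != 0 -> `|increment rule al be g g'| <= 2 * npairs k.
Proof.
move=> al01 be01 tr; rewrite (le_trans (ler_normB _ _))// mulr_natl mulr2n.
by rewrite lerD ?(jump_norm al01 be01 tr) ?(drift_norm hrule kn).
Qed.

Lemma increment_mean (al be : 'I_n -> R) g :
  \sum_g' flip_transition rule g g' * increment rule al be g g' = 0.
Proof.
under eq_bigr do rewrite mulrBr.
rewrite sumrB -mulr_suml (flip_transition_sum1 hrule kn) mul1r.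
under eq_bigr do rewrite -bilinZ.
by rewrite -bilin_sum subrr.
Qed.

Definition martingale_crosses (N : nat) (eta : R) (G : graph n) (t : N.-tuple (graph n)) :=
  [exists A : {set 'I_n}, [exists B : {set 'I_n},
    crosses (increment rule (ind A) (ind B)) eta G t ||
    crosses (fun g g' => - increment rule (ind A) (ind B) g g') eta G t]].

Lemma martingale_small N eta G (t : N.-tuple (graph n)) :
  ~~ martingale_crosses eta G t -> forall (A B : {set 'I_n}) i, (i <= N)%N ->
  `|\sum_(j < i) increment rule (ind A) (ind B) (nth G (G :: t) j) (nth G (G :: t) j.+1)| <= eta.
Proof.
move=> nc A B i iN; have it : (i <= size t)%N by rewrite size_tuple.
have : ~~ (crosses (increment rule (ind A) (ind B)) eta G t ||
    crosses (fun g g' => - increment rule (ind A) (ind B) g g') eta G t).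
  by apply: contra nc => h; apply/existsP; exists A; apply/existsP; exists B.
rewrite negb_or => /andP[n1 n2]; rewrite ler_norml lerNl; apply/andP; split.
  rewrite leNgt; apply: contra n2 => h; apply: (crosses_partial_sum (x0 := G) it).
  by rewrite sumrN ltW.
rewrite leNgt; apply: contra n1 => h; apply: (crosses_partial_sum (x0 := G) it).
exact: ltW.
Qed.

(** Union bound over the [2 ^ n * 2 ^ n] pairs of vertex sets, whose number is the factor
    [expR (2 * ln 2 * n%:R)], and over the two signs, which give the factor 2. *)
Lemma martingale_crosses_prob N (eta c lam : R) G : 2 * npairs k <= c ->
  0 <= lam -> lam * c <= 4^-1 ->
  \sum_(t : N.-tuple (graph n))
    path_weight (flip_transition rule) G t * (martingale_crosses eta G t)%:R <=
  expR (2 * ln 2 * n%:R) * (2 * expR (- (lam * eta) + N%:R * (lam ^+ 2 * c ^+ 2))).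
Proof.
move=> cK lam0 lamc; set pw := path_weight _.
have p0 := flip_transition_ge0 hrule (n := n).
have c0 : 0 <= c by rewrite (le_trans _ cK)// /npairs -natrM ler0n.
set b := expR (- (lam * eta) + _).
pose f A B (t : N.-tuple (graph n)) : R :=
  (crosses (increment rule (ind A) (ind B)) eta G t)%:R +
  (crosses (fun g g' => - increment rule (ind A) (ind B) g g') eta G t)%:R.
have f0 A B t : 0 <= f A B t by rewrite addr_ge0.
have union t : (martingale_crosses eta G t)%:R <= \sum_A \sum_B f A B t.
  have [/existsP[A /existsP[B h]]|_] := boolP (martingale_crosses eta G t); last first.
    by apply: sumr_ge0 => A _; apply: sumr_ge0.
  rewrite (bigD1 A)//= (bigD1 B)//= -addrA.
  apply: (@le_trans _ _ (f A B t)).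
    by move: h; rewrite /f; case: crosses; case: crosses => //= _; rewrite ?lerDl ?lerDr.
  rewrite lerDl addr_ge0//; first exact: sumr_ge0.
  by apply: sumr_ge0 => A' _; apply: sumr_ge0.
have maxi (xi : graph n -> graph n -> R) :
    (forall g g', flip_transition rule g g' != 0 -> `|xi g g'| <= c) ->
    (forall g, \sum_g' flip_transition rule g g' * xi g g' = 0) ->
    \sum_(t : N.-tuple (graph n)) pw G t * (crosses xi eta G t)%:R <= b.
  move=> h1 h2.
  have := chain_maximal_inequality p0 (flip_transition_sum1 hrule kn) c0 h1 h2 lam0 lamc N G eta.
  exact.
have each A B : \sum_(t : N.-tuple (graph n)) pw G t * f A B t <= 2 * b.
  under eq_bigr do rewrite mulrDr.
  rewrite big_split/= (_ : 2 * b = b + b); last by ring.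
  apply: lerD; apply: maxi => [g g' tr|g].
  - by apply: le_trans cK; apply: increment_norm => // u; exact: ind01.
  - exact: increment_mean.
  - rewrite normrN; apply: le_trans cK.
    by apply: increment_norm => // u; exact: ind01.
  - by under eq_bigr do rewrite mulrN; rewrite sumrN increment_mean oppr0.
apply: (@le_trans _ _ (\sum_(A : {set 'I_n}) \sum_(B : {set 'I_n})
    \sum_(t : N.-tuple (graph n)) pw G t * f A B t)).
  under [leRHS]eq_bigr do rewrite exchange_big/=.
  rewrite [leRHS]exchange_big/=; apply: ler_sum => t _.
  under [leRHS]eq_bigr do rewrite -mulr_sumr.
  by rewrite -mulr_sumr ler_wpM2l// path_weight_ge0.
apply: (@le_trans _ _ (\sum_(A : {set 'I_n}) \sum_(B : {set 'I_n}) (2 * b))).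
  by apply: ler_sum => A _; apply: ler_sum => B _; exact: each.
have cardS : #|{: {set 'I_n}}| = (2 ^ n)%N.
  have <- : #|powerset [set: 'I_n]%SET| = (2 ^ n)%N by rewrite card_powerset cardsT card_ord.
  by apply: eq_card => A; rewrite powersetE finset.subsetT.
rewrite !sumr_const cardS -mulrnA -[leLHS]mulr_natl.
rewrite (_ : (2 ^ n * 2 ^ n)%:R = expR (2 * ln 2 * n%:R))//.
rewrite -expnD addnn -mul2n expnM natrX.
rewrite expRM_natr; congr (_ ^+ n).
by rewrite expRM_natl lnK ?posrE// -natrX.
Qed.

End final.

Lemma nth_trace (n : nat) (G : graph n) d (S : measurableType d)
    (X : nat -> S -> graph n) N (s : S) i :
  (i < N)%N -> nth G (trace X N s) i = X i.+1 s.
Proof. by move=> iN; rewrite (nth_map (Ordinal iN)) ?size_enum_ord// nth_enum_ord. Qed.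

(** The maximum starts at index 1 and so reads only [X 1], ..., [X N]; prepending [G] to the trace
    lines up the indices and makes the event a property of the trace. *)
Lemma max_event_trace (R : realType) (n : nat) (G : graph n) (F : nat -> graph n -> \bar R)
    (e : \bar R) d (S : measurableType d) (X : nat -> S -> graph n) N :
  [set s | (\big[maxe/-oo]_(1 <= i < N.+1) F i (X i s) < e)%E] =
  [set s | (\big[maxe/-oo]_(1 <= i < N.+1) F i (nth G (G :: trace X N s) i) < e)%E].
Proof.
apply/funext => s; congr (is_true (_ < _)%E).
by apply: eq_big_nat => -[|i] iN //; rewrite [nth _ _ _]nth_trace.
Qed.

Theorem theorem5p1 (R : realType) (d : measure_display)
    (Omega : measurableType d) (mu : probability Omega R)
    (hatomless : atomless mu) (hseparable : separable_measure mu) (k : nat) :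
  exists C : R, 0 < C /\
    forall (rule : graph k -> graph k -> R), is_rule rule ->
    forall (n : nat), (k <= n)%N ->
    forall (Om : 'I_n -> set Omega), equipartition mu Om ->
    forall (G : graph n)
      (d' : measure_display) (S : measurableType d') (Pr : probability S R)
      (X : nat -> S -> graph n), flip_process rule G Pr X ->
    forall (Phi : R -> Omega * Omega -> R),
      is_trajectory mu rule (graphon_of Om G) Phi ->
    forall (T eps : R), 0 < T -> 0 < eps ->
    ((1 - C * T * expR (C * T) / eps *
          expR (2 * ln 2 * n%:R - C * eps ^+ 3 * n%:R ^+ 2 / expR (C * T)))%:E
     <= Pr [set s |
          (\big[maxe/-oo]_(1 <= i < (Num.truncn (T * n%:R ^+ 2)%R).+1)
             cut_norm mu (fun z =>
               graphon_of Om (X i s) z - Phi (i%:R / n%:R ^+ 2) z)%R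
           < eps%:E)%E])%E.
Proof.
pose vb : R := vel_bound k; pose L' : R := cut_lipschitz_const k + 1.
(* [K0] is the joint speed of the two graphons, raised to be at least 1. Adding it to the increment
   bound [2 * npairs k] makes [c] at least [K0], which [lamc] will need. *)
pose K0 : R := npairs k + vb + 1; pose c : R := 2 * npairs k + K0.
pose E0 : R := sampling_const k.
have np0 : 0 <= npairs k :> R by rewrite /npairs ler0n.
have vb0 : 0 <= vb by exact: vel_bound_ge0.
have L'0 : 0 <= L' by rewrite /L' addr_ge0// cut_lipschitz_const_ge0.
have E00 : 0 <= E0 by exact: sampling_const_ge0.
have K01 : 1 <= K0 by rewrite /K0 lerDr addr_ge0.
have K00 : 0 <= K0 := le_trans ler01 K01.
have cK : 2 * npairs k <= c by rewrite /c lerDl.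
have cK0 : K0 <= c by rewrite /c lerDr mulr_ge0.
have c1 : 1 <= c := le_trans K01 cK0.
have c0 : 0 < c := lt_le_trans ltr01 c1.
have hvb : npairs k + vb <= K0 by rewrite /K0 lerDl.
have L'E : L' = cut_lipschitz_const k + 1 by [].
have E0E : E0 = sampling_const k by [].
have vbE : vb = vel_bound k by [].
clearbody c K0 E0 L' vb.
have [C [CL CK Cc CE]] := common_upper_bound (4 * L') (2 * K0) (1024 * c ^+ 2 * K0) (64 * E0 * K0 ^+ 2).
have C0 : 0 < C by apply: lt_le_trans CK; rewrite mulr_gt0// (lt_le_trans ltr01).
exists C; split=> // rule hrule n kn Om hOm G d' S Pr X hX Phi hPhi T eps T0 eps0.
set N := Num.truncn _; set B := C * T * _ / _ * _.
have n0 : (0 : R) < n%:R by rewrite ltr0n (equipartition_gt0 hOm).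
have n20 : (0 : R) < n%:R ^+ 2 by rewrite exprn_gt0.
have TN : N%:R <= T * n%:R ^+ 2 by rewrite truncn_le mulr_ge0// ltW.
clearbody N.
have B0 : 0 <= B by rewrite ltW// !mulr_gt0 ?expR_gt0 ?invr_gt0.
have time i : (i <= N)%N -> i%:R / n%:R ^+ 2 <= T.
  by move=> iN; rewrite ler_pdivrMr// (le_trans _ TN)// ler_nat.
have time0 i : 0 <= i%:R / n%:R ^+ 2 :> R by rewrite divr_ge0// ltW.
pose F i (g : graph n) : \bar R :=
  cut_norm mu (fun z => graphon_of Om g z - Phi (i%:R / n%:R ^+ 2) z)%R.
pose Q (t : N.-tuple (graph n)) : Prop :=
  (\big[maxe/-oo]_(1 <= i < N.+1) F i (nth G (G :: t) i) < eps%:E)%E.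
rewrite (max_event_trace G F) -[X in Pr X]/[set s | Q (trace X N s)].
have QI (t : N.-tuple (graph n)) :
    (forall i, (0 < i <= N)%N -> (F i (nth G (G :: t) i) < eps%:E)%E) -> Q t.
  move=> H; rewrite /Q big_nat; apply: (big_ind (fun x => x < eps%:E)%E) => //.
    exact: ltNyr.
  by move=> x y hx hy; rewrite gt_max hx.
have trans (t : N.-tuple (graph n)) : path_weight (flip_transition rule) G t != 0 ->
    forall j, (j < N)%N ->
    flip_transition rule (nth G (G :: t) j) (nth G (G :: t) j.+1) != 0.
  rewrite (path_weight_prod rule G) size_tuple => /prodf_neq0 h j jN.
  exact: (h (Ordinal jN)).
have reduce (bad : pred (N.-tuple (graph n))) :
    (forall t : N.-tuple (graph n), path_weight (flip_transition rule) G t != 0 ->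
      ~~ bad t -> Q t) ->
    \sum_(t : N.-tuple (graph n)) path_weight (flip_transition rule) G t * (bad t)%:R <= B ->
    ((1 - B)%:E <= Pr [set s | Q (trace X N s)])%E.
  move=> h le; apply: le_trans (trace_probability hrule kn hX h).
  by rewrite lee_fin lerD2l lerN2.
have bPhi i : bmeas (Phi (i%:R / n%:R ^+ 2)) := bmeas_Phi hPhi (time0 i).
(* [K0] bounds the joint speed of the two graphons, so for [K0 * T < eps] the
   event is certain. *)
have [KT|KT] := ltP (K0 * T) eps.
  apply: (reduce pred0) => [t pw _|]; last by rewrite big1// => t _; rewrite mulr0.
  apply: QI => i /andP[_ iN].
  apply: (cut_norm_graphon_lt hOm (bPhi i) KT) => A D mA mD.
  have hPhi' : is_trajectory mu rule (graphon_of Om (nth G (G :: t) 0)) Phi by [].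
  apply: (le_trans (path_lipschitz hrule hOm hPhi' mA mD (trans t pw) iN)).
  by rewrite -vbE; apply: ler_pM => //; [exact: addr_ge0|exact: time].
(* For small [n] the claimed lower bound is not positive. *)
have [small_n|large_n] := ltP (n%:R * eps) (4 * E0 * expR (L' * T)).
  apply: (@le_trans _ _ 0%E); last exact: measure_ge0.
  rewrite lee_fin subr_le0 /B.
  have e0 := exponent_ge0 L'0 K01 E00 CL CK CE T0 eps0 KT (ltW n0) small_n.
  have p2 := prefactor_ge2 K01 CK T0 eps0 KT.
  apply: (@le_trans _ _ (2 * 1)); first by rewrite mulr1 ler1n.
  by rewrite ler_pM// -[leLHS]expR0 ler_expR.
(* Chosen so that the Gronwall factor [expR (L' * T)] times [2 * r], one [r] for the martingale and
   one for the sampling error, is [eps / 2]. *)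
pose r := eps * expR (- (L' * T)) / 4.
have r0 : 0 < r by rewrite divr_gt0// mulr_gt0// expR_gt0.
pose eta := r * n%:R ^+ 2.
(* The minimiser of [T * n%:R ^+ 2 * (lam ^+ 2 * c ^+ 2) - lam * eta]. *)
pose lam := eta / (2 * T * n%:R ^+ 2 * c ^+ 2).
have lam0 : 0 <= lam by rewrite divr_ge0// !mulr_ge0// ltW// exprn_gt0.
have rK : r <= K0 * T / 4.
  rewrite ler_wpM2r// (le_trans _ KT)// ler_piMr ?(ltW eps0)//.
  by rewrite -[leRHS]expR0 ler_expR oppr_le0 mulr_ge0// ltW.
(* Here [eps <= K0 * T] and [K0 <= c] enter: the product is [r / (2 * T * c)], at most
   [K0 / (8 * c)]. *)
have lamc : lam * c <= 4^-1.
  rewrite (_ : lam * c = r / (2 * T * c)); last first.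
    by rewrite /lam /eta; field; rewrite !gt_eqF.
  rewrite ler_pdivrMr ?mulr_gt0// (le_trans rK)//.
  have := ler_wpM2r (ltW T0) cK0; have : 0 <= c * T by rewrite mulr_ge0// ltW.
  by lra.
apply: (reduce (martingale_crosses rule eta G)) => [t pw nc|].
  apply: QI => i /andP[_ iN].
  have hPhi' : is_trajectory mu rule (graphon_of Om (nth G (G :: t) 0)) Phi by [].
  have sm := martingale_small nc.
  have close A D : measurable A -> measurable D ->
      `|box_int mu (graphon_of Om (nth G (G :: t) i)) A D -
        box_int mu (Phi (i%:R / n%:R ^+ 2)) A D| <= eps / 2.
    move=> mA mD.
    apply: (le_trans (path_close hrule kn hOm hPhi' (ltW r0) sm iN mA mD)).
    rewrite -L'E -E0E.
    (* [large_n] says precisely that [E0 / n%:R <= r]. *)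
    have rE : r + E0 / n%:R <= 2 * r.
      have e0 : 0 < expR (L' * T) by exact: expR_gt0.
      rewrite mulr_natl mulr2n lerD2l ler_pdivrMr// /r expRN.
      rewrite (_ : _ * n%:R = n%:R * eps / (4 * expR (L' * T))); last by field; rewrite gt_eqF.
      by rewrite ler_pdivlMr ?mulr_gt0// mulrCA mulrA.
    apply: (@le_trans _ _ (expR (L' * T) * (2 * r))).
      rewrite ler_pM ?expR_ge0//; first by rewrite addr_ge0 ?(ltW r0)// divr_ge0// ltW.
      by rewrite ler_expR ler_wpM2l// time.
    by rewrite /r expRN le_eqVlt; apply/orP; left; apply/eqP; field; rewrite gt_eqF// expR_gt0.
  apply: (cut_norm_graphon_lt hOm (bPhi i) _ close).
  by rewrite ltr_pdivrMr// mulr_natr mulr2n ltrDl.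
have h := martingale_crosses_prob hrule kn N eta G cK lam0 lamc.
apply: (le_trans h); rewrite /B [X in _ <= _ * X]expRD.
have p2 := prefactor_ge2 K01 CK T0 eps0 KT.
(* The factor 2 of the union bound is absorbed by the prefactor. *)
rewrite [leRHS]mulrCA ler_wpM2l ?expR_ge0// ler_pM ?expR_ge0//.
rewrite ler_expR.
have ex : C * eps ^+ 3 * n%:R ^+ 2 / expR (C * T) <=
    (eps * expR (- (L' * T)) / 4) ^+ 2 * n%:R ^+ 2 / (4 * T * c ^+ 2).
  exact: (exponent_le n%:R K01 c1 CL CK Cc T0 KT).
rewrite -/r in ex.
have lec : N%:R * (lam ^+ 2 * c ^+ 2) <= T * n%:R ^+ 2 * (lam ^+ 2 * c ^+ 2).
  by rewrite ler_wpM2r// mulr_ge0// sqr_ge0.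
have opt : T * n%:R ^+ 2 * (lam ^+ 2 * c ^+ 2) - lam * eta =
    - (r ^+ 2 * n%:R ^+ 2 / (4 * T * c ^+ 2)).
  by rewrite /lam /eta; field; rewrite !gt_eqF.
rewrite addrC (le_trans (lerD lec (lexx _)))// opt lerN2.
exact: ex.
Qed.
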